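(* Let $n \ge 2$, and let $\mu \in \mathscr{W}(\mathbb{R}^n)$ be a PS measure. For every $\vec{v} \in \mathbb{S}^{n-1}$ and every measurable set $E \subset \mathbb{R}^n$, $$\operatorname{Per}_{\mu}(H_{\mu}(E,\vec{v})) \le \operatorname{Per}_{\mu}(E).$$
   Context: $\mathscr{W}(\mathbb{R}^n)$ is the class of measures $\mu=f\mathcal{L}^n$ whose distribution function (density) $f$ is non-negative and in $L^1(\mathbb{R}^n)\cap W^{1,1}_{\mathrm{loc}}(\mathbb{R}^n)$; $f$ is always taken to be its precise representative (the limit as $r\to0$ of its averages over $B_r(x)$ where this limit exists, $0$ elsewhere). Weighted perimeter: for open $U\subset\mathbb{R}^n$ and measurable $E\subset\mathbb{R}^n$, $$\operatorname{Per}_\mu(E;U)=\sup\left\{\int_{U}\chi_E\big(\operatorname{div}(\phi)f+\phi\cdot\nabla f\big)\,dx:\ \phi\in C^1_c(U;\mathbb{R}^n),\ \|\phi\|_\infty\le 1\right\}\in[0,\infty],$$ and $\operatorname{Per}_\mu(E)=\operatorname{Per}_\mu(E;\mathbb{R}^n)$. $E$ has finite $\mu$-perimeter if $\operatorname{Per}_\mu(E)<\infty$. Generalized Ehrhard symmetrization. In dimension one, for $\mu=f\mathcal{L}^1$ with $0\le f\in L^1(\mathbb{R})$, $\vec v\in\{-1,1\}$ and $E\subset\mathbb{R}$ measurable, $E^s_{\vec v}:=\{x:\vec v\cdot x\ge c\}$, where $c\in\mathbb{R}\cup\{\pm\infty\}$ is the smallest constant such that $\mu(E)=\mu(E^s_{\vec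 v})$. In dimension $n$, for $\vec v\in\mathbb{S}^{n-1}$, let $\pi_{\vec v^\perp}$ be the orthogonal projection onto $\vec v^\perp$, and for $x\in\vec v^\perp$ let $E_x=E\cap\pi_{\vec v^\perp}^{-1}(x)$. Then $E^s_{\vec v}:=\bigcup_{x\in\vec v^\perp}(E_x)^s_{\vec v}$, where the line $\pi_{\vec v^\perp}^{-1}(x)=\{x+t\vec v:t\in\mathbb{R}\}$ is identified with $\mathbb{R}$ (with direction $\vec v$) and $(E_x)^s_{\vec v}$ is the one-dimensional symmetrization with respect to $\mu_x:=f\mathcal{H}^1$ restricted to $\pi_{\vec v^\perp}^{-1}(x)$. (This makes sense for $\mathcal{H}^{n-1}$-a.e. $x$; the exceptional fibers form an $\mathcal{L}^n$-null set. $E^s_{\vec v}$ is $\mathcal{L}^n$-measurable whenever $E$ is.) PS measure: $\mu\in\mathscr{W}(\mathbb{R}^n)$ is a perimeter symmetrization measure (PS measure) if $\operatorname{Per}_\mu(E^s_{\vec v})\le\operatorname{Per}_\mu(E)$ for every $\vec v\in\mathbb{S}^{n-1}$ and every set $E$ of finite $\mu$-perimeter. Half-spaces: for $\vec v\in\mathbb{S}^{n-1}$ and $r\in\mathbb{R}\cup\{\pm\infty\}$, $H(\vec v,r)=\{x\in\mathbb{R}^n:x\cdot\vec v\ge r\}$. For a non-empty $\mathcal{L}^n$-measurable set $E$, $H_\mu(E,\vec v)$ is the largest half-space of the form $H(\vec v,r)$ satisfying $\mu(H(\vec v,r))=\mu(E)$. *)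

(* Defs.v *)
From HB Require Import structures.
From mathcomp Require Import all_boot all_order all_algebra.
From mathcomp Require Import all_classical all_reals all_analysis.
From mathcomp Require Import measurable_realfun.

Set Implicit Arguments.
Unset Strict Implicit.
Unset Printing Implicit Defensive.
Import Order.TTheory GRing.Theory Num.Theory.
Import numFieldNormedType.Exports.

Local Open Scope classical_set_scope.
Local Open Scope ring_scope.

Definition rV_display : measure_display -> measure_display.
Proof. exact. Qed.

Section borel_rV.
Context {R : realType} (n : nat).

Let coord (i : 'I_n) (x : 'rV[R]_n) : measurableTypeR R := x ord0 i.

Let set0_borel : g_sigma_preimage coord set0.
Proof. exact: sigma_algebra0. Qed.

Let setC_borel A : g_sigma_preimage coord A -> g_sigma_preimage coord (~` A).
Proof. exact: sigma_algebraC. Qed.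

Let bigcup_borel (F : _^nat) : (forall i, g_sigma_preimage coord (F i)) ->
  g_sigma_preimage coord (\bigcup_i F i).
Proof. exact: sigma_algebra_bigcup. Qed.

HB.instance Definition _ :=
  @isMeasurable.Build (rV_display R.-ocitv.-measurable.-sigma) 'rV[R]_n
    (g_sigma_preimage coord) set0_borel setC_borel bigcup_borel.

End borel_rV.

Definition cons_rV {R : realType} {n} (p : measurableTypeR R * 'rV[R]_n) :
  'rV[R]_n.+1 := \row_i oapp (p.2 ord0) p.1 (unlift ord0 i).

Lemma measurable_coord {R : realType} n (i : 'I_n) :
  measurable_fun [set: 'rV[R]_n] (fun x => x ord0 i : measurableTypeR R).
Proof.
move=> _ Y mY; rewrite setTI; apply: sub_sigma_algebra => /=.
rewrite -bigcup_seq/=; exists i => /=; first by rewrite mem_index_enum.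
by exists Y => //; rewrite setTI.
Qed.

Lemma measurable_fun_rV {R : realType} d (T : measurableType d) n
    (h : T -> 'rV[R]_n) :
  (forall i, measurable_fun [set: T] (fun t => h t ord0 i : measurableTypeR R)) ->
  measurable_fun [set: T] h.
Proof.
move=> mh.
suff H : <<s \big[setU/set0]_(i < n) preimage_set_system setT
    (fun x : 'rV[R]_n => x ord0 i : measurableTypeR R) measurable >> `<=`
    [set A | measurable (h @^-1` A)].
  by move=> _ A mA; rewrite setTI; exact: H.
apply: smallest_sub.
  split => /=; first by rewrite preimage_set0.
    by move=> A mA; rewrite setTD preimage_setC; exact: measurableC.
  by move=> F mF; rewrite preimage_bigcup; exact: bigcup_measurable.
rewrite -bigcup_seq => A [i _ [B mB <-]] /=.
rewrite setTI; have := mh i measurableT B mB.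
by rewrite setTI.
Qed.

Lemma measurable_cons_rV {R : realType} n : measurable_fun setT (@cons_rV R n).
Proof.
apply: measurable_fun_rV => i; case: (unliftP ord0 i) => [j|] ->.
  rewrite (_ : (fun _ => _) =
      (fun y : 'rV[R]_n => y ord0 j : measurableTypeR R) \o snd); last first.
    by apply/funext => t /=; rewrite mxE liftK.
  by apply: measurableT_comp; [exact: measurable_coord|exact: measurable_snd].
rewrite (_ : (fun _ => _) = fst); first exact: measurable_fst.
by apply/funext => t; rewrite mxE unlift_none.
Qed.

Lemma measurable_cons_rV_inv {R : realType} n : measurable_fun setT
  (fun x : 'rV[R]_n.+1 => (x ord0 ord0 : measurableTypeR R, \row_i x ord0 (lift ord0 i))).
Proof.
apply/measurable_fun_pairP; split; first exact: measurable_coord.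
apply: measurable_fun_rV => i.
rewrite (_ : (fun _ => _) = (fun y : 'rV[R]_n.+1 => y ord0 (lift ord0 i) : measurableTypeR R)).
  exact: measurable_coord.
by apply/funext => t /=; rewrite mxE.
Qed.

Lemma cons_rVK {R : realType} n (p : measurableTypeR R * 'rV[R]_n) :
  ((cons_rV p) ord0 ord0, (\row_i (cons_rV p) ord0 (lift ord0 i))) = p.
Proof.
case: p => a y; congr pair; first by rewrite mxE unlift_none.
by apply/rowP => i; rewrite !mxE liftK.
Qed.

(* The sigma-finiteness is proved from that of the factors because the instance
   of SigmaFiniteMeasure found for [\x] is the one for finite measures. *)
Section cons_measure.
Context {R : realType} (n : nat) (m : {sigma_finite_measure set 'rV[R]_n -> \bar R}).

Let lm : {measure set (measurableTypeR R * 'rV[R]_n)%type -> \bar R} :=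
  (lebesgue_measure \x m)%E.

Definition cons_measure : set 'rV[R]_n.+1 -> \bar R := pushforward lm cons_rV.

Let cons_measure0 : cons_measure set0 = 0%E.
Proof. by rewrite /cons_measure /pushforward preimage_set0 measure0. Qed.

Let cons_measure_ge0 A : (0 <= cons_measure A)%E.
Proof. by rewrite /cons_measure /pushforward measure_ge0. Qed.

Let cons_measure_sigma_additive : semi_sigma_additive cons_measure.
Proof.
move=> F mF tF mUF; rewrite /cons_measure /pushforward preimage_bigcup.
have mpre A : measurable A -> measurable (@cons_rV R n @^-1` A).
  by move=> mA; rewrite -[X in measurable X]setTI; exact: measurable_cons_rV.
apply: measure_semi_sigma_additive => [k||]; first exact: mpre.
  apply/trivIsetP => /= i j _ _ ij; rewrite -preimage_setI.
  by move/trivIsetP : tF => /(_ _ _ _ _ ij) ->//; rewrite preimage_set0.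
by rewrite -preimage_bigcup; exact: mpre.
Qed.

HB.instance Definition _ := isMeasure.Build _ _ _ cons_measure
  cons_measure0 cons_measure_ge0 cons_measure_sigma_additive.

Let cons_measure_sigma_finite : sigma_finite setT cons_measure.
Proof.
have /sigma_finiteP[F [TF ndF mF]] := sigma_finiteT (@lebesgue_measure R).
have /sigma_finiteP[G [TG ndG mG]] := sigma_finiteT m.
pose uncons (x : 'rV[R]_n.+1) :=
  (x ord0 ord0 : measurableTypeR R, \row_i x ord0 (lift ord0 i)).
exists (fun k => uncons @^-1` (F k `*` G k)).
  apply/esym; rewrite -subTset => x _.
  have [i _ Fi] : (\bigcup_k F k) (uncons x).1 by rewrite -TF.
  have [j _ Gj] : (\bigcup_k G k) (uncons x).2 by rewrite -TG.
  exists (maxn i j) => //; split.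
    by move: Fi; exact/subsetPset/ndF/leq_maxl.
  by move: Gj; exact/subsetPset/ndG/leq_maxr.
move=> k; have [mFk Fk] := mF k; have [mGk Gk] := mG k; split.
  rewrite -[X in measurable X]setTI; apply: measurable_cons_rV_inv => //.
  exact: measurableX.
rewrite /cons_measure /pushforward (_ : _ @^-1` _ = F k `*` G k).
  have -> : lm (F k `*` G k) = (lebesgue_measure (F k) * m (G k))%E.
    exact: product_measure1E.
  by rewrite lte_mul_pinfty// ge0_fin_numE.
by rewrite -comp_preimage (_ : _ \o _ = id)//; apply/funext => p; exact: cons_rVK.
Qed.

HB.instance Definition _ := @Measure_isSigmaFinite.Build _ _ _ cons_measure
  cons_measure_sigma_finite.

End cons_measure.

(* Lebesgue measure on the Borel sets of R^n, as an iterated product; see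
   borel_lebesgue_box. *)
Fixpoint borel_lebesgue (R : realType) (n : nat) :
    {sigma_finite_measure set 'rV[R]_n -> \bar R} :=
  if n is m.+1 then cons_measure (borel_lebesgue R m) else \d_(0 : 'rV[R]_0).

Lemma measurable_box {R : realType} n (B : 'I_n -> set (measurableTypeR R)) :
  (forall i, measurable (B i)) ->
  measurable [set x : 'rV[R]_n | forall i, B i (x ord0 i)].
Proof.
move=> mB.
rewrite (_ : [set _ | _] = \big[setI/setT]_(i < n)
    ((fun x : 'rV[R]_n => x ord0 i : measurableTypeR R) @^-1` B i)).
  apply: bigsetI_measurable => i _.
  by rewrite -[X in measurable X]setTI; exact: measurable_coord.
rewrite -bigcap_seq; apply/seteqP; split => x /= H i.
  by move=> _; exact: H.
by apply: H => /=; rewrite mem_index_enum.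
Qed.

Lemma borel_lebesgue_box (R : realType) n (B : 'I_n -> set (measurableTypeR R)) :
  (forall i, measurable (B i)) ->
  borel_lebesgue R n [set x | forall i, B i (x ord0 i)] =
    (\prod_(i < n) lebesgue_measure (B i))%E.
Proof.
elim: n B => [|n IH] B mB.
  by rewrite big_ord0 /= diracE mem_set//= => -[].
rewrite big_ord_recl -IH//= /cons_measure /pushforward.
rewrite -product_measure1E//; last first.
  exact: (@measurable_box _ _ (fun i => B (lift ord0 i))).
congr (_ _)%E; apply/seteqP; split => -[a y] /= => [H|[Ha Hy] i].
  split; first by have := H ord0; rewrite mxE unlift_none.
  by move=> i; have := H (lift ord0 i); rewrite mxE liftK.
by rewrite mxE; case: (unliftP ord0 i) => [j|] -> /=.
Qed.

(* L^n: the outer measure induced by borel_lebesgue, on its Caratheodory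
   (that is, Lebesgue) measurable sets. *)
Definition lebesgueN (R : realType) (n : nat) :=
  @completed_measure_extension _ _ _ (borel_lebesgue R n).
Arguments lebesgueN : clear implicits.
HB.instance Definition _ R n := Measure.on (lebesgueN R n).

Notation lebesgue_type R n := (caratheodory_type (borel_lebesgue R n)^*%mu).
Definition lebesgue_measurable {R : realType} {n} (E : set 'rV[R]_n) :=
  measurable (E : set (lebesgue_type R n)).

Definition density_measure d (T : measurableType d) (R : realType)
    (mu : set T -> \bar R) (f : T -> R) (A : set T) : \bar R :=
  (\int[mu]_(x in A) (f x)%:E)%E.

Section euclidean.
Context {R : realType} {n : nat}.
Implicit Types (x y v : 'rV[R]_n) (f : 'rV[R]_n -> R) (A E U : set 'rV[R]_n).

(* The norm of the library on 'rV[R]_n is the sup norm; it is used only through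
   the topology. Lengths and balls are Euclidean. *)
Definition dotp x y : R := \sum_i x ord0 i * y ord0 i.

Definition enorm x : R := Num.sqrt (dotp x x).

Definition eball x (r : R) : set 'rV[R]_n := [set y | enorm (y - x) < r].

Definition partial (i : 'I_n) f x : R := 'D_(delta_mx ord0 i) f x.

Definition divergence (phi : 'rV[R]_n -> 'rV[R]_n) x : R :=
  \sum_i partial i (fun y => phi y ord0 i) x.

(* C^1_c(U; V), each function being extended by 0 outside U. *)
Definition C1c (V : normedModType R) U (phi : 'rV[R]_n -> V) :=
  [/\ forall x, differentiable phi x,
      forall v, continuous ('D_v phi) &
      exists K, [/\ compact K, K `<=` U & forall x, ~ K x -> phi x = 0]].

Definition loc_integrable f :=
  forall K, compact K -> (lebesgueN R n).-integrable K (EFin \o f).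

Definition weak_gradient f (g : 'rV[R]_n -> 'rV[R]_n) :=
  forall i, loc_integrable (fun x => g x ord0 i) /\
    forall psi : 'rV[R]_n -> R, C1c setT psi ->
      (\int[lebesgueN R n]_x (f x * partial i psi x)%:E =
       - \int[lebesgueN R n]_x (g x ord0 i * psi x)%:E)%E.

Definition W11loc f := loc_integrable f /\ exists g, weak_gradient f g.

(* Any two weak gradients agree almost everywhere, so that integrals do not
   depend on the choice. *)
Definition grad f : 'rV[R]_n -> 'rV[R]_n := xget (fun=> 0) (weak_gradient f).

Definition average f x (r : R) : R :=
  fine (\int[lebesgueN R n]_(y in eball x r) (f y)%:E) /
  fine (lebesgueN R n (eball x r)).

Definition precise_repr f x : R :=
  if `[< cvg (average f x r @[r --> 0^'+]) >]
  then lim (average f x r @[r --> 0^'+]) else 0.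

(* The measure f L^n is represented by its density f, taken to be its precise
   representative. *)
Definition class_W f :=
  [/\ forall x, 0 <= f x,
      (lebesgueN R n).-integrable setT (EFin \o f),
      W11loc f &
      f = precise_repr f].

Definition wmeasure f : set 'rV[R]_n -> \bar R :=
  density_measure (lebesgueN R n) f.

Definition wperimeter f E U : \bar R := ereal_sup
  [set (\int[lebesgueN R n]_(x in U)
          (\1_E x * (divergence phi x * f x + dotp (phi x) (grad f x)))%:E)%E |
   phi in [set phi : 'rV[R]_n -> 'rV[R]_n |
           C1c U phi /\ forall x, enorm (phi x) <= 1]].

End euclidean.

Section symmetrization.
Context {R : realType}.

Definition wmeasure1 (g : R -> R) : set R -> \bar R :=
  density_measure completed_lebesgue_measure g.

Definition ray (c : \bar R) : set R := [set t | (c <= t%:E)%E].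

(* The infimum is attained for a nonnegative integrable weight, see
   symmetral1_measure. Only the direction +1 occurs, since each line is
   parametrized by t |-> x + t *: v. *)
Definition symmetral1 (g : R -> R) (A : set R) : set R :=
  ray (ereal_inf [set c | wmeasure1 g (ray c) = wmeasure1 g A]).

Context {n : nat}.
Implicit Types (x v : 'rV[R]_n) (f : 'rV[R]_n -> R) (E : set 'rV[R]_n).

(* The line through x with direction v is parametrized by arc length, so H^1 on
   it is the image of L^1. *)
Definition symmetral f v E : set 'rV[R]_n :=
  \bigcup_(x in [set x | dotp x v = 0])
    [set x + t *: v | t in
      symmetral1 (fun t => f (x + t *: v)) [set t | E (x + t *: v)]].

Definition PS_measure f :=
  class_W f /\
  forall v E, enorm v = 1 -> lebesgue_measurable E ->
    (wperimeter f E setT < +oo)%E ->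
    (wperimeter f (symmetral f v E) setT <= wperimeter f E setT)%E.

Definition halfspace v (r : \bar R) : set 'rV[R]_n :=
  [set x | (r <= (dotp x v)%:E)%E].

(* The least r gives the largest half-space; the infimum is attained, see
   halfspace_of_measure and halfspace_of_largest. *)
Definition halfspace_of f E v : set 'rV[R]_n :=
  halfspace v (ereal_inf [set r | wmeasure f (halfspace v r) = wmeasure f E]).

End symmetrization.

Section level.
Local Open Scope ereal_scope.
Context d (T : measurableType d) (R : realType) (mu : {measure set T -> \bar R}).
Variables (f : T -> R) (p : T -> R).
Hypothesis f0 : forall x, (0 <= f x)%R.
Hypothesis fi : mu.-integrable setT (EFin \o f).
Hypothesis mp : forall r : R, measurable [set x | (r <= p x)%R].
Hypothesis p0 : forall r : R, mu [set x | p x = r] = 0.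

Local Notation nu := (density_measure mu f).
Let lev (r : \bar R) : set T := [set x | r <= (p x)%:E].

Let nu0 : nu set0 = 0. Proof. exact: integral_set0. Qed.

Let nu_ge0 A : 0 <= nu A.
Proof. by apply: integral_ge0 => x _; rewrite lee_fin. Qed.

Let nu_sigma_additive : semi_sigma_additive nu.
Proof.
move=> F mF tF mUF; rewrite /density_measure integral_bigcup//; last first.
  exact: (integrableS _ _ (subsetT _)).
by apply: is_cvg_ereal_nneg_natsum_cond => n _ _; exact: nu_ge0.
Qed.

HB.instance Definition _ := isMeasure.Build _ _ _ nu nu0 nu_ge0 nu_sigma_additive.

Let mlev r : measurable (lev r).
Proof.
case: r => [r| |]; first exact: mp.
  rewrite (_ : lev _ = set0); first exact: measurable0.
  by apply/seteqP; split => x //=; rewrite /lev/= leNgt ltry.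
rewrite (_ : lev _ = setT); first exact: measurableT.
by apply/seteqP; split => x //= _; rewrite /lev/= leNye.
Qed.

Let lev_oo : lev +oo = set0.
Proof. by apply/seteqP; split => x //=; rewrite /lev/= leNgt ltry. Qed.

Let lev_Noo : lev -oo = setT.
Proof. by apply/seteqP; split => x //= _; rewrite /lev/= leNye. Qed.

Let le_lev r s : r <= s -> lev s `<=` lev r.
Proof. by move=> rs x /=; exact: le_trans. Qed.

Let le_nu r s : r <= s -> nu (lev s) <= nu (lev r).
Proof. by move=> rs; apply: le_measure; rewrite ?inE//; exact: le_lev. Qed.

Let nuT : nu setT < +oo.
Proof.
have /integrableP[_] := fi.
by under eq_integral do rewrite /= ger0_norm//.
Qed.

Let up (r : nat -> \bar R) a : (forall k, r k.+1 <= r k) ->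
  (forall k, nu (lev (r k)) <= a) -> nu (\bigcup_k lev (r k)) <= a.
Proof.
move=> rk ra.
have H : nondecreasing_seq (fun k => lev (r k)).
  by apply/nondecreasing_seqP => k; apply/subsetPset; exact: le_lev.
have c := nondecreasing_cvg_mu (mu := nu) (fun k => mlev (r k))
  (bigcupT_measurable _ (fun k => mlev (r k))) H.
rewrite -(cvg_lim _ c)//; apply: lime_le; first by apply/cvg_ex; eexists; exact: c.
by apply: nearW => k; exact: ra.
Qed.

Let down (r : nat -> \bar R) a : (forall k, r k <= r k.+1) ->
  (forall k, a <= nu (lev (r k))) -> a <= nu (\bigcap_k lev (r k)).
Proof.
move=> rk ra.
have H : nonincreasing_seq (fun k => lev (r k)).
  by apply/nonincreasing_seqP => k; apply/subsetPset; exact: le_lev.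
have c := nonincreasing_cvg_mu (mu := nu) (F := fun k => lev (r k))
  (le_lt_trans (le_measure nu (mem_set (mlev _)) (mem_set measurableT) (@subsetT _ _)) nuT)
  (fun k => mlev (r k)) (bigcapT_measurable (fun k => mlev (r k))) H.
rewrite -(cvg_lim _ c)//; apply: lime_ge; first by apply/cvg_ex; eexists; exact: c.
by apply: nearW => k; exact: ra.
Qed.

Let split_lev (r : R) : lev r%:E =
  \bigcup_k lev (r + k.+1%:R^-1)%:E `|` [set x | p x = r].
Proof.
apply/seteqP; split => x /=; rewrite /lev/= ?lee_fin.
  rewrite le_eqVlt => /predU1P[->|rp]; first by right.
  left; exists (Num.truncn (p x - r)^-1) => //=.
  rewrite lee_fin -lerBrDl invf_ple ?posrE ?subr_gt0// ltW// truncnS_gt//.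
move=> [[k _]|->//]; rewrite /= lee_fin; apply: le_trans.
by rewrite lerDl invr_ge0 ler0n.
Qed.

Lemma level_inf a : 0 <= a <= nu setT ->
  nu (lev (ereal_inf [set r | nu (lev r) = a])) = a.
Proof.
move=> /andP[a0 aT].
pose S := [set r | nu (lev r) <= a]; pose r0 := ereal_inf S.
have below r : r < r0 -> a < nu (lev r).
  move=> rr0; rewrite ltNge; apply/negP => Sr.
  have : r0 <= r by exact: ereal_inf_lbound.
  by rewrite leNgt rr0.
have above r : r0 < r -> nu (lev r) <= a.
  move=> /ereal_inf_lt[s Ss sr]; exact: le_trans (le_nu (ltW sr)) Ss.
have nur0 : nu (lev r0) = a.
  apply/eqP; rewrite eq_le; apply/andP; split.
    move: above; case: r0 {below} => [r| |] above.
    - have -> : nu (lev r%:E) = nu (\bigcup_k lev (r + k.+1%:R^-1)%:E).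
        rewrite (_ : lev r%:E = \bigcup_k lev (r + k.+1%:R^-1)%:E `|` [set x | p x = r]).
          have me : measurable [set x | p x = r].
            rewrite (_ : [set _ | _] = lev r%:E `\` \bigcup_k lev (r + k.+1%:R^-1)%:E).
              by apply: measurableD => //; exact: bigcupT_measurable.
            rewrite split_lev; apply/seteqP; split => x /=.
              move=> pr; split; first by right.
              by move=> [k _]; rewrite /lev/= pr lee_fin gerDl invr_le0 leNgt ltr0n.
            by move=> [[]].
          rewrite measureU0//; first exact: bigcupT_measurable.
          apply: null_set_integral => //.
          by apply: (measurable_int mu); exact: (integrableS _ _ (subsetT _)).
        exact: split_lev.
      apply: up => // k; last by apply: above; rewrite lte_fin ltrDl.
      by rewrite lee_fin lerD2l lef_pV2 ?posrE// ler_nat.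
    - by rewrite lev_oo nu0.
    - have -> : lev -oo = \bigcup_k lev (- k%:R)%:E.
        rewrite lev_Noo; apply/esym; rewrite -subTset => x _.
        exists (Num.truncn `|p x|).+1 => //; rewrite /lev/= lee_fin lerNl.
        by rewrite (le_trans (ler_norm _))// normrN ltW// truncnS_gt.
      apply: up => // k; last by apply: above; rewrite ltNyr.
      by rewrite lee_fin lerN2 ler_nat.
  move: below; case: r0 {above} => [r| |] below.
  - have -> : lev r%:E = \bigcap_k lev (r - k.+1%:R^-1)%:E.
      apply/seteqP; split => x /=.
        move=> rx k _; apply: le_trans rx; rewrite lee_fin gerBl invr_ge0.
        exact: ler0n.
      move=> H; rewrite /lev/= lee_fin; apply/ler_addgt0Pr => e e0.
      have := H (Num.truncn e^-1) I; rewrite /lev/= lee_fin lerBlDr => /le_trans; apply.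
      by rewrite lerD2l invf_ple ?posrE// ltW// truncnS_gt.
    apply: down => // k; last by apply/ltW/below; rewrite lte_fin ltrBlDr ltrDl.
    by rewrite lee_fin lerD2l lerN2 lef_pV2 ?posrE// ler_nat.
  - have -> : lev +oo = \bigcap_k lev (k%:R)%:E.
      rewrite lev_oo; apply/esym; rewrite -subset0 => x /(_ (Num.truncn (p x)).+1 I).
      by rewrite /lev/= lee_fin leNgt truncnS_gt.
    apply: down => // k; last by apply/ltW/below; rewrite ltry.
    by rewrite lee_fin ler_nat.
  - by rewrite lev_Noo.
suff -> : ereal_inf [set r | nu (lev r) = a] = r0 by [].
apply/eqP; rewrite eq_le; apply/andP; split; first exact: ereal_inf_lbound.
apply: le_ereal_inf => r ra; have {}ra : nu (lev r) = a := ra.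
by rewrite /S /mkset ra.
Qed.

End level.

Notation line_type R := (caratheodory_type (wlength (idfun : R -> R))^*%mu).

Section well_defined.
Context {R : realType}.

Lemma measurable_dotp n (v : 'rV[R]_n) :
  measurable_fun setT (fun x : 'rV[R]_n => dotp x v : measurableTypeR R).
Proof.
apply: measurable_sum => i; apply: measurable_funM; last exact: measurable_cst.
exact: measurable_coord.
Qed.

Lemma lebesgueN_borel n (A : set 'rV[R]_n) : measurable A ->
  lebesgue_measurable A /\ lebesgueN R n A = borel_lebesgue R n A.
Proof.
move=> mA; split; first exact: caratheodory_measurable_mu_ext.
exact: measurable_mu_extE.
Qed.

Lemma measurable_hyperplane n (v : 'rV[R]_n) r :
  measurable [set x : 'rV[R]_n | dotp x v = r].
Proof.
rewrite -[X in measurable X]setTI.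
exact: (measurable_dotp v measurableT (measurable_set1 r)).
Qed.

Lemma hyperplane_null n (v : 'rV[R]_n) r : v != 0 ->
  borel_lebesgue R n [set x | dotp x v = r] = 0%E.
Proof.
elim: n v r => [|n IH] v r v0.
  by move: v0; rewrite (_ : v = 0) ?eqxx//; apply/rowP => -[].
pose w : 'rV[R]_n := \row_i v ord0 (lift ord0 i).
have dE a y : dotp (cons_rV (a, y)) v = a * v ord0 ord0 + dotp y w.
  rewrite /dotp big_ord_recl !mxE unlift_none/=; congr (_ + _).
  by apply: eq_bigr => i _; rewrite !mxE liftK.
rewrite /= /cons_measure /pushforward /product_measure1.
have [w0|w0] := eqVneq w 0; last first.
  apply: integral0_eq => a _ /=.
  rewrite -[RHS](IH w (r - a * v ord0 ord0) w0); congr (borel_lebesgue R n _).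
  apply/seteqP; split => y; rewrite /xsection/= inE/= dE.
    by move=> <-; rewrite addrC addKr.
  by move=> ->; rewrite addrC subrK.
have v00 : v ord0 ord0 != 0.
  apply: contra v0 => /eqP v00; apply/eqP/rowP => i; rewrite [RHS]mxE.
  case: (unliftP ord0 i) => [j|] -> //.
  by have /rowP/(_ j) := w0; rewrite !mxE.
rewrite (_ : _ @^-1` _ = [set r / v ord0 ord0] `*` setT); last first.
  have d0 y : dotp y w = 0.
    by rewrite w0 /dotp big1// => i _; rewrite mxE mulr0.
  apply/seteqP; split => -[a y]; rewrite /= dE d0 addr0.
    by move=> <-; split => //; rewrite mulfK.
  by move=> [-> _]; rewrite divfK.
transitivity (lebesgue_measure [set (r / v ord0 ord0)%R] * borel_lebesgue R n setT)%E.
  exact: product_measure1E.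
by rewrite lebesgue_measure_set1 mul0e.
Qed.

Context {n : nat}.
Implicit Types (v : 'rV[R]_n) (f : 'rV[R]_n -> R) (E : set 'rV[R]_n).

Lemma halfspace_of_measure f E v : class_W f -> enorm v = 1 ->
  lebesgue_measurable E -> wmeasure f (halfspace_of f E v) = wmeasure f E.
Proof.
move=> [f0 fi _ _] v1 mE.
have v0 : v != 0.
  apply/eqP => v0; move: v1; rewrite v0 /enorm /dotp big1 ?sqrtr0.
    by move/eqP; rewrite eq_sym oner_eq0.
  by move=> i _; rewrite mxE mulr0.
apply: (@level_inf _ (lebesgue_type R n) _ (lebesgueN R n) f (fun x => dotp x v)) => //.
- move=> r; apply: (lebesgueN_borel _).1.
  rewrite -[X in measurable X]setTI.
  have := measurable_dotp v measurableT (measurable_itv `[r, +oo[).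
  by under eq_set do rewrite /= in_itv/= andbT.
- move=> r; rewrite -[RHS](hyperplane_null r v0).
  exact: (lebesgueN_borel (measurable_hyperplane v r)).2.
- apply/andP; split; first by apply: integral_ge0 => x _; rewrite lee_fin.
  apply: ge0_subset_integral => //; first exact: (measurable_int (lebesgueN R n)).
  by move=> x _; rewrite lee_fin.
Qed.

Lemma halfspace_of_largest f E v r :
  wmeasure f (halfspace v r) = wmeasure f E ->
  halfspace v r `<=` halfspace_of f E v.
Proof. by move=> rE x /=; apply: le_trans; exact: ereal_inf_lbound. Qed.

Lemma symmetral1_measure (g : R -> R) (A : set R) :
  (forall t, 0 <= g t) ->
  (@completed_lebesgue_measure R).-integrable setT (EFin \o g) ->
  measurable (A : set (line_type R)) ->
  wmeasure1 g (symmetral1 g A) = wmeasure1 g A.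
Proof.
move=> g0 gi mA.
have mB (B : set R) : measurable (B : set (measurableTypeR R)) ->
    measurable (B : set (line_type R)) /\
    completed_lebesgue_measure B = lebesgue_measure B.
  by move=> mB; split => //; exact: sub_caratheodory.
apply: (@level_inf _ (line_type R) _ (@completed_lebesgue_measure R) g idfun) => //.
- move=> r; apply: (mB _ _).1.
  have := measurable_itv `[r, +oo[.
  by under eq_set do rewrite /= in_itv/= andbT.
- by move=> r; rewrite -[RHS](lebesgue_measure_set1 r); exact: (mB [set r] (measurable_set1 r)).2.
- apply/andP; split; first by apply: integral_ge0 => x _; rewrite lee_fin.
  apply: ge0_subset_integral => //; first exact: (measurable_int (@completed_lebesgue_measure R)).
  by move=> x _; rewrite lee_fin.
Qed.

End well_defined.

(* Main.v *)
Require Import Defs.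
From mathcomp Require Import all_boot all_order all_algebra.
From mathcomp Require Import all_classical all_reals all_analysis.
From mathcomp Require Import measurable_realfun.
From mathcomp Require Import ring lra.

Set Implicit Arguments.
Unset Strict Implicit.
Unset Printing Implicit Defensive.
Import Order.TTheory GRing.Theory Num.Theory.
Import numFieldNormedType.Exports.

Local Open Scope classical_set_scope.
Local Open Scope ring_scope.

(** Write mu for the measure of density f and H for the half-space of normal v
    with the mass of E, and suppose that E has finite perimeter. The half-space
    is reached from E by symmetrizing again and again, in directions chosen
    along the way, and then passing to the limit.

    _A symmetrization brings E closer to H_. Let w be a direction with w.v > 0.
    A line of direction w meets both H and the symmetral of E in rays that point
    the same way. Two such rays are nested, so on each line the symmetral loses
    nothing of the mass that E had in H, and gains at least the smaller of the
    masses of E \ H and H \ E on that line ([symmetral1_ray],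
    [push_along_mass]).

    _A direction with a definite gain exists_. Suppose that E \ H, hence also
    H \ E, has mass at least a. Most of mu lives on a bounded set where f is
    between 1/M and M, so the parts of E \ H and H \ E in that set have volume
    bounded below. By Fubini some translation z maps a set of definite volume
    from the first part into the second ([overlap]). It moves points from outside
    H into H, so z.v > 0, and symmetrizing in the direction of z gains a mass d
    that depends on a only ([exists_gain]). As mu is finite this can happen
    finitely often: for every e, after finitely many symmetrizations, none of
    which increases the perimeter, a set E' is obtained with
    mu(E' \ H) = mu(H \ E') < e ([PS_approx_halfspace]).

    _The perimeter is lower semicontinuous_. For a test field phi the function
    G = div(phi) f + phi.grad(f) is integrable and vanishes almost everywhere
    where f does. Then |G| <= m f up to a part of small integral ([domination]),
    so that the integral of G over E' tends to the one over H as mu(E' \ H) and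
    mu(H \ E') tend to 0 ([integral_stable]), and the supremum over phi gives the
    theorem.

    _The weak gradient vanishes on the zero set_ ([weak_partial_zero_set]). Let
    theta be a smooth approximation of the indicator of a bounded part A of
    {f = 0}, and let a(s) be the integral of f(x) theta(x + s e_i). Then a >= 0,
    while a(0) is almost 0, so that the slope of a is not very negative somewhere
    to the right of 0, nor very positive somewhere to the left. This slope is
    minus the integral of (d_i f)(x) theta(x + s e_i), which is for all small s
    close to minus the integral of d_i f over A.
    Hence d_i f integrates to 0 over every such A. *)

(** * Translation invariance of Lebesgue measure *)

Section translation.
Context {R : realType}.
Local Notation leb := (@lebesgue_measure R).

Lemma measurable_addr (t : R) :
  measurable_fun setT (fun s : measurableTypeR R => s + t : measurableTypeR R).
Proof. by apply: measurable_funD => //; exact: measurable_cst. Qed.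

Lemma lebesgue_measure_translation (t : R) (A : set R) :
  measurable (A : set (measurableTypeR R)) ->
  pushforward leb (fun s : measurableTypeR R => s + t : measurableTypeR R) A =
  leb A.
Proof.
move=> mA; apply/esym/lebesgue_measure_unique => //=; first exact: measurable_addr.
move=> _ _ [[a b]] _ <-; rewrite /pushforward.
have -> : (fun s : R => s + t) @^-1` `]a, b] = `]a - t, b - t]%classic.
  by apply/seteqP; split => s /=; rewrite !in_itv/= ltrBlDr lerBrDr.
rewrite !lebesgue_measure_itv/= !lte_fin ltrD2r; case: ifP => // _.
by congr (_%:E); ring.
Qed.

Lemma ge0_integral_translation (t : R) (k : R -> \bar R) :
  measurable_fun setT (k : measurableTypeR R -> \bar R) ->
  (forall s, (0 <= k s)%E) ->
  (\int[leb]_s k (s + t)%R = \int[leb]_s k s)%E.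
Proof.
move=> mk k0.
have := @ge0_integral_pushforward _ _ _ _ R _ (measurable_addr t) leb setT k measurableT
  mk (fun y _ => k0 y).
rewrite preimage_setT => <-.
by apply: eq_measure_integral => //= [|_ A mA _]; [exact: measurable_addr|exact: lebesgue_measure_translation].
Qed.

Lemma measurable_addrV n (z : 'rV[R]_n) :
  measurable_fun setT (fun x : 'rV[R]_n => x + z).
Proof.
apply: measurable_fun_rV => i.
under eq_fun do rewrite mxE.
by apply: measurable_funD; [exact: measurable_coord|exact: measurable_cst].
Qed.

(** By induction on the dimension: the last n coordinates are translated inside
    the sections, then the first one in the outer integral. *)
Lemma borel_lebesgue_translation n (z : 'rV[R]_n) (A : set 'rV[R]_n) :
  measurable A ->
  borel_lebesgue R n ((fun x => x + z) @^-1` A) = borel_lebesgue R n A.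
Proof.
elim: n z A => [|n IH] z A mA.
  congr (borel_lebesgue R 0 _); apply/seteqP; split => x /=;
  by rewrite (_ : x + z = x)//; apply/rowP => -[].
pose z' : 'rV[R]_n := \row_i z ord0 (lift ord0 i).
have cE a y : cons_rV (a, y) + z = cons_rV (a + z ord0 ord0, y + z').
  apply/rowP => i; rewrite !mxE; case: (unliftP ord0 i) => [j|] -> /=.
    by rewrite !mxE.
  by [].
have mpre (B : set 'rV[R]_n.+1) : measurable B -> measurable (@cons_rV R n @^-1` B).
  by move=> mB; rewrite -[X in measurable X]setTI; exact: measurable_cons_rV.
pose k (a : R) := borel_lebesgue R n (xsection (@cons_rV R n @^-1` A) a).
transitivity (\int[leb]_a k (a + z ord0 ord0)%R)%E.
  rewrite /= /cons_measure /pushforward /product_measure1.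
  apply: eq_integral => a _ /=; rewrite /k -[RHS](IH z'); last first.
    exact: (measurable_xsection _ (mpre _ mA)).
  congr (borel_lebesgue R n _); apply/seteqP; split => y;
  by rewrite /xsection /= !inE/= cE.
rewrite ge0_integral_translation//.
exact: (measurable_fun_xsection _ (mpre _ mA)).
Qed.

Lemma ge0_integral_translationV n (z : 'rV[R]_n) (k : 'rV[R]_n -> \bar R) :
  measurable_fun setT k -> (forall x, (0 <= k x)%E) ->
  (\int[borel_lebesgue R n]_x k (x + z)%R = \int[borel_lebesgue R n]_x k x)%E.
Proof.
move=> mk k0.
have := @ge0_integral_pushforward _ _ _ _ R _ (measurable_addrV z)
  (borel_lebesgue R n) setT k measurableT mk (fun y _ => k0 y).
rewrite preimage_setT => <-.
by apply: eq_measure_integral => //= [|_ A mA _];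
  [exact: measurable_addrV|exact: borel_lebesgue_translation].
Qed.

End translation.

(** * Borel versions of Lebesgue measurable sets and functions *)

Section completion.
Local Open Scope ereal_scope.
Context d (T : measurableType d) (R : realType).
Variable m : {sigma_finite_measure set T -> \bar R}.
Local Notation cT := (caratheodory_type (m^*)%mu).
Local Notation cm := (@completed_measure_extension _ _ _ m).

Let mu_extE (A : set T) : measurable A -> (m^*)%mu A = m A.
Proof. exact: measurable_mu_extE. Qed.

Lemma borel_hull (X : set T) :
  exists F, [/\ measurable F, X `<=` F & m F = (m^*)%mu X].
Proof.
have [Xoo|Xoo] := eqVneq ((m^*)%mu X) +oo.
  exists setT; split => //; apply/eqP; rewrite eq_le Xoo leey/= -Xoo.
  rewrite -(mu_extE measurableT).
  exact: le_mu_ext.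
have fX : (m^*)%mu X \is a fin_num by rewrite ge0_fin_numE ?mu_ext_ge0// ltey.
have H k : exists F, [/\ measurable F, X `<=` F &
    m F <= (m^*)%mu X + (k.+1%:R^-1)%:E].
  have [] := @lb_ereal_inf_adherent _ _ (k.+1%:R^-1)%R _ fX => //.
  move=> _ [A [mA XA] <-] /ltW Ak; exists (\bigcup_i A i); split => //.
    exact: bigcupT_measurable.
  apply: le_trans Ak; apply: measure_sigma_subadditive => //.
  exact: bigcupT_measurable.
have {}[F /all_and3[mF XF Fk]] := choice H.
exists (\bigcap_k F k); split.
- exact: bigcapT_measurable.
- by move=> x Xx k _; exact: XF.
- apply/eqP; rewrite eq_le; apply/andP; split.
    apply/lee_addgt0Pr => e e0.
    apply: (@le_trans _ _ (m (F (Num.truncn e^-1)))).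
      apply: le_measure; rewrite ?inE//; first exact: bigcapT_measurable.
      exact: bigcap_inf.
    apply: (le_trans (Fk _)); rewrite leeD2l// lee_fin.
    by rewrite invf_ple ?posrE// ltW// truncnS_gt.
  rewrite -mu_extE; last exact: bigcapT_measurable.
  by apply: le_mu_ext => x Xx k _; exact: XF.
Qed.

Lemma null_hull (X : set T) : (m^*)%mu X = 0 ->
  exists N, [/\ measurable N, X `<=` N & m N = 0].
Proof. by move=> X0; have [F [mF XF FX]] := borel_hull X; exists F; rewrite FX. Qed.

(** On each piece of a sigma-finite cover, a measurable set differs from a Borel
    hull of it by a null set, which has itself a Borel null hull. Removing the
    union of these hulls leaves a Borel set. *)
Lemma measurable_completion (E : set T) : measurable (E : set cT) ->
  exists N, [/\ measurable N, m N = 0 & measurable (E `\` N)].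
Proof.
move=> mE; have [S US mS] := sigma_finiteT m.
have mSc k : measurable (S k : set cT).
  exact: caratheodory_measurable_mu_ext (mS k).1.
have H k : exists FN : set T * set T, [/\ measurable FN.1, measurable FN.2,
    m FN.2 = 0, E `&` S k `<=` FN.1 & FN.1 `\` (E `&` S k) `<=` FN.2].
  have [F [mF EF FE]] := borel_hull (E `&` S k).
  have mFc : measurable (F : set cT) by exact: caratheodory_measurable_mu_ext.
  have mESk : measurable (E `&` S k : set cT) by exact: measurableI.
  have ESkoo : cm (E `&` S k) < +oo.
    have [mSk Sk] := mS k.
    have : (m^*)%mu (S k) < +oo by rewrite mu_extE.
    by apply: le_lt_trans; apply: le_mu_ext; exact: subIsetr.
  have FE0 : (m^*)%mu (F `\` (E `&` S k)) = 0.
    have Foo : cm F < +oo by rewrite [X in X < _](mu_extE mF) FE.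
    have := @measureD _ cT _ cm _ _ mFc mESk Foo; rewrite (setIidr EF) => e.
    transitivity (cm F - cm (E `&` S k)); first exact: e.
    rewrite [X in X - _](mu_extE mF) FE subee//.
    by rewrite ge0_fin_numE ?mu_ext_ge0.
  by have [N [mN FN N0]] := null_hull FE0; exists (F, N); split.
have {H}[FN /(_ _)H] := choice H.
pose N := \bigcup_k (FN k).2; exists N.
have mN : measurable N by apply: bigcupT_measurable => k; have [] := H k.
split => //.
  apply/eqP; rewrite eq_le measure_ge0 andbT.
  have mFN k : measurable (FN k).2 by have [] := H k.
  apply: (le_trans (measure_sigma_subadditive m mFN mN _)) => //.
  by rewrite eseries0// => k _ _; have [] := H k.
rewrite (_ : E `\` N = (\bigcup_k (FN k).1) `\` N).
  apply: measurableD => //; apply: bigcupT_measurable => k; by have [] := H k.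
apply/seteqP; split => x [Ex Nx]; split => //.
  have [k _ Skx] : (\bigcup_k S k) x by rewrite -US.
  by have [_ _ _ sub _] := H k; exists k => //; exact: sub.
have [k _ Fx] := Ex; have [_ _ _ _ sub] := H k.
apply: contrapT => nEx; apply: Nx; exists k => //; apply: sub; split => //.
by move=> [].
Qed.

(** A function is determined by its countably many superlevel sets at rational
    heights; the exceptional sets of these are removed together. *)
Lemma measurable_fun_completion (f : T -> R) : (forall x, 0 <= f x)%R ->
  measurable_fun setT (f : cT -> R) ->
  exists N, [/\ measurable N, m N = 0 &
    measurable_fun setT (fun x => f x * \1_(~` N) x)%R].
Proof.
move=> f0 mf.
pose q k : R := ratr (odflt 0%R (unpickle k) : rat).
pose E k : set T := [set x | q k < f x]%R.
have mE k : measurable (E k : set cT).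
  rewrite -[X in measurable X]setTI.
  by have := mf measurableT _ (measurable_itv `](q k), +oo[);
     under eq_set do rewrite /= in_itv/= andbT.
have {}[N /all_and3[mN N0 mEN]] := choice (fun k => measurable_completion (mE k)).
pose NN := \bigcup_k N k; exists NN.
have mNN : measurable NN by exact: bigcupT_measurable.
split => //.
  apply/eqP; rewrite eq_le measure_ge0 andbT.
  apply: (le_trans (measure_sigma_subadditive _ mN mNN _)) => //.
  by rewrite eseries0// => k _ _; exact: N0.
apply: (measurability _ (RGenOInfty.measurableE R)) => //.
move=> _ [_ [a ->] <-]; rewrite setTI.
have [a0|a0] := ltP a 0%R.
  rewrite (_ : _ @^-1` _ = setT)//; apply/seteqP; split => x //= _.
  by rewrite in_itv/= andbT (lt_le_trans a0)// mulr_ge0.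
rewrite (_ : _ @^-1` _ = \bigcup_k (if (a <= q k)%R then (E k `\` N k) `\` NN else set0)).
  apply: bigcupT_measurable => k; case: ifP => // _; exact: measurableD.
apply/seteqP; split => x /=.
  rewrite in_itv/= andbT indicE; have [xN|xN] := boolP (x \in _); last first.
    by rewrite mulr0 ltNge a0.
  rewrite mulr1 => /rat_in_itvoo[r]; rewrite in_itv/= => /andP[ar rf].
  have qr : q (pickle r) = ratr r by rewrite /q pickleK.
  exists (pickle r) => //; rewrite qr (ltW ar).
  move: xN; rewrite inE => xN; split => //; split; first by rewrite /E/= qr.
  by move=> Nx; apply: xN; exists (pickle r).
move=> [k _]; case: ifP => // aq [[Ex _] Nx].
by rewrite in_itv/= andbT indicE mem_set// mulr1 (le_lt_trans aq).
Qed.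

(** The identity pushes the completed measure forward to the original one. *)
Lemma ge0_integral_completion (D : set T) (k : T -> \bar R) :
  measurable D -> measurable_fun D k -> (forall x, D x -> 0 <= k x) ->
  \int[cm]_(x in D) k x = \int[m]_(x in D) k x.
Proof.
move=> mD mk k0.
have mid : measurable_fun setT (idfun : cT -> T).
  by move=> _ A mA; rewrite setTI; exact: caratheodory_measurable_mu_ext.
have := @ge0_integral_pushforward _ _ _ _ R _ mid cm D k mD mk.
rewrite preimage_id => <-; last by move=> x; rewrite inE; exact: k0.
apply: eq_measure_integral => //= A mA _.
by rewrite /pushforward preimage_id; exact: mu_extE.
Qed.

End completion.

(** * Slicing along a direction *)

Section dotp_theory.
Context {R : realType} {n : nat}.
Implicit Types (x y z : 'rV[R]_n).

Lemma dotpDl x y z : dotp (x + y) z = dotp x z + dotp y z.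
Proof. by rewrite /dotp -big_split/=; apply: eq_bigr => i _; rewrite mxE mulrDl. Qed.

Lemma dotpZl a x z : dotp (a *: x) z = a * dotp x z.
Proof. by rewrite /dotp big_distrr/=; apply: eq_bigr => i _; rewrite mxE mulrA. Qed.

Lemma dotpC x y : dotp x y = dotp y x.
Proof. by apply: eq_bigr => i _; rewrite mulrC. Qed.

Lemma dotp_ge0 x : 0 <= dotp x x.
Proof. by apply: sumr_ge0 => i _; rewrite -expr2 sqr_ge0. Qed.

Lemma dotp_eq0 x : dotp x x = 0 -> x = 0.
Proof.
move=> /eqP; rewrite psumr_eq0; last by move=> i _; rewrite -expr2 sqr_ge0.
move=> /allP x0; apply/rowP => i; apply/eqP.
by have := x0 i (mem_index_enum _); rewrite /= mulf_eq0 orbb mxE.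
Qed.

Lemma enorm1_dotp x : enorm x = 1 -> dotp x x = 1.
Proof. by move=> x1; rewrite -[dotp x x]sqr_sqrtr ?dotp_ge0// -/(enorm x) x1 expr1n. Qed.

Lemma enorm_gt0 x : x != 0 -> 0 < enorm x.
Proof.
move=> x0; rewrite sqrtr_gt0 lt0r dotp_ge0 andbT.
by apply: contra x0 => /eqP/dotp_eq0 ->.
Qed.

Lemma enormZ a x : enorm (a *: x) = `|a| * enorm x.
Proof. by rewrite /enorm dotpZl dotpC dotpZl mulrA -expr2 sqrtrM ?sqr_ge0// sqrtr_sqr. Qed.

End dotp_theory.

Lemma ge0_integral_eq0_null d (T : measurableType d) (R : realType)
    (m : {measure set T -> \bar R}) (h : T -> \bar R) :
  measurable_fun setT h -> (forall x, 0 <= h x)%E -> (\int[m]_x h x = 0)%E ->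
  m [set x | h x != 0%E] = 0%E.
Proof.
move=> mh h0 ih.
have /(ae_eq_integral_abs m measurableT mh)[N [mN N0 sN]] : (\int[m]_x `|h x| = 0)%E.
  by under eq_integral do rewrite gee0_abs//.
apply: (subset_measure0 _ mN _ N0).
  by rewrite -[X in measurable X]setTI; exact: emeasurable_neq.
by move=> x /eqP hx; apply: sN => /= /(_ I).
Qed.

Section line_integral.
Context {R : realType} {n : nat}.
Variable w : 'rV[R]_n.
Local Notation leb := (@lebesgue_measure R).
Local Notation L := (borel_lebesgue R n).
Implicit Types (k : 'rV[R]_n -> \bar R).

Definition line_integral k (x : 'rV[R]_n) : \bar R := (\int[leb]_s k (x + s *: w)%R)%E.

Lemma measurable_line_pair : measurable_fun setT
  (fun p : 'rV[R]_n * measurableTypeR R => p.1 + p.2 *: w).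
Proof.
apply: measurable_fun_rV => i.
under eq_fun do rewrite !mxE.
apply: measurable_funD.
  by apply: (measurableT_comp (measurable_coord i)); exact: measurable_fst.
apply: measurable_funM; [exact: measurable_snd|exact: measurable_cst].
Qed.

Lemma measurable_line (x : 'rV[R]_n) :
  measurable_fun setT (fun s : measurableTypeR R => x + s *: w).
Proof.
apply: measurable_fun_rV => i.
under eq_fun do rewrite !mxE.
apply: measurable_funD; first exact: measurable_cst.
by apply: measurable_funM => //; exact: measurable_cst.
Qed.

Lemma measurable_line_integral k : measurable_fun setT k ->
  (forall x, (0 <= k x)%E) -> measurable_fun setT (line_integral k).
Proof.
move=> mk k0.
have := @measurable_fun_fubini_tonelli_F _ _ 'rV[R]_n (measurableTypeR R) R leb
  (fun p => k (p.1 + p.2 *: w)); apply => //.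
exact: (measurableT_comp mk measurable_line_pair).
Qed.

Lemma line_integral_ge0 k x : (forall x, (0 <= k x)%E) -> (0 <= line_integral k x)%E.
Proof. by move=> k0; exact: integral_ge0. Qed.

Lemma line_integral_shift k x t : measurable_fun setT k -> (forall x, (0 <= k x)%E) ->
  line_integral k (x + t *: w) = line_integral k x.
Proof.
move=> mk k0.
rewrite /line_integral -[RHS](ge0_integral_translation t); last 2 first.
- exact: (measurableT_comp mk (measurable_line x)).
- by move=> s.
by apply: eq_integral => s _; rewrite scalerDl addrA addrAC.
Qed.

Hypothesis w1 : dotp w w = 1.

(** Integrating a function of lines over all base points x would count each line
    infinitely often. Weighting x by a Gaussian density in its position along the
    line counts each line once, and spares coordinates on the hyperplane
    orthogonal to w. *)
Definition slice_weight (x : 'rV[R]_n) : R := normal_pdf 0 1 (dotp x w).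

Lemma slice_weight_gt0 x : 0 < slice_weight x.
Proof.
rewrite /slice_weight normal_pdfE ?oner_neq0//.
by rewrite mulr_gt0 ?normal_peak_gt0 ?oner_neq0// expR_gt0.
Qed.

Lemma measurable_slice_weight : measurable_fun setT slice_weight.
Proof.
by apply: (measurableT_comp (measurable_normal_pdf 0 1)); exact: measurable_dotp.
Qed.

(** After exchanging the integrals and translating by s w, the variable s occurs
    in the weight only, which is a probability density in s because |w| = 1. *)
Lemma slice_integral k : measurable_fun setT k -> (forall x, (0 <= k x)%E) ->
  (\int[L]_x ((slice_weight x)%:E * line_integral k x) = \int[L]_x k x)%E.
Proof.
move=> mk k0.
have sw0 x : (0 <= (slice_weight x)%:E)%E by rewrite lee_fin ltW// slice_weight_gt0.
have msw : measurable_fun setT (fun x => (slice_weight x)%:E).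
  by apply/measurable_EFinP; exact: measurable_slice_weight.
pose K (p : 'rV[R]_n * measurableTypeR R) :=
  ((slice_weight p.1)%:E * k (p.1 + p.2 *: w)%R)%E.
have mK : measurable_fun setT K.
  apply: emeasurable_funM; last exact: (measurableT_comp mk measurable_line_pair).
  by apply: (measurableT_comp msw); exact: measurable_fst.
have K0 p : (0 <= K p)%E by rewrite mule_ge0.
transitivity (\int[L]_x \int[leb]_s K (x, s))%E.
  apply: eq_integral => x _; rewrite /line_integral -ge0_integralZl//.
  exact: (measurableT_comp mk (measurable_line x)).
rewrite (fubini_tonelli K)//.
pose K' (p : 'rV[R]_n * measurableTypeR R) :=
  ((slice_weight (p.1 - p.2 *: w)%R)%:E * k p.1)%E.
have mK' : measurable_fun setT K'.
  apply: emeasurable_funM; last first.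
    by apply: (measurableT_comp mk); exact: measurable_fst.
  apply: (measurableT_comp msw); apply: measurable_fun_rV => i.
  under eq_fun do rewrite !mxE.
  apply: measurable_funB.
    by apply: (measurableT_comp (measurable_coord i)); exact: measurable_fst.
  by apply: measurable_funM; [exact: measurable_snd|exact: measurable_cst].
have K'0 p : (0 <= K' p)%E by rewrite mule_ge0.
transitivity (\int[leb]_s \int[L]_x K' (x, s))%E.
  apply: eq_integral => s _.
  rewrite -[RHS](ge0_integral_translationV (s *: w)); last 2 first.
  - by apply: (measurableT_comp mK'); exact: measurable_pair2.
  - by move=> x.
  by apply: eq_integral => x _; rewrite /K/K'/= addrK.
rewrite -(fubini_tonelli K')//; apply: eq_integral => x _.
rewrite /K'/=.
have sE s : slice_weight (x - s *: w) = normal_pdf (dotp x w) 1 s.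
  rewrite /slice_weight -scaleNr dotpDl dotpZl w1 mulr1.
  rewrite !normal_pdfE ?oner_neq0// /normal_fun subr0.
  by rewrite (_ : (dotp x w - s) ^+ 2 = (s - dotp x w) ^+ 2)//; ring.
under eq_integral do rewrite sE.
rewrite ge0_integralZr ?integral_normal_pdf ?mul1e//.
  by apply/measurable_EFinP; exact: measurable_normal_pdf.
by move=> s _; rewrite lee_fin normal_pdf_ge0.
Qed.

(** The base points of bad lines are themselves negligible, which is how the
    exceptional fibres enter below. *)
Lemma null_line (N : set 'rV[R]_n) : measurable N -> L N = 0%E ->
  exists B, [/\ measurable B, L B = 0%E &
    forall x, ~ B x -> leb [set s | N (x + s *: w)] = 0%E].
Proof.
move=> mN N0; pose k x : \bar R := (\1_N x)%:E.
have mk : measurable_fun setT k by apply/measurable_EFinP; exact: measurable_indic.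
have k0 x : (0 <= k x)%E by rewrite lee_fin.
have mNx x : measurable ([set s | N (x + s *: w)] : set (measurableTypeR R)).
  by rewrite -[X in measurable X]setTI; exact: measurable_line.
have kE x : line_integral k x = leb [set s | N (x + s *: w)].
  rewrite -[in RHS](setIT [set _ | _]) -integral_indic//.
have ml := measurable_line_integral mk k0.
exists [set x | line_integral k x != 0%E]; split.
- by rewrite -[X in measurable X]setTI; exact: emeasurable_neq.
- have h0 : (\int[L]_x ((slice_weight x)%:E * line_integral k x) = 0)%E.
    by rewrite slice_integral// integral_indic// setIT.
  rewrite -[RHS](ge0_integral_eq0_null _ _ h0).
  + congr (L _); apply/seteqP; split => x /=; rewrite mule_eq0 negb_or.
      by move=> ->; rewrite andbT eqe gt_eqF// slice_weight_gt0.
    by move=> /andP[].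
  + apply: emeasurable_funM => //.
    by apply/measurable_EFinP; exact: measurable_slice_weight.
  + by move=> x; apply: mule_ge0; [rewrite lee_fin ltW ?slice_weight_gt0//|exact: line_integral_ge0].
- by move=> x /negP; rewrite negbK kE => /eqP.
Qed.

Lemma line_integral_finite k : measurable_fun setT k -> (forall x, (0 <= k x)%E) ->
  (\int[L]_x k x < +oo)%E ->
  exists B, [/\ measurable B, L B = 0%E &
    forall x, ~ B x -> (line_integral k x < +oo)%E].
Proof.
move=> mk k0 koo; have ml := measurable_line_integral mk k0.
have msl : measurable_fun setT (fun x => (slice_weight x)%:E * line_integral k x)%E.
  apply: emeasurable_funM => //.
  by apply/measurable_EFinP; exact: measurable_slice_weight.
exists [set x | line_integral k x = +oo%E].
have mB : measurable [set x | line_integral k x = +oo%E].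
  by rewrite -[X in measurable X]setTI; exact: (ml measurableT _ (emeasurable_set1 +oo)).
split => //; last by move=> x /eqP; rewrite ltey.
have /integrable_ae : L.-integrable setT
    (fun x => (slice_weight x)%:E * line_integral k x)%E.
  apply/integrableP; split => //.
  under eq_integral.
    move=> x _; rewrite gee0_abs; last first.
      apply: mule_ge0; last exact: line_integral_ge0.
      by rewrite lee_fin ltW// slice_weight_gt0.
    over.
  by rewrite slice_integral.
move=> /(_ measurableT)[N [mN N0 sN]].
apply: (subset_measure0 mB mN _ N0) => x /= xoo; apply: sN => /= /(_ I).
by rewrite xoo gt0_muley// lte_fin slice_weight_gt0.
Qed.

End line_integral.

(** * Symmetrization on a line *)

Section density.
Local Open Scope ereal_scope.
Context d (T : measurableType d) (R : realType) (m : {measure set T -> \bar R}).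
Variable f : T -> R.
Hypothesis f0 : forall x, (0 <= f x)%R.
Hypothesis mf : measurable_fun setT f.
Local Notation nu := (density_measure m f).

Let mEf A : measurable_fun A (EFin \o f).
Proof. by apply/measurable_EFinP; exact: measurable_funTS. Qed.

Lemma density_measure_ge0 A : 0 <= nu A.
Proof. by apply: integral_ge0 => x _; rewrite lee_fin. Qed.

Lemma le_density_measure A B : measurable A -> measurable B -> A `<=` B ->
  nu A <= nu B.
Proof.
by move=> mA mB AB; apply: ge0_subset_integral => // x _; rewrite lee_fin.
Qed.

Lemma density_measure_split A B : measurable A -> measurable B ->
  nu A = nu (A `&` B) + nu (A `\` B).
Proof.
move=> mA mB; rewrite /density_measure -ge0_integral_setU//=.
- by rewrite setUIDK.
- exact: measurableI.
- exact: measurableD.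
- by move=> x _; rewrite lee_fin.
- by apply/disj_setPS => x [[_ Bx] [_ nBx]].
Qed.

End density.

(** Transfers a computation with a Borel density and a Borel set to data that
    agree with them off a null set, for a complete measure. It serves for the
    line and for the whole space, where phi is the identity seen from the
    completed to the Borel sigma-algebra. *)
Lemma density_measure_complete d1 d2 (X : measurableType d1) (Y : measurableType d2)
    (R : realType) (mu : {measure set X -> \bar R}) (nu : {measure set Y -> \bar R})
    (phi : X -> Y) (g : X -> R) (g0 : Y -> R) (A : set X) (A0 Z : set Y) :
  measurable_fun setT phi -> measure_is_complete mu ->
  (forall B, measurable B -> mu (phi @^-1` B) = nu B) ->
  (forall x, 0 <= g x) -> (forall y, 0 <= g0 y) -> measurable_fun setT g0 ->
  measurable A0 -> measurable Z -> nu Z = 0%E ->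
  (forall x, ~ Z (phi x) -> g x = g0 (phi x) /\ (A x <-> A0 (phi x))) ->
  [/\ measurable_fun setT g, measurable A &
      density_measure mu g A = density_measure nu g0 A0].
Proof.
move=> mphi cmu munu g_ge0 g0_ge0 mg0 mA0 mZ Z0 gg0.
have mpre B : measurable B -> measurable (phi @^-1` B).
  by move=> mB; rewrite -[X in measurable X]setTI; exact: mphi.
have pZ0 : mu (phi @^-1` Z) = 0%E by rewrite munu.
have mg0p : measurable_fun setT (EFin \o (g0 \o phi)).
  by apply/measurable_EFinP; exact: measurableT_comp.
have gae : ae_eq mu setT (EFin \o (g0 \o phi)) (EFin \o g).
  exists (phi @^-1` Z); split => //; first exact: mpre.
  move=> x /= H; apply: contrapT => Zx; apply: H => _.
  by have [-> _] := gg0 x Zx.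
have mg : measurable_fun setT (EFin \o g) by exact: (ae_measurable_fun cmu gae).
have mA : measurable A.
  have -> : A = (phi @^-1` A0 `\` phi @^-1` Z) `|` (A `&` phi @^-1` Z).
    apply/seteqP; split => x /=.
      move=> Ax; have [Zx|Zx] := pselect (Z (phi x)); first by right.
      by left; split => //; have [_ [+ _]] := gg0 x Zx; exact.
    by move=> [[A0x Zx]|[]//]; have [_ [_ +]] := gg0 x Zx; exact.
  apply: measurableU; first by apply: measurableD; exact: mpre.
  by apply: cmu; exists (phi @^-1` Z); split => //; exact: mpre.
split => //; first exact/measurable_EFinP.
rewrite /density_measure.
transitivity (\int[mu]_(x in phi @^-1` A0) (g0 (phi x))%:E)%E.
  rewrite integral_mkcond [RHS]integral_mkcond.
  apply: ge0_ae_eq_integral => //.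
  - by apply/(measurable_restrictT _ mA); exact: measurable_funTS.
  - apply/(measurable_restrictT _ (mpre _ mA0)); exact: measurable_funTS.
  - by move=> x _; rewrite patchE; case: ifP => // _; rewrite lee_fin.
  - by move=> x _; rewrite patchE; case: ifP => // _; rewrite lee_fin.
  exists (phi @^-1` Z); split => //; first exact: mpre.
  move=> x /= H; apply: contrapT => Zx; apply: H => _.
  have [gx Ax] := gg0 x Zx; rewrite !patchE gx.
  suff -> : (x \in A) = (x \in phi @^-1` A0) by [].
  by apply/idP/idP => /set_mem/Ax/mem_set.
transitivity (\int[pushforward mu phi]_(y in A0) (g0 y)%:E)%E.
  rewrite (ge0_integral_pushforward mphi mu mA0 (f := EFin \o g0))//.
    by apply/measurable_EFinP; exact: measurable_funTS.
  by move=> y _; rewrite lee_fin.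
by apply: eq_measure_integral => //= B mB _; exact: munu.
Qed.

Section symmetral_line.
Context {R : realType}.
Local Notation leb := (@lebesgue_measure R).

Lemma measurable_ray (c : \bar R) : measurable (ray c : set (measurableTypeR R)).
Proof.
case: c => [r| |].
- by rewrite (_ : ray _ = `[r, +oo[%classic)//; apply/seteqP; split => t;
    rewrite /ray/= in_itv/= andbT.
- rewrite (_ : ray _ = set0)//; apply/seteqP; split => [t|t []].
  by rewrite /ray/mkset leNgt ltry.
- by rewrite (_ : ray _ = setT)//; apply/seteqP; split => t // _; rewrite /ray/mkset leNye.
Qed.

Lemma wmeasure1_borel (g g0 : R -> R) (A A0 Z : set (measurableTypeR R)) :
  (forall s, 0 <= g s) -> (forall s, 0 <= g0 s) ->
  measurable_fun setT (g0 : measurableTypeR R -> R) ->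
  measurable A0 -> measurable Z -> leb Z = 0%E ->
  (forall s, ~ Z s -> g s = g0 s /\ (A s <-> A0 s)) ->
  [/\ measurable_fun setT (g : line_type R -> R), measurable (A : set (line_type R)) &
    wmeasure1 g A = density_measure leb g0 A0].
Proof.
move=> g_ge0 g0_ge0 mg0 mA0 mZ Z0 gg0.
apply: (@density_measure_complete _ _ (line_type R) (measurableTypeR R) R
  (@completed_lebesgue_measure R) leb idfun g g0 A A0 Z) => //.
- by move=> _ B mB; rewrite setTI; exact: sub_caratheodory.
- exact: completed_lebesgue_measure_is_complete.
Qed.

(** The least [c] whose ray carries the mass of the section is characterized by
    the masses of the rays alone, so that no infimum is left. *)
Lemma symmetral1E (g g0 : R -> R) (A A0 Z : set (measurableTypeR R)) t :
  (forall s, 0 <= g s) -> (forall s, 0 <= g0 s) ->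
  measurable_fun setT (g0 : measurableTypeR R -> R) ->
  measurable A0 -> measurable Z -> leb Z = 0%E ->
  (forall s, ~ Z s -> g s = g0 s /\ (A s <-> A0 s)) ->
  (density_measure leb g0 setT < +oo)%E ->
  symmetral1 g A t <->
    (density_measure leb g0 (ray t%:E) <= density_measure leb g0 A0)%E.
Proof.
move=> g_ge0 g0_ge0 mg0 mA0 mZ Z0 gg0 g0oo.
have wE B B0 := @wmeasure1_borel g g0 B B0 Z g_ge0 g0_ge0 mg0.
have [mg mA wA] := wE _ _ mA0 mZ Z0 gg0.
have wray c : wmeasure1 g (ray c) = density_measure leb g0 (ray c).
  by have [_ _ ->] := wE (ray c) _ (measurable_ray c) mZ Z0
    (fun s Zs => conj (gg0 s Zs).1 (iff_refl _)).
have gi : (@completed_lebesgue_measure R).-integrable setT (EFin \o g).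
  apply/integrableP; split; first exact/measurable_EFinP.
  have [_ _ wT] := wE setT _ measurableT mZ Z0
    (fun s Zs => conj (gg0 s Zs).1 (iff_refl _)).
  under eq_integral do rewrite /= ger0_norm//.
  by rewrite [X in (X < _)%E]wT.
have := symmetral1_measure g_ge0 gi mA.
rewrite /symmetral1; set c := ereal_inf _ => cA.
split.
  rewrite /ray/= => ct; rewrite -wA -cA wray.
  apply: le_density_measure => //; [exact: measurable_ray|exact: measurable_ray|].
  by move=> s; rewrite /ray/=; exact: le_trans.
move=> tA; rewrite /ray/= leNgt; apply/negP => tc.
have : (c <= t%:E)%E.
  apply: ereal_inf_lbound => /=; apply/eqP.
  rewrite eq_le wray wA tA/= -wA -cA wray.
  apply: le_density_measure => //; [exact: measurable_ray|exact: measurable_ray|].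
  by move=> s; rewrite /ray/=; apply: le_trans; exact: ltW.
by rewrite leNgt tc.
Qed.

(** [U] and [V] are nested. If [U] is inside [V], all the mass of [A] ends up in
    [V], which gains that of [A] outside [V]; if [V] is inside [U], all of [V] is
    filled, which gains the mass of [V] outside [A]. *)
Lemma symmetral1_ray (g : R -> R) (A V : set (measurableTypeR R)) :
  (forall s, 0 <= g s) -> measurable_fun setT (g : measurableTypeR R -> R) ->
  measurable A -> measurable V -> (forall s t, V s -> s <= t -> V t) ->
  (density_measure leb g setT < +oo)%E ->
  let nu := density_measure leb g in
  let U : set (measurableTypeR R) := [set s | (nu (ray s%:E) <= nu A)%E] in
  [/\ measurable U, nu U = nu A &
  (nu (A `&` V) + Order.min (nu (A `\` V)) (nu (V `\` A)) <= nu (U `&` V))%E].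
Proof.
move=> g0 mg mA mV upV goo nu U.
have wE (B : set (measurableTypeR R)) : measurable B -> [/\ measurable_fun setT (g : line_type R -> R),
    measurable (B : set (line_type R)) & wmeasure1 g B = nu B].
  by move=> mB; apply: (wmeasure1_borel (Z := set0)) => //; rewrite measure0.
have UE : U = symmetral1 g A.
  by apply/seteqP; split => s /=; have [H1 H2] := @symmetral1E g g A A set0 s g0 g0
    mg mA measurable0 (measure0 _) (fun t _ => conj erefl (iff_refl _)) goo;
    [exact: H2|exact: H1].
have mU : measurable U by rewrite UE; exact: measurable_ray.
have nuU : nu U = nu A.
  have [mgc mAc <-] := wE _ mA.
  have [_ _ <-] := wE _ mU.
  rewrite UE; apply: symmetral1_measure => //.
  apply/integrableP; split; first exact/measurable_EFinP.
  under eq_integral do rewrite /= ger0_norm//.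
  by have [_ _] := wE _ measurableT; rewrite /wmeasure1/density_measure => ->.
split => //.
have upU s t : U s -> s <= t -> U t.
  rewrite UE /symmetral1/ray/= => /le_trans + st; apply.
  by rewrite lee_fin.
have [UV|/existsNP[s /not_implyP[Us nVs]]] := pselect (U `<=` V).
  rewrite (setIidl UV) nuU [X in (_ <= X)%E](density_measure_split leb g0 mg mA mV).
  apply: leeD2l.
  by rewrite ge_min lexx.
have VU : V `<=` U.
  move=> t Vt; have [ts|st] := leP t s; last exact: upU (ltW st).
  by exfalso; apply: nVs; exact: upV ts.
rewrite (setIidr VU) [X in (_ <= X)%E](density_measure_split leb g0 mg mV mA) setIC.
apply: leeD2l.
by rewrite ge_min lexx orbT.
Qed.

End symmetral_line.

(** * Symmetrization as a Borel operation *)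

Lemma ereal_rat_between (R : realType) (x y : \bar R) : (x < y)%E ->
  exists q : rat, (x < (ratr q)%:E)%E && ((ratr q)%:E < y)%E.
Proof.
have rat_in (a b : R) : a < b -> exists q : rat, a < ratr q < b.
  by move=> /rat_in_itvoo[q]; rewrite in_itv/=; exists q.
case: x y => [a| |] [b| |] //=.
- by rewrite lte_fin => /rat_in[q abq]; exists q; rewrite !lte_fin.
- have [|q /andP[aq _] _] := rat_in a (a + 1); first by rewrite ltrDl.
  by exists q; rewrite lte_fin aq ltry.
- have [|q /andP[_ qb] _] := rat_in (b - 1) b; first by rewrite ltrBlDr ltrDl.
  by exists q; rewrite lte_fin qb ltNyr.
- by exists 0; rewrite ltry ltNyr.
Qed.

Lemma measurable_lee d (T : measurableType d) (R : realType) (h g : T -> \bar R) :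
  measurable_fun setT h -> measurable_fun setT g ->
  measurable [set x | (h x <= g x)%E].
Proof.
move=> mh mg.
have -> : [set x | (h x <= g x)%E] = ~` \bigcup_(q : rat)
    ([set x | (g x < (ratr q)%:E)%E] `&` [set x | ((ratr q)%:E < h x)%E]).
  apply/seteqP; split => x /=.
    move=> hg [q _ [/= gq /(lt_trans gq)]]; by rewrite ltNge hg.
  move=> H; rewrite leNgt; apply/negP => /ereal_rat_between[q /andP[gq qh]].
  by apply: H; exists q.
apply: measurableC; apply: bigcupT_measurable_rat => q; apply: measurableI;
  rewrite -[X in measurable X]setTI.
- exact: emeasurable_fun_infty_o.
- exact: emeasurable_fun_o_infty.
Qed.

Section line_mass.
Context {R : realType} {n : nat}.
Local Notation leb := (@lebesgue_measure R).
Local Notation L := (borel_lebesgue R n).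
Variables (w : 'rV[R]_n) (f : 'rV[R]_n -> R).
Hypothesis w1 : dotp w w = 1.
Hypothesis f0 : forall x, 0 <= f x.
Hypothesis mf : measurable_fun setT f.
Implicit Types (A V : set 'rV[R]_n) (x : 'rV[R]_n).

Definition on_line x : measurableTypeR R -> 'rV[R]_n := fun s => x + s *: w.

Definition line_mass A x : \bar R :=
  density_measure leb (f \o on_line x) (on_line x @^-1` A).

Definition ray_mass x : \bar R := density_measure leb (f \o on_line x) (ray 0%:E).

Lemma measurable_on_line A x : measurable A -> measurable (on_line x @^-1` A).
Proof. by move=> mA; rewrite -[X in measurable X]setTI; exact: measurable_line. Qed.

Lemma measurable_fun_on_line x : measurable_fun setT (f \o on_line x).
Proof. exact: (measurableT_comp mf (measurable_line w x)). Qed.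

Lemma line_massE A : line_mass A = line_integral w ((EFin \o f) \_ A).
Proof.
by apply/funext => x; rewrite /line_mass /density_measure integral_mkcond.
Qed.

Let restrict_ge0 A x : (0 <= ((EFin \o f) \_ A) x)%E.
Proof. by rewrite patchE; case: ifP => // _; rewrite lee_fin. Qed.

Let measurable_fun_restrict A : measurable A -> measurable_fun setT ((EFin \o f) \_ A).
Proof.
move=> mA; apply/(measurable_restrictT _ mA)/measurable_EFinP.
exact: measurable_funTS.
Qed.

Lemma line_mass_ge0 A x : (0 <= line_mass A x)%E.
Proof. by apply: density_measure_ge0 => s; exact: f0. Qed.

Lemma measurable_line_mass A : measurable A -> measurable_fun setT (line_mass A).
Proof.
by move=> mA; rewrite line_massE; apply: measurable_line_integral => //;
  exact: measurable_fun_restrict.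
Qed.

Lemma slice_line_mass A : measurable A ->
  (\int[L]_x ((slice_weight w x)%:E * line_mass A x) = density_measure L f A)%E.
Proof.
move=> mA; rewrite line_massE slice_integral//; last exact: measurable_fun_restrict.
by rewrite /density_measure [RHS]integral_mkcond.
Qed.

Lemma line_mass_shift A x t : measurable A ->
  line_mass A (x + t *: w) = line_mass A x.
Proof.
by move=> mA; rewrite line_massE line_integral_shift//; exact: measurable_fun_restrict.
Qed.

Lemma measurable_ray_mass : measurable_fun setT ray_mass.
Proof.
have := @measurable_fun_fubini_tonelli_F _ _ 'rV[R]_n (measurableTypeR R) R leb
  (fun p => (f (p.1 + p.2 *: w) * \1_(ray 0%:E) p.2)%:E).
rewrite (_ : fubini_F _ _ = ray_mass); last first.
  apply/funext => x; rewrite /ray_mass /density_measure integral_mkcond.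
  apply: eq_integral => s _; rewrite patchE /= indicE.
  by case: (_ \in _); rewrite ?mulr1 ?mulr0.
apply.
  apply/measurable_EFinP; apply: measurable_funM.
    exact: (measurableT_comp mf (measurable_line_pair w)).
  apply: (measurableT_comp _ measurable_snd).
  exact: measurable_indic (measurable_ray _).
by move=> p; rewrite lee_fin mulr_ge0.
Qed.

Lemma ray_mass_shift x t :
  ray_mass (x + t *: w) = density_measure leb (f \o on_line x) (ray t%:E).
Proof.
rewrite /ray_mass /density_measure integral_mkcond [RHS]integral_mkcond.
rewrite -[RHS](ge0_integral_translation t).
- apply: eq_integral => s _; rewrite !patchE /= /on_line -addrA -scalerDl (addrC t).
  congr (if _ then _ else _); apply/idP/idP => /set_mem H; apply/mem_set; move: H;
  by rewrite /ray /mkset/= !lee_fin lerDr.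
- apply/(measurable_restrictT _ (measurable_ray _))/measurable_EFinP.
  by apply: measurable_funTS; exact: measurable_fun_on_line.
- by move=> s; rewrite patchE; case: ifP => // _; rewrite lee_fin; exact: f0.
Qed.

(** The symmetral of [A] up to a null set: [x] belongs to it when the ray from [x]
    carries at most the mass of [A] on the line of [x]. Both masses are Borel
    functions of [x], so that measurability is immediate. *)
Definition push_along A : set 'rV[R]_n := [set x | (ray_mass x <= line_mass A x)%E].

Lemma measurable_push_along A : measurable A -> measurable (push_along A).
Proof.
by move=> mA; apply: measurable_lee; [exact: measurable_ray_mass|exact: measurable_line_mass].
Qed.

Hypothesis foo : (density_measure L f setT < +oo)%E.

Lemma push_along_line A V x : measurable A -> measurable V ->
  (forall y t, V y -> 0 <= t -> V (y + t *: w)) -> (line_mass setT x < +oo)%E ->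
  line_mass (push_along A) x = line_mass A x /\
  (line_mass (A `&` V) x + Order.min (line_mass (A `\` V) x) (line_mass (V `\` A) x)
    <= line_mass (push_along A `&` V) x)%E.
Proof.
move=> mA mV upV xoo.
have [] := @symmetral1_ray R (f \o on_line x) (on_line x @^-1` A) (on_line x @^-1` V).
- by move=> s; exact: f0.
- exact: measurable_fun_on_line.
- exact: measurable_on_line.
- exact: measurable_on_line.
- move=> s t /= Vs st; have := upV _ (t - s) Vs; rewrite subr_ge0 => /(_ st).
  by rewrite /on_line -addrA -scalerDl (addrC s) subrK.
- exact: xoo.
have -> : [set s | (density_measure leb (f \o on_line x) (ray s%:E) <=
    density_measure leb (f \o on_line x) (on_line x @^-1` A))%E] =
    on_line x @^-1` push_along A.
  apply/seteqP; split => s; rewrite /= /push_along /= ray_mass_shift;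
  by rewrite line_mass_shift.
by move=> _ ? ?.
Qed.

(** The inequality on each line of finite mass, integrated over the lines. *)
Lemma push_along_mass A V : measurable A -> measurable V ->
  (forall y t, V y -> 0 <= t -> V (y + t *: w)) ->
  density_measure L f (push_along A) = density_measure L f A /\
  (density_measure L f (A `&` V) +
   \int[L]_x ((slice_weight w x)%:E *
     Order.min (line_mass (A `\` V) x) (line_mass (V `\` A) x))
   <= density_measure L f (push_along A `&` V))%E.
Proof.
move=> mA mV upV.
have fT : (\int[L]_x ((EFin \o f) \_ setT) x < +oo)%E by rewrite -integral_mkcond.
have [B [mB B0 Boo]] := line_integral_finite w1 (measurable_fun_restrict measurableT)
  (restrict_ge0 setT) fT.
have {}Boo x : ~ B x -> (line_mass setT x < +oo)%E by rewrite line_massE; exact: Boo.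
have mP := measurable_push_along mA.
have sw0 x : (0 <= (slice_weight w x)%:E)%E by rewrite lee_fin ltW// slice_weight_gt0.
have msw : measurable_fun setT (fun x => (slice_weight w x)%:E).
  by apply/measurable_EFinP; exact: measurable_slice_weight.
have mwl D : measurable D ->
    measurable_fun setT (fun x => (slice_weight w x)%:E * line_mass D x)%E.
  by move=> mD; apply: emeasurable_funM => //; exact: measurable_line_mass.
have wl0 D x : (0 <= (slice_weight w x)%:E * line_mass D x)%E.
  by rewrite mule_ge0// line_mass_ge0.
have min0 x : (0 <= Order.min (line_mass (A `\` V) x) (line_mass (V `\` A) x))%E.
  by rewrite le_min !line_mass_ge0.
have mmin : measurable_fun setT (fun x =>
    (slice_weight w x)%:E * Order.min (line_mass (A `\` V) x) (line_mass (V `\` A) x))%E.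
  apply: emeasurable_funM => //; apply: measurable_mine;
  by apply: measurable_line_mass; exact: measurableD.
split.
  rewrite -(slice_line_mass mP) -(slice_line_mass mA).
  apply: ge0_ae_eq_integral => //; [exact: mwl|exact: mwl|].
  exists B; split => // x /= H; apply: contrapT => Bx; apply: H => _.
  by have [-> _] := push_along_line mA mV upV (Boo _ Bx).
rewrite -(slice_line_mass (measurableI _ _ mA mV)) -(slice_line_mass (measurableI _ _ mP mV)).
rewrite -ge0_integralD//; last 2 first.
- by apply: mwl; exact: measurableI.
- by move=> x _; rewrite mule_ge0.
apply: ae_ge0_le_integral => //.
- by move=> x _; rewrite adde_ge0// mule_ge0.
- by apply: emeasurable_funD => //; apply: mwl; exact: measurableI.
- by apply: mwl; exact: measurableI.
exists B; split => // x /= H; apply: contrapT => Bx; apply: H => _.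
have [_ le] := push_along_line mA mV upV (Boo _ Bx).
by rewrite -ge0_muleDr ?line_mass_ge0//; exact: lee_wpmul2l.
Qed.

End line_mass.

Section symmetral_push.
Context {R : realType} {n : nat}.
Local Notation leb := (@lebesgue_measure R).
Local Notation L := (borel_lebesgue R n).
Implicit Types (v w x : 'rV[R]_n) (f : 'rV[R]_n -> R) (E : set 'rV[R]_n).

Lemma symmetral_section f w E x : dotp w w = 1 ->
  let t := dotp x w in let p := x - t *: w in
  symmetral f w E x <->
  symmetral1 (f \o on_line w p) (on_line w p @^-1` E) t.
Proof.
move=> w1 t p; split => [[y yw [s sy yx]]|st].
  have ts : t = s by rewrite /t -yx dotpDl dotpZl w1 mulr1 yw add0r.
  have py : p = y by rewrite /p ts -yx addrK.
  by rewrite py ts.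
exists p; first by rewrite /= /p -scaleNr dotpDl dotpZl w1 mulr1 subrr.
by exists t => //; rewrite /p subrK.
Qed.

(** The characterization [symmetral1E] applies on every line, except for those that
    meet [N] in positive length or have infinite mass; these fill a null set. *)
Lemma symmetral_push_along f f0 w E E0 N : dotp w w = 1 ->
  (forall x, 0 <= f x) -> (forall x, 0 <= f0 x) -> measurable_fun setT f0 ->
  measurable E0 -> measurable N -> L N = 0%E ->
  (forall x, ~ N x -> f x = f0 x /\ (E x <-> E0 x)) ->
  (density_measure L f0 setT < +oo)%E ->
  exists B, [/\ measurable B, L B = 0%E &
    forall x, ~ B x -> (symmetral f w E x <-> push_along w f0 E0 x)].
Proof.
move=> w1 f_ge0 f0_ge0 mf0 mE0 mN N0 ff0 f0oo.
have [B1 [mB1 B10 HB1]] := null_line w1 mN N0.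
have mr : measurable_fun setT ((EFin \o f0) \_ setT) by rewrite patch_setT; exact/measurable_EFinP.
have [B2 [mB2 B20 HB2]] := @line_integral_finite _ _ w w1 ((EFin \o f0) \_ setT) mr
  ltac:(by move=> x; rewrite patch_setT lee_fin f0_ge0)
  ltac:(by rewrite -integral_mkcond).
exists (B1 `|` B2); split; first exact: measurableU.
  by apply/null_set_setU.
move=> x /not_orP[/HB1 Nx /HB2 xoo].
apply: (iff_trans (symmetral_section _ _ _ w1)).
set t := dotp x w; set p := x - t *: w.
have xp : x = p + t *: w by rewrite /p subrK.
clearbody p t.
have mline (A : set 'rV[R]_n) : measurable A -> measurable (on_line w p @^-1` A).
  by exact: measurable_on_line.
apply: (iff_trans (@symmetral1E R _ (f0 \o on_line w p) _ (on_line w p @^-1` E0)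
  (on_line w p @^-1` N) t _ _ _ _ _ _ _ _)) => //.
- by move=> s; exact: f_ge0.
- by move=> s; exact: f0_ge0.
- exact: measurable_fun_on_line.
- exact: mline.
- exact: mline.
- rewrite -Nx -(lebesgue_measure_translation t); last exact: measurable_on_line.
  congr (leb _); apply/seteqP; split => s;
  by rewrite /= /on_line xp -addrA -scalerDl (addrC t).
- by move=> s; exact: ff0.
- have := line_mass_shift w f0_ge0 mf0 p t measurableT.
  by rewrite -xp => /esym; rewrite {1}/line_mass preimage_setT => ->; rewrite line_massE.
by rewrite /push_along /mkset xp ray_mass_shift// line_mass_shift.
Qed.

End symmetral_push.

(** * Gain of mass in a half-space *)

Section gain.
Context {R : realType} {n : nat}.
Local Notation leb := (@lebesgue_measure R).
Local Notation L := (borel_lebesgue R n).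
Implicit Types (v w x z : 'rV[R]_n) (A B C : set 'rV[R]_n).

Definition box (c : R) : set 'rV[R]_n :=
  [set x | forall i, `]- c, c[%classic (x ord0 i)].

Lemma measurable_cube c : measurable (box c).
Proof. exact: (@measurable_box R n (fun=> `]- c, c[%classic)). Qed.

Lemma box_fin_num c : L (box c) \is a fin_num.
Proof.
rewrite /box (@borel_lebesgue_box R n (fun=> `]- c, c[%classic))// prode_fin_num// => i _.
by rewrite lebesgue_measure_itv/=; case: ifP.
Qed.

(** By Fubini the product on the left is the integral over z of the volume of
    [A] met with [B - z], and this volume is 0 unless z is in the box of twice the
    size. *)
Lemma overlap A B (c d : R) : measurable A -> measurable B ->
  A `<=` box c -> B `<=` box c -> 0 <= d ->
  (forall z, L (A `&` [set x | B (x + z)%R]) <= d%:E)%E ->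
  (L A * L B <= d%:E * L (box (c + c)))%E.
Proof.
move=> mA mB Ac Bc d0 Hd.
pose K (p : 'rV[R]_n * 'rV[R]_n) : \bar R := (\1_A p.1 * \1_B (p.1 + p.2))%:E.
have mK : measurable_fun setT K.
  apply/measurable_EFinP; apply: measurable_funM.
    by apply: (measurableT_comp (measurable_indic mA)); exact: measurable_fst.
  apply: (measurableT_comp (measurable_indic mB)); apply: measurable_fun_rV => i.
  under eq_fun do rewrite mxE.
  by apply: measurable_funD; apply: (measurableT_comp (measurable_coord i));
    [exact: measurable_fst|exact: measurable_snd].
have K0 p : (0 <= K p)%E by rewrite lee_fin mulr_ge0.
have mBz z : measurable [set x | B (x + z)%R].
  by rewrite -[X in measurable X]setTI; exact: measurable_addrV.
have -> : (L A * L B = \int[L]_x \int[L]_z K (x, z))%E.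
  transitivity (\int[L]_x ((\1_A x)%:E * L B))%E.
    rewrite ge0_integralZr//; last by apply/measurable_EFinP; exact: measurable_indic.
    by rewrite integral_indic// setIT.
  apply: eq_integral => x _; rewrite /K/=.
  under eq_integral do rewrite EFinM.
  rewrite ge0_integralZl_EFin//; last first.
    apply/measurable_EFinP; apply: (measurableT_comp (measurable_indic mB)).
    rewrite (_ : +%R x = fun z => z + x); first exact: measurable_addrV.
    by apply/funext => z; rewrite addrC.
  congr (_ * _)%E.
  under eq_integral do rewrite addrC.
  rewrite (ge0_integral_translationV x (k := fun y => (\1_B y)%:E))//.
    by rewrite integral_indic// setIT.
  by apply/measurable_EFinP; exact: measurable_indic.
rewrite (fubini_tonelli K)//.
rewrite -[X in (_ * L X)%E]setIT -integral_indic//; last exact: measurable_cube.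
rewrite -ge0_integralZl//; last first.
  by apply/measurable_EFinP; apply: measurable_indic; exact: measurable_cube.
apply: ge0_le_integral => //.
- by move=> z _; exact: integral_ge0.
- exact: (measurable_fun_fubini_tonelli_G K).
- apply: measurable_funeM; apply/measurable_EFinP; apply: measurable_indic; exact: measurable_cube.
move=> z _.
have -> : (\int[L]_x K (x, z) = L (A `&` [set x | B (x + z)%R]))%E.
  rewrite -[X in _ = L X]setIT -integral_indic//; last exact: measurableI.
  by apply: eq_integral => x _; rewrite /K/= indicI/= .
rewrite indicE; have [zc|zc] := boolP (z \in _); first by rewrite mule1.
rewrite (_ : _ `&` _ = set0) ?measure0 ?mule0//.
apply/seteqP; split => // x [/Ac Ax /Bc Bx]; move/negP: zc; apply.
rewrite inE => i /=; have := Ax i; have := Bx i.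
rewrite /= !in_itv/= mxE; lra.
Qed.

(** On each line, both [A] and [B] carry at least [c] times the length of [C]: for
    [B], apply the translation by [r *: w], which preserves the line. *)
Lemma gain_lower (f : 'rV[R]_n -> R) w A B C (c r : R) : dotp w w = 1 ->
  0 < c -> (forall x, 0 <= f x) -> measurable_fun setT f ->
  measurable A -> measurable B -> measurable C ->
  (forall x, C x -> A x /\ c <= f x) ->
  (forall x, C x -> B (x + r *: w) /\ c <= f (x + r *: w)) ->
  (c%:E * L C <= \int[L]_x ((slice_weight w x)%:E *
     Order.min (line_mass w f A x) (line_mass w f B x)))%E.
Proof.
move=> w1 c0 f0 mf mA mB mC CA CB.
pose k x : \bar R := (c * \1_C x)%:E.
have k0 x : (0 <= k x)%E by rewrite lee_fin mulr_ge0// ltW.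
have mk : measurable_fun setT k.
  apply/measurable_EFinP; apply: measurable_funM; first exact: measurable_cst.
  exact: measurable_indic.
have -> : (c%:E * L C = \int[L]_x k x)%E.
  rewrite /k; under eq_integral do rewrite EFinM.
  rewrite ge0_integralZl_EFin//; last 2 first.
  - by apply/measurable_EFinP; exact: measurable_indic.
  - exact: ltW.
  by rewrite integral_indic// setIT.
have mrestr D : measurable D -> measurable_fun setT ((EFin \o f) \_ D).
  move=> mD; apply/(measurable_restrictT _ mD)/measurable_EFinP.
  exact: measurable_funTS.
have sw0 x : (0 <= (slice_weight w x)%:E)%E by rewrite lee_fin ltW// slice_weight_gt0.
have msw : measurable_fun setT (fun x => (slice_weight w x)%:E).
  by apply/measurable_EFinP; exact: measurable_slice_weight.
have mlm D : measurable D -> measurable_fun setT (line_mass w f D).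
  by exact: measurable_line_mass.
rewrite -(slice_integral w1)//; apply: ge0_le_integral => //.
- by move=> x _; rewrite mule_ge0// line_integral_ge0.
- by apply: emeasurable_funM => //; exact: measurable_line_integral.
- by apply: emeasurable_funM => //; apply: measurable_mine; exact: mlm.
move=> x _; apply: lee_wpmul2l => //.
rewrite le_min; apply/andP; split; rewrite line_massE /line_integral.
  apply: ge0_le_integral => //.
  - exact: (measurableT_comp mk (measurable_line w x)).
  - exact: (measurableT_comp (mrestr _ mA) (measurable_line w x)).
  move=> s _; rewrite /k indicE patchE.
  have [xC|] := boolP (_ \in _).
    have [Ax cx] := CA _ (set_mem xC).
    by rewrite mem_set// mulr1 lee_fin.
  by move=> _; rewrite mulr0; case: ifP => // _; rewrite lee_fin.
rewrite -/(line_integral w k x) -(line_integral_shift w x (- r) mk k0).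
apply: ge0_le_integral => //.
- exact: (measurableT_comp mk (measurable_line w _)).
- exact: (measurableT_comp (mrestr _ mB) (measurable_line w x)).
move=> s _; rewrite scaleNr addrAC; set y := x + s *: w.
rewrite /k indicE patchE; have [xC|] := boolP (_ \in _).
  by have [] := CB _ (set_mem xC); rewrite subrK mulr1 => /mem_set ->.
by move=> _; rewrite mulr0; case: ifP => // _; rewrite lee_fin.
Qed.

End gain.

Section exists_gain.
Context {R : realType} {n : nat}.
Local Notation leb := (@lebesgue_measure R).
Local Notation L := (borel_lebesgue R n).
Variables (f : 'rV[R]_n -> R).
Hypothesis f0 : forall x, 0 <= f x.
Hypothesis mf : measurable_fun setT f.
Hypothesis foo : (density_measure L f setT < +oo)%E.
Local Notation mu := (density_measure L f).

Let mEf A : measurable_fun A (EFin \o f).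
Proof. by apply/measurable_EFinP; exact: measurable_funTS. Qed.

Lemma density_measure_fin_num A : measurable A -> mu A \is a fin_num.
Proof.
move=> mA; rewrite ge0_fin_numE ?density_measure_ge0//.
by apply: le_lt_trans foo; exact: le_density_measure.
Qed.

(** The sets where x is bounded and f is between 1/k and k exhaust {f > 0}, which
    carries all the mass. *)
Lemma core_set (a : R) : 0 < a -> exists M : R, exists G : set 'rV[R]_n,
  [/\ 0 < M, measurable G, G `<=` box M,
    forall x, G x -> M^-1 <= f x <= M & (mu (~` G) < a%:E)%E].
Proof.
move=> a0.
pose G k : set 'rV[R]_n := box k.+1%:R `&`
  ([set x | k.+1%:R^-1 <= f x] `&` [set x | f x <= k.+1%:R]).
have mG k : measurable (G k).
  apply: measurableI; first exact: measurable_cube.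
  apply: measurableI; rewrite -[X in measurable X]setTI.
    by have := mf measurableT (measurable_itv `[(k.+1%:R^-1), +oo[);
      under eq_set do rewrite /= in_itv/= andbT.
  by have := mf measurableT (measurable_itv `]-oo, (k.+1%:R)]);
      under eq_set do rewrite /= in_itv/=.
have ndG : nondecreasing_seq G.
  apply/nondecreasing_seqP => k; apply/subsetPset => x [bx [/= h1 h2]].
  have kk : k.+1%:R <= k.+2%:R :> R by rewrite ler_nat.
  split; last split => /=.
  - move=> i; have := bx i; rewrite /= !in_itv/= => /andP[h3 h4].
    by rewrite (lt_le_trans h4)// (le_lt_trans _ h3)// lerN2.
  - by apply: le_trans h1; rewrite lef_pV2 ?posrE.
  - exact: le_trans kk.
have UG : \bigcup_k G k = [set x | 0 < f x].
  apply/seteqP; split => x /=.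
    by move=> [k _ [_ [/= h1 _]]]; apply: lt_le_trans h1; rewrite invr_gt0.
  move=> fx.
  have [K Kx] : exists K : nat, forall i, `|x ord0 i| < K%:R.
    exists (\sum_i (Num.truncn `|x ord0 i|).+1)%N => i.
    apply: lt_le_trans (truncnS_gt _) _; rewrite ler_nat (bigD1 i)//=.
    exact: leq_addr.
  pose k := (K + ((Num.truncn (f x)).+1 + (Num.truncn (f x)^-1).+1))%N.
  exists k => //; split; last split => /=.
  - move=> i; rewrite /= in_itv/= -ltr_norml (lt_le_trans (Kx i))// ler_nat.
    by rewrite /k -addnS leq_addr.
  - rewrite invf_ple ?posrE// (le_trans (ltW (truncnS_gt _)))// ler_nat /k.
    by rewrite ltnS; apply: ltnW; rewrite addnA leq_addl.
  - rewrite (le_trans (ltW (truncnS_gt _)))// ler_nat /k.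
    by rewrite ltnS; apply: ltnW; rewrite addnCA leq_addr.
have mUG : measurable (\bigcup_k G k) by exact: bigcupT_measurable.
have muU : mu (\bigcup_k G k) = mu setT.
  rewrite [RHS](density_measure_split L f0 mf measurableT mUG) setTI setTD.
  rewrite [X in (_ + X)%E](_ : _ = 0%E) ?adde0//.
  apply: integral0_eq => x; rewrite UG /= => /negP; rewrite -leNgt => fx.
  by congr EFin; apply/eqP; rewrite eq_le fx f0.
have cG : (mu (G k) @[k --> \oo] --> mu setT)%E.
  rewrite -muU; apply: (ge0_nondecreasing_set_cvg_integral (f := EFin \o f)) => //.
  by move=> k x _; rewrite lee_fin.
have fT := density_measure_fin_num measurableT.
have [k kG] : exists k, (mu setT - a%:E < mu (G k))%E.
  apply: contrapT => /forallNP H.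
  have : (limn (fun k => mu (G k)) <= mu setT - a%:E)%E.
    apply: lime_le; first by apply/cvg_ex; eexists; exact: cG.
    by apply: nearW => k; rewrite leNgt; apply/negP; exact: H.
  rewrite (cvg_lim _ cG)//; move: fT; case: (mu setT) => // r _.
  by rewrite -EFinB lee_fin; lra.
exists k.+1%:R, (G k); split => //.
- by move=> x [].
- by move=> x [_ [/= -> ->]].
have := density_measure_split L f0 mf measurableT (mG k).
rewrite setTI setTD => e; move: kG; rewrite e.
have := density_measure_fin_num (mG k); have := density_measure_fin_num (measurableC (mG k)).
case: (mu (G k)) => // r1; case: (mu (~` _)) => // r2 _ _.
by rewrite -!EFinD !lte_fin; lra.
Qed.

Lemma density_measure_setD E H : measurable E -> measurable H -> mu E = mu H ->
  mu (E `\` H) = mu (H `\` E).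
Proof.
move=> mE mH; rewrite (density_measure_split L f0 mf mE mH).
rewrite (density_measure_split L f0 mf mH mE) setIC.
have := density_measure_fin_num (measurableD mH mE).
have := density_measure_fin_num (measurableD mE mH).
have := density_measure_fin_num (measurableI _ _ mH mE).
case: (mu (H `&` E)) => // r1 _; case: (mu (E `\` H)) => // r2 _.
by case: (mu (H `\` E)) => // r3 _ [/addrI ->].
Qed.

(** The gain [d] is uniform in [E], which is what makes the iteration stop. On [H]
    only two order properties are used, shared by all half-spaces of normal [v],
    empty or full ones included. *)
Lemma exists_gain (H : set 'rV[R]_n) v (a : R) : measurable H ->
  (forall x y, ~ H x -> H y -> dotp x v < dotp y v) ->
  (forall x y, H x -> dotp x v <= dotp y v -> H y) -> 0 < a ->
  exists2 d : R, 0 < d & forall E, measurable E -> mu E = mu H ->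
    (a%:E <= mu (E `\` H))%E ->
    exists w, [/\ dotp w w = 1, mu (push_along w f E) = mu E &
      (mu (E `&` H) + d%:E <= mu (push_along w f E `&` H))%E].
Proof.
move=> mH Hlt Hup a0.
have a20 : 0 < a / 2 by rewrite divr_gt0.
have [M [G [M0 mG GM fG muG]]] := core_set a20.
pose q := fine (L (box (M + M))).
have q0 : 0 <= q by rewrite fine_ge0.
pose b := a / 2 / M.
have b0 : 0 < b by rewrite divr_gt0.
(* Above, b is a lower bound on the volume of A and B: each carries mass a / 2 at
   density at most M. Now d0 is just small enough to contradict [overlap], with
   q + 1 in place of q so that it is defined also for q = 0. *)
pose d0 := b * b / (q + 1).
have q1 : 0 < q + 1 by lra.
have d00 : 0 < d0 by apply: divr_gt0 => //; exact: mulr_gt0.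
exists (M^-1 * d0); first by rewrite mulr_gt0 ?invr_gt0.
move=> E mE EH aE.
pose A := (E `\` H) `&` G; pose B := (H `\` E) `&` G.
have mEH : measurable (E `\` H) by exact: measurableD.
have mHE : measurable (H `\` E) by exact: measurableD.
have mA : measurable A by exact: measurableI.
have mB : measurable B by exact: measurableI.
have LG D : measurable D -> (a%:E <= mu D)%E -> (b%:E <= L (D `&` G))%E.
  move=> mD aD.
  have : ((a / 2)%:E <= mu (D `&` G))%E.
    have := density_measure_split L f0 mf mD mG.
    have : (mu (D `\` G) <= mu (~` G))%E.
      apply: (le_density_measure _ f0 mf (measurableD mD mG) (measurableC mG)).
      by move=> x [].
    move: aD muG.
    have := density_measure_fin_num (measurableI _ _ mD mG).
    have := density_measure_fin_num (measurableD mD mG).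
    have := density_measure_fin_num (measurableC mG).
    case: (mu (~` G)) => // r1; case: (mu (D `\` G)) => // r2 _ _ .
    case: (mu (D `&` G)) => // r3 _ + + + e; rewrite e -EFinD !lee_fin !lte_fin; lra.
  have : (mu (D `&` G) <= M%:E * L (D `&` G))%E.
    rewrite -integral_cst; last exact: measurableI.
    apply: ge0_le_integral => //.
    - exact: measurableI.
    - by move=> x _; rewrite lee_fin.
    - by move=> x [_ /fG/andP[_]]; rewrite lee_fin.
  move=> h1 h2; have := le_trans h2 h1.
  rewrite -[X in (X <= _)%E](_ : (M%:E * b%:E)%E = _).
    by rewrite lee_pmul2l// lte_fin.
  by rewrite -EFinM /b mulrC divfK// gt_eqF.
have aH : (a%:E <= mu (H `\` E))%E.
  suff <- : mu (E `\` H) = mu (H `\` E) by [].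
  exact: density_measure_setD.
have LA := LG _ mEH aE; have LB := LG _ mHE aH.
have [z zd] : exists z, (d0%:E < L (A `&` [set x | B (x + z)%R]))%E.
  apply: contrapT => /forallNP nz.
  have : (L A * L B <= d0%:E * L (box (M + M)))%E.
    apply: overlap => //; [by move=> x [_ /GM]|by move=> x [_ /GM]|exact: ltW|].
    by move=> z; rewrite leNgt; apply/negP; exact: nz.
  have : ((b * b)%:E <= L A * L B)%E by rewrite EFinM lee_pmul// lee_fin ltW.
  move=> h1 h2; have := le_trans h1 h2.
  rewrite -[L (box _)]fineK ?box_fin_num// -/q -EFinM lee_fin leNgt => /negP; apply.
  by rewrite /d0 mulrAC ltr_pdivrMr//; have := mulr_gt0 b0 b0; nra.
pose C := A `&` [set x | B (x + z)].
have mC : measurable C.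
  apply: measurableI => //.
  by rewrite -[X in measurable X]setTI; exact: measurable_addrV.
have [x [[[Ex Hx] Gx] [[Hxz Exz] Gxz]]] : exists x, C x.
  apply: contrapT => /forallNP C0.
  move: zd; rewrite -/C (_ : C = set0) ?measure0.
    by rewrite lte_fin ltNge ltW.
  by apply/seteqP; split.
(* A single point moved from outside H into H decides the sign of z.v. *)
have zv : 0 < dotp z v.
  by have := Hlt _ _ Hx Hxz; rewrite dotpDl ltrDl.
have z0 : z != 0.
  apply: contraTneq zv => ->; rewrite /dotp big1 ?ltxx// => i _.
  by rewrite mxE mul0r.
have ez := enorm_gt0 z0.
pose w := (enorm z)^-1 *: z.
have w1 : dotp w w = 1.
  apply: enorm1_dotp; rewrite enormZ gtr0_norm ?invr_gt0//.
  by rewrite mulVf// gt_eqF.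
have zw : z = enorm z *: w by rewrite scalerA mulfV ?scale1r// gt_eqF.
have [|pm pg] := push_along_mass w1 f0 mf foo mE mH.
  move=> y t Hy t0; apply: Hup Hy _.
  rewrite dotpDl dotpZl lerDl mulr_ge0// dotpZl mulr_ge0// ?ltW//.
  by rewrite invr_gt0.
exists w; split => //; apply: le_trans pg; apply: leeD2l.
apply: (@le_trans _ _ (M^-1%:E * L C)%E).
  by rewrite EFinM; apply: lee_wpmul2l; [rewrite lee_fin invr_ge0|]; exact: ltW.
apply: (gain_lower (r := enorm z)) => //.
- by rewrite invr_gt0.
- by move=> y [[Ay /fG/andP[? _]] _].
- by move=> y [_ []] /=; rewrite -zw => By /fG/andP[].
Qed.

End exists_gain.

(** * Reaching the half-space by finitely many symmetrizations *)

Section borel_versions.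
Context {R : realType} {n : nat}.
Local Notation L := (borel_lebesgue R n).
Implicit Types (f : 'rV[R]_n -> R) (A E N : set 'rV[R]_n).

Lemma wmeasure_borel f f0 E E0 N :
  (forall x, 0 <= f x) -> (forall x, 0 <= f0 x) -> measurable_fun setT f0 ->
  measurable E0 -> measurable N -> L N = 0%E ->
  (forall x, ~ N x -> f x = f0 x /\ (E x <-> E0 x)) ->
  lebesgue_measurable E /\ wmeasure f E = density_measure L f0 E0.
Proof.
move=> f_ge0 f0_ge0 mf0 mE0 mN N0 ff0.
suff [_ ? ?] : [/\ measurable_fun setT (f : lebesgue_type R n -> R),
    lebesgue_measurable E & wmeasure f E = density_measure L f0 E0] by [].
apply: (@density_measure_complete _ _ (lebesgue_type R n) 'rV[R]_n R
  (lebesgueN R n) L idfun f f0 E E0 N _ _ _ f_ge0 f0_ge0 mf0 mE0 mN N0 ff0).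
- by move=> _ B mB; rewrite setTI; exact: caratheodory_measurable_mu_ext.
- exact: measure_is_complete_caratheodory.
- by move=> B mB; have [] := lebesgueN_borel mB.
Qed.

Lemma measurable_halfspace (v : 'rV[R]_n) (r : \bar R) : measurable (halfspace v r).
Proof.
rewrite -[X in measurable X]setTI.
exact: (measurable_dotp v measurableT (measurable_ray r)).
Qed.

Variable f : 'rV[R]_n -> R.
Hypothesis hf : PS_measure f.

(** As long as the mass of [E'] outside [H] is at least [e], some symmetrization
    increases the mass of [E'] in [H] by a fixed [d]; this is possible at most
    mu(R^n) / d times. *)
Lemma PS_approx_halfspace v E (e : R) : enorm v = 1 -> lebesgue_measurable E ->
  (wperimeter f E setT < +oo)%E -> 0 < e ->
  let H := halfspace_of f E v in
  exists E', [/\ lebesgue_measurable E',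
    (wperimeter f E' setT <= wperimeter f E setT)%E,
    (wmeasure f (E' `\` H) < e%:E)%E & (wmeasure f (H `\` E') < e%:E)%E].
Proof.
move=> v1 mE Eoo e0 H.
have [[f_ge0 fi _ _] ps] := hf.
have mfc : measurable_fun setT (f : lebesgue_type R n -> R).
  by apply/measurable_EFinP; exact: (measurable_int (lebesgueN R n)).
have [N [mN N0 mf0]] := measurable_fun_completion f_ge0 mfc.
pose f0 x := f x * \1_(~` N) x; rewrite -/f0 in mf0.
have f0_ge0 x : 0 <= f0 x by rewrite mulr_ge0.
have ff0 x : ~ N x -> f x = f0 x by move=> Nx; rewrite /f0 indicE mem_set// mulr1.
have mH : measurable H by exact: measurable_halfspace.
have wE A A0 B : measurable A0 -> measurable B -> L B = 0%E ->
    (forall x, ~ B x -> (A x <-> A0 x)) ->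
    wmeasure f A = density_measure L f0 A0.
  move=> mA0 mB B0 AA0.
  have NB0 : L (N `|` B) = 0%E by exact/null_set_setU.
  have NBff0 x : ~ (N `|` B) x -> f x = f0 x /\ (A x <-> A0 x).
    by move=> /not_orP[/ff0 ? /AA0 ?].
  by have [] := wmeasure_borel f_ge0 f0_ge0 mf0 mA0 (measurableU _ _ mN mB) NB0 NBff0.
have foo : (density_measure L f0 setT < +oo)%E.
  rewrite -(wE setT setT set0)//.
  have /integrableP[_] := fi.
  by under eq_integral do rewrite /= ger0_norm//.
have wH : wmeasure f H = density_measure L f0 H by exact: (wE _ _ set0).
have Hlt x y : ~ H x -> H y -> dotp x v < dotp y v.
  rewrite /H /halfspace_of /halfspace /= => /negP; rewrite -ltNge => h1 h2.
  by rewrite -lte_fin; exact: lt_le_trans h2.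
have Hup x y : H x -> dotp x v <= dotp y v -> H y.
  by rewrite /H /halfspace_of /halfspace /= -lee_fin; exact: le_trans.
have [d d0 gain] := exists_gain f0_ge0 mf0 foo mH Hlt Hup e0.
(* The gain is stated for Borel sets, the perimeter inequality for symmetrals. A
   pair of sets that agree off the null set B is carried along the iteration. *)
pose good E' E0 B := [/\ measurable E0, measurable B, L B = 0%E &
  forall x, ~ B x -> (E' x <-> E0 x)] /\ [/\ lebesgue_measurable E',
  (wperimeter f E' setT <= wperimeter f E setT)%E &
  density_measure L f0 E0 = density_measure L f0 H].
suff [E' [E0 [B [[[mE0 mB B0 EE0] [mE' pE' EH0]] small]]]] : exists E' E0 B,
    good E' E0 B /\ (density_measure L f0 (E0 `\` H) < e%:E)%E.
  exists E'; split => //.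
    by rewrite (wE _ (E0 `\` H) B)//; [exact: measurableD|move=> x /EE0[? ?]; split=> -[]; split; auto].
  rewrite (wE _ (H `\` E0) B)//; [|exact: measurableD|by move=> x /EE0[? ?]; split=> -[? ?]; split; auto].
  by rewrite -(density_measure_setD f0_ge0 mf0 foo mE0 mH EH0).
apply: contrapT => none.
have step k : exists E' E0 B, good E' E0 B /\
    ((k%:R * d)%:E <= density_measure L f0 (E0 `&` H))%E.
  elim: k => [|k [E' [E0 [B [gE kE]]]]].
    have [B [mB B0 mEB]] := measurable_completion mE.
    exists E, (E `\` B), B; split; last by rewrite mul0r density_measure_ge0.
    have EB x : ~ B x -> (E x <-> (E `\` B) x) by move=> Bx; split => // -[].
    split; split => //.
    rewrite -(wE _ _ _ _ _ _ EB)// -wH halfspace_of_measure//; exact: hf.1.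
  have [[mE0 mB B0 EE0] [mE' pE' EH0]] := gE.
  have [|w [w1 pm pg]] := gain _ mE0 EH0.
    by rewrite leNgt; apply/negP => small; apply: none; exists E', E0, B.
  have NBff0 x : ~ (N `|` B) x -> f x = f0 x /\ (E' x <-> E0 x).
    by move=> /not_orP[/ff0 ? /EE0 ?].
  have NB0 : L (N `|` B) = 0%E by exact/null_set_setU.
  have [B' [mB' B'0 HB']] := symmetral_push_along w1 f_ge0 f0_ge0 mf0 mE0
    (measurableU _ _ mN mB) NB0 NBff0 foo.
  have mP := measurable_push_along w f0_ge0 mf0 mE0.
  exists (symmetral f w E'), (push_along w f0 E0), B'; split; last first.
    by rewrite -natr1 mulrDl mul1r EFinD; apply: le_trans pg; exact: leeD2r.
  split; [by split|split].
  - have NB'0 : L (N `|` B') = 0%E by exact/null_set_setU.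
    have NB'ff0 x : ~ (N `|` B') x ->
        f x = f0 x /\ (symmetral f w E' x <-> push_along w f0 E0 x).
      by move=> /not_orP[/ff0 ? /HB' ?].
    by have [] := wmeasure_borel f_ge0 f0_ge0 mf0 mP (measurableU _ _ mN mB') NB'0 NB'ff0.
  - apply: (le_trans _ pE'); apply: ps; last exact: le_lt_trans pE' Eoo.
      by rewrite /enorm w1 sqrtr1.
    exact: mE'.
  - by rewrite pm.
have fT := density_measure_fin_num f0_ge0 mf0 foo measurableT.
have [E' [E0 [B [[[mE0 _ _ _] _] kE]]]] :=
  step (Num.truncn (fine (density_measure L f0 setT) / d)).+1.
have := le_trans kE (le_density_measure L f0_ge0 mf0 (measurableI _ _ mE0 mH)
  measurableT (@subsetT _ _)).
rewrite -[X in (_ <= X)%E]fineK// lee_fin leNgt => /negP; apply.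
by rewrite -ltr_pdivrMr// truncnS_gt.
Qed.

End borel_versions.

(** * Continuously differentiable functions *)

Section borel_topology.
Context {R : realType} {n : nat}.

(** An open set is the union of the countably many cubes with rational centre and
    radius 1/(k+1) that it contains. *)
Lemma open_measurable_rV (U : set 'rV[R]_n) : open U -> measurable U.
Proof.
move=> oU.
pose I (p : 'rV[rat]_n * nat) (i : 'I_n) : set R :=
  `](ratr (p.1 ord0 i) - p.2.+1%:R^-1), (ratr (p.1 ord0 i) + p.2.+1%:R^-1)[%classic.
pose q p : set 'rV[R]_n := [set x | forall i, I p i (x ord0 i)].
have mq p : measurable (q p).
  by apply: (@measurable_box R n (I p)) => i; exact: measurable_itv.
pose F k := if unpickle k is Some p then
  (if `[< q p `<=` U >] then q p else set0) else set0.
have -> : U = \bigcup_k F k.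
  apply/seteqP; split => x; last first.
    move=> [k _]; rewrite /F; case: unpickle => // p.
    by case: asboolP => // pU; exact: pU.
  move=> Ux; have /nbhs_ballP[e /= e0 eU] : nbhs x U by exact: open_nbhs_nbhs.
  have [k [d [dE ke d0]]] : exists k d, [/\ d = k.+1%:R^-1 :> R, d < e / 2 & 0 < d].
    exists (Num.truncn (e / 2)^-1), (Num.truncn (e / 2)^-1).+1%:R^-1.
    by split=> //; rewrite ?invr_gt0// invf_plt ?posrE ?divr_gt0// truncnS_gt.
  have /choice[r rx] i : exists r : rat, ratr r - d < x ord0 i < ratr r + d.
    have [|r] := @rat_in_itvoo R (x ord0 i - d) (x ord0 i + d); first by lra.
    by rewrite in_itv/= => /andP[h1 h2]; exists r; apply/andP; split; lra.
  pose p : 'rV[rat]_n * nat := (\row_i r i, k).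
  have qx : q p x by move=> i; rewrite /I/= mxE in_itv/= -dE; exact: rx.
  exists (pickle p) => //; rewrite /F pickleK; case: asboolP => // -[] y qy.
  apply: eU; split => // j i /=; rewrite ord1.
  have := qx i; have := qy i; rewrite /I/= mxE !in_itv/= -dE /ball/= => /andP[h1 h2] /andP[h3 h4].
  by rewrite ltr_norml; apply/andP; split; lra.
apply: bigcupT_measurable => k; rewrite /F; case: unpickle => // p.
by case: asboolP => // _; exact: mq.
Qed.

Lemma continuous_measurable_rV (h : 'rV[R]_n -> R) : continuous h ->
  measurable_fun setT h.
Proof.
move=> /continuousP ch; apply: (measurability _ (RGenOpens.measurableE R)) => //.
by move=> _ [_ [a [b ->] <-]]; rewrite setTI; apply: open_measurable_rV; apply: ch; exact: (@interval_open R (BRight a) (BLeft b)).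
Qed.

End borel_topology.

Section C1.
Context {R : realType} {V : normedModType R}.
Implicit Types psi : V -> R.

Definition C1 psi := (forall x, differentiable psi x) /\
  (forall v, continuous ('D_v psi)).

Lemma C1_continuous psi : C1 psi -> continuous psi.
Proof. by move=> [dpsi _] x; exact: differentiable_continuous. Qed.

Lemma C1_derivable psi x v : C1 psi -> derivable psi x v.
Proof. by move=> [dpsi _]; exact: diff_derivable. Qed.

Lemma C1_cst (c : R) : C1 (cst c : V -> R).
Proof.
split=> [x|v]; first exact: differentiable_cst.
rewrite (_ : 'D_v _ = cst 0); first exact: cst_continuous.
by apply/funext => x; rewrite derive_cst.
Qed.

Lemma C1D f g : C1 f -> C1 g -> C1 (fun x => f x + g x).
Proof.
move=> C1f C1g; split => [x|v].
  by apply: (@differentiableD R V R f g); [exact: C1f.1|exact: C1g.1].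
rewrite (_ : 'D_v _ = fun x => 'D_v f x + 'D_v g x).
  by move=> x; apply: cvgD; [exact: C1f.2|exact: C1g.2].
by apply/funext => x; apply: (@deriveD R V R f g); exact: C1_derivable.
Qed.

Lemma C1M f g : C1 f -> C1 g -> C1 (fun x => f x * g x).
Proof.
move=> C1f C1g; split => [x|v].
  by apply: (@differentiableM R V f g); [exact: C1f.1|exact: C1g.1].
rewrite (_ : 'D_v _ = fun x => f x * 'D_v g x + g x * 'D_v f x).
  move=> x; apply: cvgD; apply: cvgM.
  - exact: (C1_continuous C1f).
  - exact: C1g.2.
  - exact: (C1_continuous C1g).
  - exact: C1f.2.
by apply/funext => x; apply: (@deriveM R V f g); exact: C1_derivable.
Qed.

Lemma C1_sum (I : Type) (s : seq I) (F : I -> V -> R) :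
  (forall i, C1 (F i)) -> C1 (fun x => \sum_(i <- s) F i x).
Proof.
move=> C1F; elim: s => [|i s IH].
  under eq_fun do rewrite big_nil; exact: C1_cst.
by under eq_fun do rewrite big_cons; exact: C1D.
Qed.

Lemma C1_onem f : C1 f -> C1 (fun x => 1 + (-1) * f x).
Proof.
move=> C1f; apply: C1D; first exact: C1_cst.
by apply: C1M; [exact: C1_cst|exact: C1f].
Qed.

Lemma C1V f : C1 f -> (forall x, f x != 0) -> C1 (fun x => (f x)^-1).
Proof.
move=> C1f f0; split => [x|v].
  by apply: (@differentiableV R V f); [exact: C1f.1|exact: f0].
rewrite (_ : 'D_v _ = fun x => - (f x) ^- 2 * 'D_v f x).
  move=> x; apply: cvgM; last exact: C1f.2.
  apply: cvgN; apply: cvgV; first by rewrite expf_neq0.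
  by apply: cvgM; exact: (C1_continuous C1f).
by apply/funext => x; apply: (@deriveV R V f); [exact: f0|exact: C1_derivable].
Qed.

Lemma C1_comp (h dh : R -> R) f : (forall t : R, is_derive t 1 h (dh t)) ->
  continuous dh -> C1 f -> C1 (h \o f).
Proof.
move=> hdh cdh C1f.
have dfh t : differentiable h t by apply/derivable1_diffP; exact: (@ex_derive _ _ _ _ _ _ _ (hdh t)).
split => [x|v]; first by apply: differentiable_comp; [exact: C1f.1|exact: dfh].
rewrite (_ : 'D_v _ = fun x => 'D_v f x * dh (f x)).
  move=> x; apply: cvgM; first exact: C1f.2.
  by apply: continuous_comp; [exact: C1_continuous|exact: cdh].
apply/funext => x; rewrite deriveE; last first.
  by apply: differentiable_comp; [exact: C1f.1|exact: dfh].
rewrite diff_comp; [|exact: C1f.1|exact: dfh].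
rewrite /= -(deriveE v (C1f.1 x)).
rewrite deriv1E; last exact: (@ex_derive _ _ _ _ _ _ _ (hdh _)).
by rewrite derive1E (@derive_val _ _ _ _ _ _ _ (hdh _)).
Qed.

End C1.

Section positive_part_square.
Context {R : realType}.

(** A C^1 function that is positive exactly on the positive reals: all that the
    construction of ramps and cutoffs below asks for. *)
Definition psq (t : R) : R := Num.max 0 t ^+ 2.

Lemma is_derive_psq (t : R) : is_derive t 1 psq (Num.max 0 t *+ 2).
Proof.
have H h : `|psq (h + t) - psq t - h * (Num.max 0 t *+ 2)| <= h ^+ 2.
  rewrite /psq ler_norml; apply/andP; split.
    by case: (leP 0 (h + t)) => h1; case: (leP 0 t) => h2; rewrite /=; nra.
  by case: (leP 0 (h + t)) => h1; case: (leP 0 t) => h2; rewrite /=; nra.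
have cv : h^-1 *: (psq (h *: 1 + t) - psq t) @[h --> 0^'] --> Num.max 0 t *+ 2.
  apply/cvgrPdist_le => e e0; near=> h.
  have h0 : h != 0 by near: h; exact: nbhs_dnbhs_neq.
  have he : `|h| <= e.
    near: h; exact: dnbhs0_le.
  apply: le_trans he; rewrite distrC.
  have -> : h^-1 *: (psq (h *: 1 + t) - psq t) - Num.max 0 t *+ 2 =
      h^-1 * (psq (h + t) - psq t - h * (Num.max 0 t *+ 2)).
    rewrite mulrBr mulKf// /GRing.scale/= mulr1//.
  rewrite normrM normfV ler_pdivrMl ?normr_gt0//.
  by apply: le_trans (H h) _; rewrite -normrM -expr2 ger0_norm ?sqr_ge0.
apply: DeriveDef; first by apply/cvg_ex; eexists; exact: cv.
exact: cvg_lim cv.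
Unshelve. all: by end_near. Qed.

Lemma psq_ge0 t : 0 <= psq t. Proof. exact: sqr_ge0. Qed.

Lemma psq_le0 t : t <= 0 -> psq t = 0.
Proof. by move=> t0; rewrite /psq max_l// expr0n. Qed.

Lemma psq_gt0 t : 0 < t -> 0 < psq t.
Proof. by move=> t0; rewrite /psq max_r ?ltW// exprn_gt0. Qed.

Lemma psq_le1 t : t <= 1 -> psq t <= 1.
Proof. by move=> t1; rewrite /psq expr_le1// ?le_max ?lexx// ge_max ler01 t1. Qed.

Lemma C1_psq (V : normedModType R) (f : V -> R) : C1 f -> C1 (psq \o f).
Proof.
apply: C1_comp is_derive_psq _ => t.
apply: cvgMn; apply: (@continuous_max R R (cst 0) id t); last exact: cvg_id.
exact: cvg_cst.
Qed.

End positive_part_square.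

Section C1_rV.
Context {R : realType} {n : nat}.

Lemma C1_coord (i : 'I_n) : C1 (fun x : 'rV[R]_n => x ord0 i).
Proof.
split => [x|v]; first exact: differentiable_coord.
rewrite (_ : 'D_v _ = cst (v ord0 i)); first exact: cst_continuous.
apply/funext => x; rewrite /derive; apply: lim_near_cst => //; near=> h.
have h0 : h != 0 by near: h; exact: nbhs_dnbhs_neq.
by rewrite /= !mxE addrK /GRing.scale/= mulKf.
Unshelve. all: by end_near. Qed.

(** 1 - 1/(1 + k t) increases to the indicator of t > 0; t is made C^1 by [psq]. *)
Definition ramp (i : 'I_n) (a : R) (k : nat) (x : 'rV[R]_n) : R :=
  1 + (-1) * (1 + k%:R * psq (x ord0 i - a))^-1.

Lemma ramp_den_gt0 i a k (x : 'rV[R]_n) : 0 < 1 + k%:R * psq (x ord0 i - a).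
Proof. by rewrite ltr_wpDr// mulr_ge0// psq_ge0. Qed.

Lemma C1_ramp i a k : C1 (ramp i a k).
Proof.
apply: C1D; first exact: C1_cst.
apply: C1M; first exact: C1_cst.
apply: C1V; last by move=> x; rewrite gt_eqF// ramp_den_gt0.
apply: C1D; first exact: C1_cst.
apply: C1M; first exact: C1_cst.
apply: (C1_psq (f := fun x : 'rV[R]_n => x ord0 i - a)).
by apply: C1D; [exact: C1_coord|exact: C1_cst].
Qed.

Lemma ramp_itv i a k x : 0 <= ramp i a k x <= 1.
Proof.
have d0 := ramp_den_gt0 i a k x.
have d1 : (1 + k%:R * psq (x ord0 i - a))^-1 <= 1.
  by rewrite invf_le1// lerDl mulr_ge0// psq_ge0.
rewrite /ramp mulN1r subr_ge0 d1/= gerDl oppr_le0 invr_ge0; exact: ltW.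
Qed.

Lemma cvg_ramp i a x : ramp i a k x @[k --> \oo] --> (\1_[set y : 'rV[R]_n | a < y ord0 i] x : R).
Proof.
have [xa|ax] := leP (x ord0 i) a.
  rewrite (_ : (fun k => _) = cst 0).
    by rewrite indicE memNset ?mulr0n; [exact: cvg_cst|rewrite /= ltNge xa].
  by apply/funext => k; rewrite /ramp psq_le0 ?subr_le0// mulr0 addr0 invr1 mulr1 subrr.
rewrite indicE mem_set//= -[X in _ --> X]addr0; apply: cvgD; first exact: cvg_cst.
rewrite -(mulr0 (-1)); apply: cvgM; first exact: cvg_cst.
have p0 : 0 < psq (x ord0 i - a) by rewrite psq_gt0// subr_gt0.
apply/cvgrPdist_le => e e0; near=> k.
rewrite sub0r normrN ger0_norm ?invr_ge0 ?ltW ?ramp_den_gt0//.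
rewrite invf_plt ?posrE ?ramp_den_gt0//.
apply: (@lt_trans _ _ (k%:R * psq (x ord0 i - a))); last by rewrite ltrDr.
rewrite -ltr_pdivrMr//; near: k; exact: nbhs_infty_gtr.
Unshelve. all: by end_near. Qed.

Definition cutoff (c : R) (x : 'rV[R]_n) : R := psq (1 + - c ^- 2 * dotp x x).

Lemma C1_cutoff c : C1 (cutoff c).
Proof.
apply: (C1_psq (f := fun x : 'rV[R]_n => 1 + - c ^- 2 * dotp x x)).
apply: C1D; first exact: C1_cst.
apply: C1M; first exact: C1_cst.
by apply: C1_sum => i; apply: C1M; exact: C1_coord.
Qed.

Lemma cutoff_itv c x : 0 <= cutoff c x <= 1.
Proof.
rewrite psq_ge0 psq_le1// gerDl mulNr oppr_le0 mulr_ge0 ?dotp_ge0//.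
by rewrite invr_ge0 sqr_ge0.
Qed.

Lemma cutoff_gt0 c x : dotp x x < c ^+ 2 -> 0 < cutoff c x.
Proof.
move=> xc; have c0 : 0 < c ^+ 2 by exact: le_lt_trans (dotp_ge0 x) xc.
by apply: psq_gt0; rewrite mulNr subr_gt0 mulrC ltr_pdivrMr// mul1r.
Qed.

Definition cbox (c : R) : set 'rV[R]_n := [set x | forall i, `[- c, c]%classic (x ord0 i)].

Lemma compact_cbox c : compact (cbox c).
Proof. by apply: (@rV_compact _ n (fun=> `[- c, c]%classic)) => i; exact: segment_compact. Qed.

Lemma cutoff_out c x : 0 < c -> ~ cbox c x -> cutoff c x = 0.
Proof.
move=> c0 /existsNP[i xi]; apply: psq_le0.
rewrite mulNr subr_le0 mulrC ler_pdivlMr ?exprn_gt0// mul1r.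
apply: (@le_trans _ _ (x ord0 i ^+ 2)); last first.
  rewrite /dotp (bigD1 i)//= -expr2 lerDl sumr_ge0// => j _.
  by rewrite -expr2 sqr_ge0.
have xc : c < `|x ord0 i|.
  by rewrite ltNge ler_norml; apply/negP => h; apply: xi; rewrite /= in_itv/=.
by rewrite -[leRHS]real_normK ?num_real// ler_sqr ?nnegrE//; exact: ltW.
Qed.

End C1_rV.

(** * Approximation of indicators in weighted L^1 *)

Section weighted_dist.
Context d (T : measurableType d) (R : realType) (mu : {measure set T -> \bar R}).
Variable w : T -> R.
Hypothesis w0 : forall x, 0 <= w x.
Hypothesis wi : mu.-integrable setT (EFin \o w).

Let mw : measurable_fun setT w.
Proof. by apply/measurable_EFinP; exact: (measurable_int mu). Qed.

Let measurable_weighted_dist (u v : T -> R) :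
  measurable_fun setT u -> measurable_fun setT v ->
  measurable_fun setT (fun x => (`|u x - v x| * w x)%:E).
Proof.
move=> mfu mfv; apply/measurable_EFinP; apply: measurable_funM => //.
by apply: measurableT_comp => //; exact: measurable_funB.
Qed.

Let dist_ge0 (u v : T -> R) x : (0 <= (`|u x - v x| * w x)%:E)%E.
Proof. by rewrite lee_fin mulr_ge0. Qed.

(** Dominated convergence, with dominating function [w]. *)
Lemma small_weighted_dist (h : nat -> T -> R) (l : T -> R) (e : R) :
  (forall k, measurable_fun setT (h k)) ->
  (forall k x, 0 <= h k x <= 1) -> (forall x, h k x @[k --> \oo] --> l x) -> 0 < e ->
  exists k, (\int[mu]_x (`|l x - h k x| * w x)%:E <= e%:E)%E.
Proof.
move=> mh h01 hl e0.
have ml : measurable_fun setT l.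
  by apply: (measurable_fun_cvg mh) => x _; exact: hl.
have l01 x : 0 <= l x <= 1.
  apply/andP; split.
    rewrite -(cvg_lim (@Rhausdorff R) (hl x)); apply: limr_ge; first by apply/cvg_ex; eexists; exact: hl.
    by apply: nearW => k; have /andP[] := h01 k x.
  rewrite -(cvg_lim (@Rhausdorff R) (hl x)); apply: limr_le; first by apply/cvg_ex; eexists; exact: hl.
  by apply: nearW => k; have /andP[] := h01 k x.
pose F k x := (`|l x - h k x| * w x)%:E.
have mF k : measurable_fun setT (F k).
  apply/measurable_EFinP; apply: measurable_funM => //.
  by apply: measurableT_comp => //; exact: measurable_funB.
have Fw k x : (`|F k x| <= (w x)%:E)%E.
  rewrite /= lee_fin normrM normr_id (ger0_norm (w0 x)) ler_piMl//.
  by rewrite ler_norml; have /andP[? ?] := l01 x; have /andP[? ?] := h01 k x; lra.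
have Fc x : (F k x @[k --> \oo] --> cst 0%E x)%E.
  apply: cvg_EFin; first by apply: nearW.
  rewrite /= -[X in _ --> X](mul0r (w x)); apply: cvgM; last exact: cvg_cst.
  rewrite -(normr0 R); apply: cvg_norm; rewrite -(subrr (l x)).
  by apply: cvgB; [exact: cvg_cst|exact: hl].
have [_ cF _] := @dominated_convergence _ T R mu setT measurableT F (cst 0%E) (EFin \o w)
  mF (measurable_cst _) (aeW mu (fun x _ => Fc x)) wi
  (aeW mu (fun x k _ => Fw k x)).
apply: contrapT => /forallNP H.
have : (e%:E <= 0)%E; last by rewrite lee_fin leNgt e0.
rewrite -(cvg_lim (@ereal_hausdorff R) cF); apply: lime_ge.
  by apply/cvg_ex; eexists; exact: cF.
apply: nearW => k /=; have /negP := H k; rewrite -ltNge => /ltW/le_trans; apply.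
rewrite le_eqVlt; apply/orP; left; apply/eqP; apply: eq_integral => x _.
by congr EFin; rewrite subr0 [RHS]ger0_norm// mulr_ge0.
Qed.

Lemma weighted_dist_trans (l h k : T -> R) (a b : R) :
  measurable_fun setT l -> measurable_fun setT h -> measurable_fun setT k ->
  (\int[mu]_x (`|l x - h x| * w x)%:E <= a%:E)%E ->
  (\int[mu]_x (`|h x - k x| * w x)%:E <= b%:E)%E ->
  (\int[mu]_x (`|l x - k x| * w x)%:E <= (a + b)%:E)%E.
Proof.
move=> ml mh mk la lb; rewrite EFinD; apply: le_trans (leeD la lb).
rewrite -ge0_integralD//; try exact: measurable_weighted_dist; try by (move=> x _; exact: dist_ge0).
apply: ge0_le_integral => //.
- exact: measurable_weighted_dist.
- by apply: emeasurable_funD; exact: measurable_weighted_dist.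
move=> x _; rewrite -EFinD lee_fin -mulrDl ler_wpM2r//.
by rewrite (le_trans _ (ler_normD _ _))// le_eqVlt; apply/orP; left; apply/eqP; congr `|_|; lra.
Qed.

(** 1 - (1 - p)(1 - q) is the indicator of the union when p and q are indicators,
    and is 1-Lipschitz in each of p and q on the unit interval. *)
Lemma weighted_dist_union (a b : R) (A B : set T) (psi phi : T -> R) :
  measurable A -> measurable B -> measurable_fun setT psi -> measurable_fun setT phi ->
  (forall x, 0 <= psi x <= 1) -> (forall x, 0 <= phi x <= 1) ->
  (\int[mu]_x (`|\1_A x - psi x| * w x)%:E <= a%:E)%E ->
  (\int[mu]_x (`|\1_B x - phi x| * w x)%:E <= b%:E)%E ->
  (\int[mu]_x (`|\1_(A `|` B) x - (psi x + (1 + (-1) * psi x) * phi x)| * w x)%:E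
    <= (a + b)%:E)%E.
Proof.
move=> mA mB mpsi mphi psi01 phi01 la lb; rewrite EFinD; apply: le_trans (leeD la lb).
have mf : measurable_fun setT (fun x => psi x + (1 + (-1) * psi x) * phi x).
  apply: measurable_funD => //; apply: measurable_funM => //.
  by apply: measurable_funD => //; exact: measurable_funM.
have mAB : measurable (A `|` B) by exact: measurableU.
rewrite -ge0_integralD//; try exact: measurable_weighted_dist; try by (move=> x _; exact: dist_ge0).
apply: ge0_le_integral => //.
- by move=> x _; rewrite lee_fin mulr_ge0.
- by have := measurable_weighted_dist (measurable_indic mAB) mf; apply.
- by apply: emeasurable_funD; exact: measurable_weighted_dist.
move=> x _; rewrite -EFinD lee_fin -mulrDl ler_wpM2r//.
have /andP[p0 p1] := psi01 x; have /andP[q0 q1] := phi01 x.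
have n1 (u : R) : 0 <= u -> u <= 1 -> `|1 - u| = 1 - u by move=> ? ?; rewrite ger0_norm// subr_ge0.
have n0 (u : R) : 0 <= u -> `|0 - u| = u by move=> ?; rewrite sub0r normrN ger0_norm.
have pq : 0 <= psi x * phi x by exact: mulr_ge0.
have pq' : 0 <= (1 - psi x) * (1 - phi x) by apply: mulr_ge0; rewrite subr_ge0.
rewrite !indicE in_setU; case: (x \in A); case: (x \in B) => /=;
  rewrite ?mulr1n ?mulr0n ?n1 ?n0//; rewrite ?ler_norml; try (apply/andP; split); nra.
Qed.

End weighted_dist.

Section C1_density.
Context {R : realType} {n : nat}.
Local Notation T := (lebesgue_type R n).
Local Notation lam := (lebesgueN R n).

Lemma measurable_fun_lebesgue (h : 'rV[R]_n -> R) :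
  measurable_fun setT h -> measurable_fun setT (h : T -> R).
Proof.
move=> mh _ B mB; rewrite setTI; apply: caratheodory_measurable_mu_ext.
by rewrite -[X in measurable X]setTI; exact: mh.
Qed.

Lemma C1_measurable (h : 'rV[R]_n -> R) : C1 h -> measurable_fun setT (h : T -> R).
Proof.
move=> C1h; apply: measurable_fun_lebesgue; apply: continuous_measurable_rV.
exact: C1_continuous.
Qed.

Variable w : T -> R.
Hypothesis w0 : forall x, 0 <= w x.
Hypothesis wi : lam.-integrable setT (EFin \o w).

(** The sets approximated by C^1 functions in [L^1(w)] form a sigma-algebra, and
    it contains the half-spaces [x_i > a]. *)
Let approx (A : set 'rV[R]_n) := measurable A /\ forall e, 0 < e ->
  exists psi : 'rV[R]_n -> R, [/\ C1 psi, forall x, 0 <= psi x <= 1 &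
    (\int[lam]_x (`|\1_A x - psi x| * w x)%:E <= e%:E)%E].

Let mind (A : set 'rV[R]_n) : measurable A -> measurable_fun setT (\1_A : T -> R).
Proof. by move=> mA; apply: measurable_indic; exact: caratheodory_measurable_mu_ext. Qed.

Let approx0 : approx set0.
Proof.
split=> // e e0; exists (cst 0); split => [|x|]; first exact: C1_cst.
  by rewrite /= lexx ler01.
rewrite integral0_eq ?lee_fin ?ltW// => x _.
by rewrite indic0 /= subrr normr0 mul0r.
Qed.

Let approxC A : approx A -> approx (~` A).
Proof.
move=> [mA HA]; split=> [|e e0]; first exact: measurableC.
have [psi [C1psi psi01 psie]] := HA e e0.
exists (fun x => 1 + (-1) * psi x); split.
- exact: C1_onem.
- move=> x; have := psi01 x; move: (psi x) => p /andP[p0 p1].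
  by apply/andP; split; lra.
apply: le_trans psie; rewrite le_eqVlt; apply/orP; left; apply/eqP.
apply: eq_integral => x _; congr (_ * _)%:E; rewrite !indicE in_setC -[LHS]normrN.
by case: (x \in A) => /=; congr `| _ |; rewrite ?mulr1n ?mulr0n; ring.
Qed.

Let approxU A B : approx A -> approx B -> approx (A `|` B).
Proof.
move=> [mA HA] [mB HB]; split=> [|e e0]; first exact: measurableU.
have e20 : 0 < e / 2 by rewrite divr_gt0.
have [psi [C1psi psi01 psie]] := HA _ e20.
have [phi [C1phi phi01 phie]] := HB _ e20.
exists (fun x => psi x + (1 + (-1) * psi x) * phi x); split.
- by apply: (C1D C1psi); apply: C1M; [exact: C1_onem|exact: C1phi].
- move=> x; have := psi01 x; have := phi01 x; move: (psi x) (phi x) => p q.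
  by move=> {HA HB} /andP[q0 q1] /andP[p0 p1]; apply/andP; split; nra.
rewrite (splitr e).
apply: (@weighted_dist_union _ T R lam w w0 wi _ _ A B psi phi _ _ _ _ psi01 phi01 psie phie).
- exact: caratheodory_measurable_mu_ext.
- exact: caratheodory_measurable_mu_ext.
- exact: C1_measurable.
- exact: C1_measurable.
Qed.

Let approx_bigcup (F : nat -> set 'rV[R]_n) : (forall k, approx (F k)) ->
  approx (\bigcup_k F k).
Proof.
move=> aF.
pose G k := \big[setU/set0]_(i < k) F i.
have aG k : approx (G k).
  rewrite /G; elim: k => [|k IH]; first by rewrite big_ord0.
  by rewrite big_ord_recr/=; exact: approxU.
have mU : measurable (\bigcup_k F k).
  by apply: bigcupT_measurable => k; have [] := aF k.
split=> // e e0; have e20 : 0 < e / 2 by rewrite divr_gt0.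
have [|||k kE] := @small_weighted_dist _ T R lam w w0 wi (fun k => \1_(G k)) (\1_(\bigcup_k F k)) _ _ _ _ e20.
- by move=> k; apply: mind; have [] := aG k.
- by move=> k x; rewrite indicE; case: (_ \in _); rewrite ?lexx ler01.
- move=> x; have [xF|xF] := boolP (x \in \bigcup_k F k).
    have /set_mem[i _ Fix] := xF.
    rewrite indicE xF; apply: cvg_near_cst; near=> k.
    rewrite indicE mem_set//; apply: (@bigsetU_sup _ i) Fix.
    by near: k; exact: nbhs_infty_gt.
  rewrite indicE (negbTE xF); apply: cvg_near_cst; apply: nearW => k.
  rewrite indicE memNset// /G -bigcup_mkord => -[i _ Fix].
  by move/negP: xF; apply; apply/mem_set; exists i.
have [psi [C1psi psi01 psie]] := (aG k).2 _ e20.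
exists psi; split => //; rewrite (splitr e).
apply: (weighted_dist_trans w0 wi _ _ _ kE psie); [exact: mind|by apply: mind; have [] := aG k|exact: C1_measurable].
Unshelve. all: by end_near. Qed.

Lemma C1_approx (A : set 'rV[R]_n) e : measurable A -> 0 < e ->
  exists psi : 'rV[R]_n -> R, [/\ C1 psi, forall x, 0 <= psi x <= 1 &
    (\int[lam]_x (`|\1_A x - psi x| * w x)%:E <= e%:E)%E].
Proof.
move=> mA; suff [_] : approx A by exact.
have sA : sigma_algebra setT approx.
  by split; [exact: approx0|by move=> B; rewrite setTD; exact: approxC|exact: approx_bigcup].
have H i a : approx [set x | a < x ord0 i].
  split=> [|d d0].
    rewrite -[X in measurable X]setTI.
    have := @measurable_coord R n i measurableT _ (measurable_itv `]a, +oo[).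
    by under eq_set do rewrite /= in_itv/= andbT.
  have [|||k kE] := @small_weighted_dist _ T R lam w w0 wi (ramp i a) (\1_[set x | a < x ord0 i]) _ _ _ _ d0.
  - by move=> k; apply: C1_measurable; exact: C1_ramp.
  - by move=> k x; exact: ramp_itv.
  - by move=> x; exact: cvg_ramp.
  by exists (ramp i a k); split => //; [exact: C1_ramp|exact: ramp_itv].
have Hi i (B : set (measurableTypeR R)) : measurable B ->
    approx ((fun x : 'rV[R]_n => x ord0 i) @^-1` B).
  move=> mB; suff sub : (@RGenOInfty.G R).-sigma.-measurable `<=`
      [set B' | approx ((fun x : 'rV[R]_n => x ord0 i) @^-1` B')].
    by apply: sub; rewrite -RGenOInfty.measurableE.
  apply: smallest_sub.
    split => /=; first by rewrite preimage_set0; exact: approx0.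
      by move=> B' HB'; rewrite setTD preimage_setC; exact: approxC.
    by move=> F HF; rewrite preimage_bigcup; exact: approx_bigcup.
  move=> _ [a ->] /=.
  have -> : (fun x : 'rV[R]_n => x ord0 i) @^-1` `]a, +oo[%classic = [set x | a < x ord0 i].
    by apply/seteqP; split => x /=; rewrite in_itv/= andbT.
  exact: H.
suff sub : <<s \big[setU/set0]_(i < n) preimage_set_system setT
    (fun x : 'rV[R]_n => x ord0 i : measurableTypeR R) measurable >> `<=` approx.
  exact: sub.
apply: smallest_sub; first exact: sA.
by rewrite -bigcup_seq => _ [i _ [B mB <-]]; rewrite setTI; exact: Hi.
Qed.

End C1_density.

(** * Integrands dominated by a density *)

Section domination.
Context d (T : measurableType d) (R : realType) (mu : {measure set T -> \bar R}).

Lemma integrable_bounded (G h : T -> R) (c : R) :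
  mu.-integrable setT (EFin \o G) -> measurable_fun setT h ->
  (forall x, `|h x| <= c) -> mu.-integrable setT (fun x => (G x * h x)%:E).
Proof.
move=> Gi mh hc.
have mG : measurable_fun setT G by apply/measurable_EFinP; exact: (measurable_int mu).
apply: (@le_integrable _ _ _ mu setT measurableT _ (fun x => (c%:E * (EFin \o G) x)%E)).
- by apply/measurable_EFinP; exact: measurable_funM.
- move=> x _ /=; rewrite lee_fin !normrM mulrC.
  by rewrite ler_wpM2r// (le_trans (hc x))// ler_norm.
- exact: integrableZl.
Qed.

(** Since [G] vanishes where [f] does, the sets |G| <= k f increase to the whole
    space, and |G| has a small integral outside one of them. *)
Lemma domination (G f : T -> R) (e : R) : mu.-integrable setT (EFin \o G) ->
  measurable_fun setT f -> (forall x, 0 <= f x) -> (forall x, f x = 0 -> G x = 0) ->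
  0 < e -> exists2 m : R, 0 <= m & forall h : T -> R, measurable_fun setT h ->
    (forall x, 0 <= h x <= 1) ->
    (\int[mu]_x (`|G x| * h x)%:E <= m%:E * \int[mu]_x (f x * h x)%:E + e%:E)%E.
Proof.
move=> Gi mf f0 fG e0.
have mG : measurable_fun setT G by apply/measurable_EFinP; exact: (measurable_int mu).
have mnG : measurable_fun setT (fun x => `|G x|) by exact: measurableT_comp.
pose S k := [set x | `|G x| <= k%:R * f x].
have mS k : measurable (S k).
  rewrite -[X in measurable X]setTI; apply: measurable_fun_ler => //.
    exact: measurable_funM.
have [|||||k] := @small_weighted_dist _ T R mu (fun x => `|G x|) _ _
    (fun k => \1_(S k)) (cst 1) e _ _ _ e0.
- by [].
- exact: integrable_norm.
- by move=> k; exact: measurable_indic.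
- by move=> k x; rewrite indicE; case: (_ \in _); rewrite ?lexx ler01.
- move=> x; apply: cvg_near_cst.
  have [fx|fx] := eqVneq (f x) 0.
    by apply: nearW => k; rewrite indicE mem_set// /S/= (fG _ fx) fx normr0 mulr0.
  near=> k; rewrite indicE mem_set// /S /mkset -ler_pdivrMr ?lt0r ?fx ?f0//.
  by near: k; exact: nbhs_infty_ger.
move=> Hk; exists k%:R => // h mh h01.
have mkfh : measurable_fun setT (fun x => (k%:R * (f x * h x))%:E).
  by apply/measurable_EFinP; apply: measurable_funM => //; exact: measurable_funM.
have h0 x : 0 <= h x by have /andP[] := h01 x.
have mSG : measurable_fun setT (fun x => (`|cst 1 x - \1_(S k) x| * `|G x|)%:E).
  apply/measurable_EFinP; apply: measurable_funM => //.
  by apply: measurableT_comp => //; apply: measurable_funB => //; exact: measurable_indic.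
apply: le_trans (leeD2l _ Hk).
rewrite -ge0_integralZl//; last 2 first.
- by apply/measurable_EFinP; exact: measurable_funM.
- by move=> x _; rewrite lee_fin mulr_ge0.
rewrite -ge0_integralD//; try by (move=> x _; rewrite ?mule_ge0 ?lee_fin ?mulr_ge0).
apply: ge0_le_integral => //.
- by move=> x _; rewrite lee_fin mulr_ge0.
- by apply/measurable_EFinP; exact: measurable_funM.
- exact: emeasurable_funD.
move=> x _; rewrite -EFinM -EFinD lee_fin.
have /andP[? h1] := h01 x.
rewrite indicE /=; have [xS|xS] := boolP (x \in S k).
  rewrite subrr normr0 mul0r addr0 mulrA ler_wpM2r//; exact: set_mem xS.
rewrite subr0 normr1 mul1r ler_wpDl ?mulr_ge0// ler_piMr//.
Unshelve. all: by end_near. Qed.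

Lemma Rintegral_dist (G u v : T -> R) (c : R) :
  mu.-integrable setT (EFin \o G) -> measurable_fun setT u -> measurable_fun setT v ->
  (forall x, `|u x| <= c) -> (forall x, `|v x| <= c) ->
  ((`|\int[mu]_x (G x * u x) - \int[mu]_x (G x * v x)|)%:E <=
    \int[mu]_x (`|G x| * `|u x - v x|)%:E)%E.
Proof.
move=> Gi mu' mv uc vc.
have iu := integrable_bounded Gi mu' uc; have iv := integrable_bounded Gi mv vc.
rewrite -RintegralB//.
have -> : \int[mu]_x (G x * u x - G x * v x) = \int[mu]_x (G x * (u x - v x)).
  by apply: eq_Rintegral => x _; rewrite mulrBr.
have iuv : mu.-integrable setT (fun x => (G x * (u x - v x))%:E).
  apply: (@integrable_bounded _ _ (c + c)) => //; first exact: measurable_funB.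
  by move=> x; rewrite (le_trans (ler_normB _ _))// lerD.
have -> : (\int[mu]_x (`|G x| * `|u x - v x|)%:E = \int[mu]_x `|(G x * (u x - v x))%:E|)%E.
  by apply: eq_integral => x _; rewrite /= normrM.
rewrite EFin_normr_Rintegral//; apply: le_abse_integral => //.
exact: (measurable_int mu).
Qed.

End domination.

(** * Weak derivatives and translations *)

Section C1_compact_support.
Context {R : realType} {n : nat}.
Implicit Types (th : 'rV[R]_n -> R) (K : set 'rV[R]_n).

Lemma derive_translate th v z x : 'D_v (fun y => th (y + z)) x = 'D_v th (x + z).
Proof.
have E : (fun h : R => h^-1 *: (th (h *: v + x + z) - th (x + z))) =
    (fun h => h^-1 *: (th (h *: v + (x + z)) - th (x + z))).
  by apply/funext => h; rewrite addrA.
by rewrite /derive /= E.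
Qed.

Lemma C1_translate th z : C1 th -> C1 (fun y => th (y + z)).
Proof.
move=> C1th; split => [x|v].
  apply: (@differentiable_comp _ _ _ _ (fun y : 'rV[R]_n => y + z) th); last exact: C1th.1.
  by apply: differentiableD => //; exact: differentiable_cst.
rewrite (_ : 'D_v _ = 'D_v th \o (fun y => y + z)).
  move=> x; apply: continuous_comp; last exact: C1th.2.
  apply: differentiable_continuous.
  by apply: differentiableD => //; exact: differentiable_cst.
by apply/funext => x; exact: derive_translate.
Qed.

Lemma derive_line th (e x : 'rV[R]_n) (s : R) : C1 th ->
  is_derive s 1 (fun s => th (x + s *: e)) ('D_e th (x + s *: e)).
Proof.
move=> C1th.
have E : (fun h : R => h^-1 *: (th (x + (h *: 1 + s) *: e) - th (x + s *: e))) =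
    (fun h => h^-1 *: (th (h *: e + (x + s *: e)) - th (x + s *: e))).
  apply/funext => h; congr (_ *: (th _ - _)).
  by rewrite scalerDl [h *: 1]mulr1 addrCA.
apply: DeriveDef.
  by rewrite /derivable /= E; exact: (@C1_derivable _ _ th (x + s *: e) e C1th).
by rewrite /derive /= E.
Qed.

Lemma derive_out th K v x : compact K -> (forall y, ~ K y -> th y = 0) -> ~ K x ->
  'D_v th x = 0.
Proof.
move=> cK th0 Kx; rewrite -[RHS](derive_cst (0 : R) x v); apply: near_eq_derive.
have oK : open (~` K) by apply: closed_openC; exact: compact_closed.
have : nbhs x (~` K) by exact: open_nbhs_nbhs.
by apply: filterS => y /th0.
Qed.

Lemma derive_bounded th K v : compact K -> (forall y, ~ K y -> th y = 0) -> C1 th ->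
  exists2 C : R, 0 <= C & forall x, `|'D_v th x| <= C.
Proof.
move=> cK th0 C1th.
have : compact ('D_v th @` K).
  apply: continuous_compact => //; apply: continuous_subspaceT; exact: C1th.2.
move=> /compact_bounded[M [_ HM]].
exists (`|M| + 1); first by rewrite addr_ge0.
move=> x; have [Kx|Kx] := pselect (K x).
  apply: (HM (`|M| + 1)); last by exists x.
  by rewrite ltr_pwDr// ler_norm.
by rewrite (derive_out _ cK th0 Kx) normr0 addr_ge0.
Qed.

Lemma compact_translate K (z : 'rV[R]_n) : compact K -> compact [set x | K (x + z)].
Proof.
move=> cK; have -> : [set x | K (x + z)] = (fun x => x - z) @` K.
  apply/seteqP; split => x /=.
    by move=> Kx; exists (x + z) => //; rewrite addrK.
  by move=> [y Ky <-]; rewrite subrK.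
apply: continuous_compact => //; apply: continuous_subspaceT => x.
apply: differentiable_continuous.
by apply: differentiableB => //; exact: differentiable_cst.
Qed.

End C1_compact_support.

Section weak_derivative_translation.
Context {R : realType} {n : nat}.
Local Notation T := (lebesgue_type R n).
Local Notation lam := (lebesgueN R n).
Variables (f g : 'rV[R]_n -> R) (i : 'I_n).
Hypothesis fi : lam.-integrable setT (EFin \o f).
Hypothesis weak : forall psi : 'rV[R]_n -> R, C1c setT psi ->
  (\int[lam]_x (f x * partial i psi x)%:E = - \int[lam]_x (g x * psi x)%:E)%E.
Let e : 'rV[R]_n := delta_mx ord0 i.

(** The integral of f(x) th(x + s e) is differentiable in s, and its derivative is
    the integral of f(x) (d_i th)(x + s e), that is minus the one of
    g(x) th(x + s e). *)
Lemma weak_translation_MVT (th : 'rV[R]_n -> R) K (a b : R) : C1 th -> compact K ->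
  (forall y, ~ K y -> th y = 0) -> (forall x, `|th x| <= 1) -> a < b ->
  exists2 s, s \in `]a, b[ &
    \int[lam]_x (f x * th (x + b *: e)) - \int[lam]_x (f x * th (x + a *: e)) =
    - (\int[lam]_x (g x * th (x + s *: e))) * (b - a).
Proof.
move=> C1th cK th0 th1 ab.
have [C C0 thC] := derive_bounded e cK th0 C1th.
pose F (s : R) (x : T) := f x * th (x + s *: e).
pose A s := \int[lam]_x (f x * th (x + s *: e)).
have mth s : measurable_fun setT (fun x : T => th (x + s *: e)).
  by apply: C1_measurable; exact: C1_translate.
have dF (s : R) (x : T) : is_derive s 1 (F ^~ x) (f x * 'D_e th (x + s *: e)).
  exact: (@is_deriveZ R R R (fun s => th (x + s *: e)) (f x) s 1 _ (derive_line e x s C1th)).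
have iF s : lam.-integrable setT (EFin \o F s).
  by apply: (integrable_bounded fi (mth s)) => x; exact: th1.
have dA (s : R) : is_derive s 1 A (- \int[lam]_x (g x * th (x + s *: e))).
  have Is : s \in `](s - 1), (s + 1)[ by rewrite in_itv/= ltrDl gtrBl ltr01.
  have d1F t x : partial1of2 F t x = f x * 'D_e th (x + t *: e).
    by rewrite partial1of2E (@derive_val _ _ _ _ _ _ _ (dF t x)).
  have intG : lam.-integrable setT (EFin \o (fun x : T => `|f x| * C)).
    have := integrableZr measurableT C (integrable_norm fi).
    by [].
  have G0 (x : T) : 0 <= `|f x| * C by rewrite mulr_ge0.
  have GF t (x : T) : `](s - 1), (s + 1)[%classic t -> setT x ->
      `|partial1of2 F t x| <= `|f x| * C.
    by move=> _ _; rewrite d1F normrM ler_wpM2l.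
  have derF t (x : T) : `](s - 1), (s + 1)[%classic t -> setT x ->
      derivable (F ^~ x) t 1.
    by move=> _ _; exact: (@ex_derive _ _ _ _ _ _ _ (dF t x)).
  apply: DeriveDef.
    exact: (@derivable_under_integral R _ T lam F setT measurableT s (s - 1) (s + 1) Is
      (fun t _ => iF t) derF _ G0 intG GF).
  rewrite -derive1E.
  rewrite (@differentiation_under_integral R _ T lam F setT measurableT s (s - 1) (s + 1) Is
      (fun t _ => iF t) derF _ G0 intG GF).
  under eq_Rintegral do rewrite d1F.
  have C1c_s : C1c setT (fun x => th (x + s *: e)).
    have [C1s1 C1s2] := C1_translate (s *: e) C1th.
    split => //; exists [set x | K (x + s *: e)]; split => //.
      exact: compact_translate.
    by move=> x Kx; exact: th0.
  have D : (\int[lam]_x (f x * 'D_e th (x + s *: e))%:E =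
      \int[lam]_x (f x * partial i (fun x => th (x + s *: e)) x)%:E)%E.
    by apply: eq_integral => x _; rewrite /partial derive_translate.
  by rewrite /Rintegral D (weak C1c_s) fineN.
have [s sab H] := @MVT R A (fun s => - \int[lam]_x (g x * th (x + s *: e))) a b ab
  (fun s _ => dA s) (@derivable_within_continuous _ _ A `[a, b] (fun s _ => @ex_derive _ _ _ _ _ _ _ (dA s))).
by exists s.
Qed.

End weak_derivative_translation.

Lemma norm_sub_itv01 (R : realDomainType) (p q : R) : 0 <= p <= 1 -> 0 <= q <= 1 ->
  `|p - q| <= 1.
Proof.
by move=> /andP[? ?] /andP[? ?]; rewrite ler_norml; apply/andP; split; lra.
Qed.

(** * The weak gradient vanishes on the zero set *)

Section truncated_distance.
Context d (T : measurableType d) (R : realType) (mu : {measure set T -> \bar R}).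
Variables (f g psi chi : T -> R) (A : set T) (eta : R).
Hypothesis mf : measurable_fun setT f.
Hypothesis mg : measurable_fun setT g.
Hypothesis mpsi : measurable_fun setT psi.
Hypothesis mchi : measurable_fun setT chi.
Hypothesis mA : measurable A.
Hypothesis f0 : forall x, 0 <= f x.
Hypothesis psi0 : forall x, 0 <= psi x.
Hypothesis chi0 : forall x, 0 <= chi x.
Hypothesis Af : forall x, A x -> f x = 0.
Hypothesis psie :
  (\int[mu]_x (`|\1_A x - psi x| * ((1 + f x + `|g x|) * chi x))%:E <= eta%:E)%E.

Let m1A : measurable_fun setT (\1_A : T -> R).
Proof. exact: measurable_indic. Qed.

Let mdw : measurable_fun setT
  (fun x => (`|\1_A x - psi x| * ((1 + f x + `|g x|) * chi x))%:E).
Proof.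
apply/measurable_EFinP; apply: measurable_funM.
  by apply: measurableT_comp => //; exact: measurable_funB.
apply: measurable_funM => //; apply: measurable_funD.
  by apply: measurable_funD => //; exact: measurable_cst.
exact: measurableT_comp.
Qed.

Lemma truncated_mass : (\int[mu]_x (f x * (psi x * chi x))%:E <= eta%:E)%E.
Proof.
apply: le_trans psie; apply: ge0_le_integral => //.
- by move=> x _; rewrite lee_fin !mulr_ge0.
- by apply/measurable_EFinP; apply: measurable_funM => //; exact: measurable_funM.
move=> x _; rewrite lee_fin indicE; have [xA|xA] := boolP (x \in A).
  by rewrite (Af (set_mem xA)) mul0r !mulr_ge0// !addr_ge0.
rewrite sub0r normrN ger0_norm//; have := psi0 x; have := chi0 x; have := f0 x.
have := normr_ge0 (g x); move: (psi x) (chi x) (f x) `|g x| => p q r t t0 r0 q0 p0.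
rewrite [leRHS](_ : _ = r * (p * q) + p * q * (1 + t)); last by ring.
by rewrite lerDl !mulr_ge0// addr_ge0.
Qed.

Lemma truncated_dist :
  (\int[mu]_x ((1 + `|g x|) * `|psi x * chi x - \1_A x * chi x|)%:E <= eta%:E)%E.
Proof.
apply: le_trans psie; apply: ge0_le_integral => //.
- apply/measurable_EFinP; apply: measurable_funM.
    by apply: measurable_funD; [exact: measurable_cst|exact: measurableT_comp].
  apply: measurableT_comp => //.
  by apply: measurable_funB; apply: measurable_funM.
move=> x _; rewrite lee_fin -mulrBl normrM distrC (ger0_norm (chi0 x)).
have := normr_ge0 (g x); have := normr_ge0 (\1_A x - psi x); have := f0 x.
have := chi0 x; move: (chi x) (f x) `|g x| `|_ - _| => q r t u q0 r0 u0 t0.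
rewrite [leRHS](_ : _ = (1 + t) * (u * q) + r * (u * q)); last by ring.
by rewrite lerDl !mulr_ge0.
Qed.

End truncated_distance.

Lemma weighted_ge1 d (T : measurableType d) (R : realType)
    (mu : {measure set T -> \bar R}) (g u v : T -> R) :
  measurable_fun setT g -> measurable_fun setT u -> measurable_fun setT v ->
  (\int[mu]_x (`|u x - v x|)%:E <= \int[mu]_x ((1 + `|g x|) * `|u x - v x|)%:E)%E.
Proof.
move=> mg mu' mv.
have muv : measurable_fun setT (fun x => `|u x - v x|).
  by apply: measurableT_comp => //; exact: measurable_funB.
apply: ge0_le_integral => //.
- exact/measurable_EFinP.
- apply/measurable_EFinP; apply: measurable_funM => //.
  by apply: measurable_funD; [exact: measurable_cst|exact: measurableT_comp].
by move=> x _; rewrite lee_fin ler_peMl// lerDl.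
Qed.

Lemma compact_lebesgue_measurable (R : realType) n (K : set 'rV[R]_n) :
  compact K -> lebesgue_measurable K.
Proof.
move=> cK; apply: (lebesgueN_borel _).1; rewrite -[K]setCK; apply: measurableC.
by apply: open_measurable_rV; apply: closed_openC; exact: compact_closed.
Qed.

Lemma loc_integrable_truncated (R : realType) n (g : 'rV[R]_n -> R) (K : set 'rV[R]_n) :
  loc_integrable g -> compact K ->
  (lebesgueN R n).-integrable setT
    (EFin \o (fun x : lebesgue_type R n => g x * \1_K x)).
Proof.
move=> gi cK; have mK : measurable (K : set (lebesgue_type R n)).
  exact: compact_lebesgue_measurable.
have := gi K cK.
rewrite (integrable_mkcond _ mK); apply: eq_integrable => // x _.
rewrite patchE /= indicE; case: (x \in K) => /=; first by rewrite mulr1.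
by rewrite mulr0.
Qed.

Section weak_gradient_zero_set.
Context {R : realType} {n : nat}.
Local Notation T := (lebesgue_type R n).
Local Notation lam := (lebesgueN R n).
Local Notation L := (borel_lebesgue R n).

Lemma lebesgueN_translation (z : 'rV[R]_n) (k : 'rV[R]_n -> R) :
  measurable_fun setT k -> (forall x, 0 <= k x) ->
  (\int[lam]_x (k (x + z))%:E = \int[lam]_x (k x)%:E)%E.
Proof.
move=> mk k0.
have mkE : measurable_fun setT (EFin \o k) by exact/measurable_EFinP.
have mkz : measurable_fun setT (fun x : 'rV[R]_n => (k (x + z))%:E).
  exact: (measurableT_comp mkE (measurable_addrV z)).
transitivity (\int[L]_x (k (x + z))%:E)%E.
  by apply: ge0_integral_completion => // x _; rewrite lee_fin.
transitivity (\int[L]_x (k x)%:E)%E.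
  by apply: (ge0_integral_translationV z (k := EFin \o k)) => // x; rewrite lee_fin.
by apply/esym; apply: ge0_integral_completion => // x _; rewrite lee_fin.
Qed.

Lemma measurable_cbox (c : R) : measurable (cbox c : set 'rV[R]_n).
Proof. by apply: (@measurable_box R n (fun=> `[- c, c]%classic)). Qed.

Lemma integrable_cbox (c : R) : lam.-integrable setT (EFin \o (\1_(cbox c) : T -> R)).
Proof.
have [mK lK] := lebesgueN_borel (measurable_cbox c).
have E : (\int[lam]_x `|(EFin \o (\1_(cbox c) : T -> R)) x| = L (cbox c))%E.
  rewrite -lK -[X in _ = lam X]setIT -(integral_indic lam measurableT mK).
  by apply: eq_integral => x _; rewrite /= ger0_norm.
apply/integrableP; split; first by apply/measurable_EFinP; exact: measurable_indic.
rewrite E /cbox (@borel_lebesgue_box R n (fun=> `[- c, c]%classic))//.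
rewrite -ge0_fin_numE ?prode_ge0// prode_fin_num// => i _.
by rewrite lebesgue_measure_itv/=; case: ifP.
Qed.

Variables (f g : 'rV[R]_n -> R) (i : 'I_n).
Hypothesis f0 : forall x, 0 <= f x.
Hypothesis fi : lam.-integrable setT (EFin \o f).
Hypothesis gi : loc_integrable g.
Hypothesis weak : forall psi : 'rV[R]_n -> R, C1c setT psi ->
  (\int[lam]_x (f x * partial i psi x)%:E = - \int[lam]_x (g x * psi x)%:E)%E.
Let e : 'rV[R]_n := delta_mx ord0 i.

Section fixed_radius.
Variable c : R.
Hypothesis c0 : 0 < c.
Let K : set 'rV[R]_n := cbox c.
Let K1 : set 'rV[R]_n := cbox (c + 1).
Let chi : 'rV[R]_n -> R := cutoff c.
Let g1 (x : T) : R := g x * \1_K1 x.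

Let chi01 x : 0 <= chi x <= 1. Proof. exact: cutoff_itv. Qed.

Let mchi : measurable_fun setT (chi : T -> R).
Proof. by apply: C1_measurable; exact: C1_cutoff. Qed.

Let g1i : lam.-integrable setT (EFin \o g1).
Proof. by apply: loc_integrable_truncated => //; exact: compact_cbox. Qed.

Let K_K1 x s : `|s| <= 1 -> K (x + s *: e) -> K1 x.
Proof.
move=> s1 Kx j; have := Kx j; rewrite /= !in_itv/= !mxE eqxx/=.
have : `|s * (j == i)%:R| <= 1.
  by rewrite normrM; case: (j == i); rewrite ?normr1 ?mulr1// normr0 mulr0.
by rewrite ler_norml => /andP[h1 h2] /andP[h3 h4]; apply/andP; split; lra.
Qed.

(** One weight that controls at once the mass of f, the integral of g and the
    Lebesgue measure, on the support of [chi]. *)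
Let w (x : T) : R := (1 + f x + `|g1 x|) * chi x.

Let w0 x : 0 <= w x.
Proof. by rewrite mulr_ge0 ?addr_ge0//; have /andP[] := chi01 x. Qed.

Let wi : lam.-integrable setT (EFin \o w).
Proof.
have chi1 x : `|chi x| <= 1.
  by have /andP[h0 h1] := chi01 x; rewrite ger0_norm.
have i1 := integrable_bounded (integrable_cbox c) mchi chi1.
have i2 := integrable_bounded fi mchi chi1.
have i3 := integrable_bounded (integrable_norm g1i) mchi chi1.
have := integrableD measurableT (integrableD measurableT i1 i2) i3.
apply: eq_integrable => // x _ /=; rewrite -!EFinD; congr EFin.
rewrite /w indicE; have [xK|xK] := boolP (x \in cbox c); first by rewrite mulr1n; ring.
rewrite /chi cutoff_out; first by rewrite !mulr0 !addr0.
  exact: c0.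
by move/negP: xK => h h'; apply: h; rewrite inE.
Qed.

(** Since f vanishes on [A], closeness to the indicator of [A] makes the integral
    of f against [th] small. *)
Let approximating (A : set 'rV[R]_n) (eta : R) : measurable A -> 0 < eta ->
  (forall x, A x -> f x = 0) ->
  exists th : 'rV[R]_n -> R, [/\ C1 th, forall x, 0 <= th x <= 1,
    forall x, ~ K x -> th x = 0,
    (\int[lam]_x (f x * th x)%:E <= eta%:E)%E &
    (\int[lam]_x ((1 + `|g1 x|) * `|th x - \1_A x * chi x|)%:E <= eta%:E)%E].
Proof.
move=> mA eta0 Af.
have [psi [C1psi psi01 psie]] := C1_approx w0 wi mA eta0.
have mpsi : measurable_fun setT (psi : T -> R) by exact: C1_measurable.
have mf : measurable_fun setT (f : T -> R) by apply/measurable_EFinP; exact: (measurable_int lam).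
have mg1 : measurable_fun setT g1 by apply/measurable_EFinP; exact: (measurable_int lam).
have psi0 (x : T) : 0 <= psi x by have /andP[] := psi01 x.
have chi0 (x : T) : 0 <= chi x by have /andP[] := chi01 x.
have mA' : measurable (A : set T) by exact: (lebesgueN_borel mA).1.
exists (fun x => psi x * chi x); split.
- by apply: C1M => //; exact: C1_cutoff.
- move=> x; have := psi01 x; have := chi01 x; move: (psi x) (chi x) => p q.
  by move=> /andP[q0 q1] /andP[p0 p1]; apply/andP; split; nra.
- by move=> x Kx; rewrite /chi cutoff_out ?mulr0.
- exact: (truncated_mass mf mg1 mpsi mchi mA' f0 psi0 chi0 Af psie).
- exact: (truncated_dist mf mg1 mpsi mchi mA' f0 chi0 psie).
Qed.

Let U (th : 'rV[R]_n -> R) (s : R) : R := \int[lam]_x (g1 x * th (x + s *: e)).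

(** The distance of [th] and [th'] is measured for Lebesgue measure, which is
    invariant under translations, so bounding |g1| by a constant up to a small
    integral gives an estimate that is uniform in [s]. *)
Let U_dist (eps : R) : 0 < eps -> exists2 m : R, 0 <= m &
  forall (th th' : 'rV[R]_n -> R) (d : R), measurable_fun setT th -> measurable_fun setT th' ->
  (forall x, 0 <= th x <= 1) -> (forall x, 0 <= th' x <= 1) ->
  (\int[lam]_x (`|th x - th' x|)%:E <= d%:E)%E ->
  forall s, `|U th s - U th' s| <= m * d + eps.
Proof.
move=> eps0.
have n10 (x : T) : (1 : R) = 0 -> g1 x = 0 by move/eqP; rewrite oner_eq0.
have [m m0 Hm] := domination g1i (@measurable_cst _ _ T _ setT (1 : R))
  (fun _ => ler01) n10 eps0.
exists m => // th th' d mth mth' th01 th01' thd s.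
have mt (k : 'rV[R]_n -> R) : measurable_fun setT k ->
    measurable_fun setT (fun x : 'rV[R]_n => k (x + s *: e)).
  by move=> mk; exact: (measurableT_comp mk (measurable_addrV _)).
have b1 (k : 'rV[R]_n -> R) : (forall x, 0 <= k x <= 1) -> forall x : T, `|k (x + s *: e)| <= 1.
  by move=> k01 x; have /andP[k0 k1] := k01 (x + s *: e); rewrite ger0_norm.
have H1 := Rintegral_dist g1i (measurable_fun_lebesgue (mt _ mth))
  (measurable_fun_lebesgue (mt _ mth')) (b1 _ th01) (b1 _ th01').
rewrite -lee_fin; apply: (le_trans H1).
have mh : measurable_fun setT (fun x : 'rV[R]_n => `|th x - th' x|).
  apply: measurableT_comp; first exact: normr_measurable.
  exact: measurable_funB.
have H2 := Hm _ (measurable_fun_lebesgue (mt _ mh)).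
apply: (le_trans (H2 _)).
  move=> x; rewrite normr_ge0/=.
  by apply: norm_sub_itv01; [exact: th01|exact: th01'].
rewrite EFinD EFinM leeD2r// lee_wpmul2l ?lee_fin//.
under eq_integral do rewrite mul1r.
by rewrite (lebesgueN_translation _ mh).
Qed.

Let U_continuous (th : 'rV[R]_n -> R) : C1 th -> (forall x, 0 <= th x <= 1) ->
  {for 0, continuous (U th)}.
Proof.
move=> C1th th01.
have b1 s (x : T) : `|th (x + s *: e)| <= 1.
  by have /andP[k0 k1] := th01 (x + s *: e); rewrite ger0_norm.
have mth s : measurable_fun setT (fun x : T => th (x + s *: e)).
  by apply: C1_measurable; exact: C1_translate.
have I0 : (0 : R) \in (`]-1, 1[%classic : set R).
  by rewrite inE/= in_itv/= ltr01 ltrN10.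
apply: (@continuity_under_integral R _ T lam (fun s x => g1 x * th (x + s *: e)) setT
  measurableT (-1) 1 (fun s _ => integrable_bounded g1i (mth s) (b1 s)) _
  (fun x => `|g1 x|) (integrable_norm g1i) _ 0 I0).
- apply: aeW => x _ s _.
  have [d _] := @is_deriveZ R R R (fun s => th (x + s *: e)) (g1 x) s 1 _ (derive_line e x s C1th).
  by apply: differentiable_continuous; apply/derivable1_diffP.
- move=> s _; apply: aeW => x _; rewrite normrM ler_piMr//; exact: b1.
Qed.

(** The radius s0 must not depend on [th], as a better [th] is chosen once s0 is
    known. It comes from the continuity in s for one fixed [th0], and is passed on
    to every good [th] by the uniform estimate. *)
Lemma U_near (A : set 'rV[R]_n) (eps : R) : measurable A -> (forall x, A x -> f x = 0) ->
  0 < eps -> exists s0 eta : R, [/\ 0 < s0, s0 < 1, 0 < eta &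
   forall th : 'rV[R]_n -> R, C1 th -> (forall x, 0 <= th x <= 1) ->
     (\int[lam]_x ((1 + `|g1 x|) * `|th x - \1_A x * chi x|)%:E <= eta%:E)%E ->
     forall s, `|s| <= s0 ->
     `|U th s - \int[lam]_x (g1 x * (\1_A x * chi x))| <= eps].
Proof.
move=> mA Af eps0.
pose d := eps / 8; have d0 : 0 < d by rewrite divr_gt0.
have [m m0 Hm] := U_dist d0.
pose eta := d / (m + 1); have m10 : 0 < m + 1 by rewrite ltr_wpDl.
have eta0 : 0 < eta by rewrite divr_gt0.
have meta : m * eta <= d.
  rewrite /eta mulrCA ler_piMr ?(ltW d0)//.
  by rewrite ler_pdivrMr// mul1r lerDl.
pose v x : R := \1_A x * chi x.
have mv : measurable_fun setT (v : 'rV[R]_n -> R).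
  apply: measurable_funM; first exact: measurable_indic.
  by apply: continuous_measurable_rV; apply: C1_continuous; exact: C1_cutoff.
have v01 x : 0 <= v x <= 1.
  rewrite /v indicE; case: (x \in A); rewrite ?mul1r ?mul0r//.
  by rewrite lexx ler01.
have mv' : measurable_fun setT (v : T -> R) by exact: measurable_fun_lebesgue.
have mg1 : measurable_fun setT g1 by apply/measurable_EFinP; exact: (measurable_int lam).
have close (th : 'rV[R]_n -> R) : C1 th -> (forall x, 0 <= th x <= 1) ->
    (\int[lam]_x ((1 + `|g1 x|) * `|th x - \1_A x * chi x|)%:E <= eta%:E)%E ->
    forall s, `|U th s - U v s| <= 2 * d.
  move=> C1th th01 the s.
  have mth : measurable_fun setT (th : 'rV[R]_n -> R).
    by apply: continuous_measurable_rV; exact: C1_continuous.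
  have H : (\int[lam]_x (`|th x - v x|)%:E <= eta%:E)%E.
    apply: le_trans the.
    exact: (@weighted_ge1 _ T R lam g1 th v mg1 (measurable_fun_lebesgue mth) mv').
  by apply: (le_trans (Hm th v eta mth mv th01 v01 H s)); rewrite mulrDl mul1r lerD2r.
have [th0 [C1th0 th001 _ _ th0e]] := approximating mA eta0 Af.
have /cvgrPdist_le/(_ d d0)/nbhs_ballP[s1 /= s10 Hs1] := U_continuous C1th0 th001.
have Bv : \int[lam]_x (g1 x * (\1_A x * chi x)) = U v 0.
  by apply: eq_Rintegral => x _; rewrite scale0r addr0.
exists (Num.min (s1 / 2) 2^-1), eta; split => //.
- by rewrite lt_min invr_gt0 divr_gt0//=.
- by rewrite gt_min; apply/orP; right; rewrite invf_lt1// ltr1n.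
move=> th C1th th01 the s; rewrite le_min => /andP[sle _].
rewrite Bv; have h1 := close _ C1th th01 the s.
have h2 := close _ C1th0 th001 th0e s; have h3 := close _ C1th0 th001 th0e 0.
have h4 : `|U th0 0 - U th0 s| <= d.
  apply: Hs1; rewrite /ball/= sub0r normrN (le_lt_trans sle)//.
  by rewrite ltr_pdivrMr// ltr_pMr// ltr1n.
have hd : eps = 8 * d by rewrite /d mulrCA divff ?mulr1// pnatr_eq0.
rewrite hd; move: h1 h2 h3 h4 d0; clear.
move: (U th s) (U v s) (U th0 s) (U th0 0) (U v 0) d => a1 a2 a3 a4 a5 d'.
rewrite !ler_norml => /andP[? ?] /andP[? ?] /andP[? ?] /andP[? ?] ?.
by apply/andP; split; lra.
Qed.

(** The nonnegative function a(s) is at most eps s0 at 0. By the mean value theorem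
    on [0, s0] and on [-s0, 0], its derivative, which is close to the constant
    -B0, is at least -eps somewhere on the right and at most eps somewhere on the
    left. *)
Lemma zero_set_integral (A : set 'rV[R]_n) : measurable A -> (forall x, A x -> f x = 0) ->
  \int[lam]_x (g1 x * (\1_A x * chi x)) = 0.
Proof.
move=> mA Af; set B0 := Rintegral _ _ _.
suff H (eps : R) : 0 < eps -> `|B0| <= 2 * eps.
  apply/eqP; rewrite -normr_eq0 -[_ == _]negbK -normr_gt0 normr_id; apply/negP => B00.
  have := H _ (divr_gt0 B00 (ltr0n R 4)); move: `|B0| B00 => b b0 h; lra.
move=> eps0; have [s0 [eta0 [s00 s01 eta00 HU]]] := U_near mA Af eps0.
pose eta := Num.min eta0 (eps * s0).
have eta_gt0 : 0 < eta by rewrite lt_min eta00 mulr_gt0.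
have [th [C1th th01 thK fth gth]] := approximating mA eta_gt0 Af.
have thn1 x : `|th x| <= 1 by have /andP[h0 h1] := th01 x; rewrite ger0_norm.
have HUs := HU th C1th th01 (le_trans gth (_ : (eta%:E <= eta0%:E)%E)).
have {}HUs s : `|s| <= s0 -> `|U th s - B0| <= eps.
  by apply: HUs; rewrite lee_fin ge_min lexx.
pose a s := \int[lam]_x (f x * th (x + s *: e)).
have a_ge0 s : 0 <= a s.
  by apply: Rintegral_ge0 => x _; rewrite mulr_ge0//; have /andP[] := th01 (x + s *: e).
have a0 : a 0 <= eps * s0.
  have i0 : lam.-integrable setT (fun x : T => (f x * th x)%:E).
    exact: (integrable_bounded fi (C1_measurable C1th) thn1).
  have -> : a 0 = \int[lam]_x (f x * th x).
    by apply: eq_Rintegral => x _; rewrite scale0r addr0.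
  rewrite -lee_fin fineK; last exact: integrable_fin_num.
  by apply: (le_trans fth); rewrite lee_fin ge_min lexx orbT.
have gU s : `|s| <= s0 -> \int[lam]_x (g x * th (x + s *: e)) = U th s.
  move=> ss0; apply: eq_Rintegral => x _; rewrite /g1 indicE.
  have [xK|xK] := boolP (x \in K1); first by rewrite mulr1.
  rewrite thK ?mulr0// => Kx; move/negP: xK; apply; apply/mem_set.
  by apply: K_K1 Kx; rewrite (le_trans ss0)// ltW.
have [s] := weak_translation_MVT fi weak C1th (@compact_cbox R n c) thK thn1 s00.
rewrite in_itv/= => /andP[sl sr].
have sn : `|s| <= s0 by rewrite ger0_norm ltW.
rewrite (gU _ sn) -/(a s0) -/(a 0) subr0 => E1.
have ns00 : - s0 < 0 by rewrite oppr_lt0.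
have [t] := weak_translation_MVT fi weak C1th (@compact_cbox R n c) thK thn1 ns00.
rewrite in_itv/= => /andP[tl tr].
have tn : `|t| <= s0 by rewrite ltr0_norm// lerNl ltW.
rewrite (gU _ tn) -/(a (- s0)) -/(a 0) sub0r opprK => E2.
have := HUs _ sn; have := HUs _ tn; have := a_ge0 s0; have := a_ge0 (- s0).
move: E1 E2 a0 s00 eps0; clear.
move: (U th s) (U th t) (a s0) (a (- s0)) (a 0) B0 => u1 u2 a1 a2 a3 b E1 E2 a0 s00 eps0 h2 h1.
rewrite !ler_norml => /andP[? ?] /andP[? ?].
have l1 : u1 <= eps by rewrite -(ler_pM2r s00); lra.
have l2 : - eps <= u2 by rewrite -(ler_pM2r s00); lra.
by clear E1 E2; apply/andP; split; lra.
Qed.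

End fixed_radius.

End weak_gradient_zero_set.

Section weak_gradient_null.
Context {R : realType} {n : nat}.
Local Notation T := (lebesgue_type R n).
Local Notation lam := (lebesgueN R n).
Variables (f g : 'rV[R]_n -> R) (i : 'I_n).
Hypothesis f0 : forall x, 0 <= f x.
Hypothesis fi : lam.-integrable setT (EFin \o f).
Hypothesis gi : loc_integrable g.
Hypothesis weak : forall psi : 'rV[R]_n -> R, C1c setT psi ->
  (\int[lam]_x (f x * partial i psi x)%:E = - \int[lam]_x (g x * psi x)%:E)%E.

(** On the part of {f = 0} where s g > 0 the integrand of [zero_set_integral] has a
    constant sign, so the vanishing of its integral makes that part null. *)
Let signed_null (c s : R) : 0 < c -> exists2 M : set T,
  lam.-negligible M & forall x, f x = 0 ->
    0 < s * (g x * \1_(cbox (c + 1)) x) -> 0 < cutoff c x -> M x.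
Proof.
move=> c0; set g1 := fun x : T => g x * \1_(cbox (c + 1)) x.
have g1i : lam.-integrable setT (EFin \o g1).
  by apply: loc_integrable_truncated => //; exact: compact_cbox.
have mg1 : measurable_fun setT g1 by apply/measurable_EFinP; exact: (measurable_int lam).
have mf : measurable_fun setT (f : T -> R).
  by apply/measurable_EFinP; exact: (measurable_int lam).
have mA0 : measurable [set x : T | f x = 0 /\ 0 < s * g1 x].
  have -> : [set x : T | f x = 0 /\ 0 < s * g1 x] =
      (f @^-1` [set 0]) `&` ((fun x => s * g1 x) @^-1` `]0, +oo[%classic).
    by apply/seteqP; split => x /=; rewrite in_itv/= andbT.
  apply: measurableI; rewrite -[X in measurable X]setTI.
    exact: (mf measurableT _ (measurable_set1 0)).
  have msg : measurable_fun setT (fun x => s * g1 x).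
    exact: (measurable_funM (measurable_cst _) mg1).
  exact: (msg measurableT _ (measurable_itv _)).
have [N [mN N0 mA]] := measurable_completion mA0.
set A : set 'rV[R]_n := _ `\` N in mA.
have Af x : A x -> f x = 0 by move=> [[]].
have I0 := zero_set_integral f0 fi gi weak c0 mA Af.
have [mN' lN] := lebesgueN_borel mN.
have mA' : measurable (A : set T) by exact: (lebesgueN_borel mA).1.
have mv : measurable_fun setT (fun x : T => \1_A x * cutoff c x).
  by apply: (measurable_funM (measurable_indic mA')); exact: C1_measurable (C1_cutoff _).
have v01 (x : T) : 0 <= \1_A x * cutoff c x <= 1.
  rewrite indicE; case: (x \in A); rewrite ?mul1r ?mul0r; first exact: cutoff_itv.
  by rewrite lexx ler01.
have vn (x : T) : `|\1_A x * cutoff c x| <= 1.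
  by have /andP[v0 v1] := v01 x; rewrite ger0_norm.
have ih := integrable_bounded g1i mv vn.
pose h (x : T) : \bar R := (s%:E * (g1 x * (\1_A x * cutoff c x))%:E)%E.
have mh : measurable_fun setT h.
  by apply: measurable_funeM; exact: (measurable_int lam).
have h0 (x : T) : (0 <= h x)%E.
  rewrite /h -EFinM lee_fin mulrA indicE.
  have [xA|xA] := boolP (x \in A); last by rewrite mul0r mulr0.
  have [[_ h1] _] := set_mem xA; rewrite mul1r mulr_ge0 ?(ltW h1)//.
  by have /andP[] := cutoff_itv c x.
have ih0 : (\int[lam]_x h x = 0)%E.
  rewrite integralZl//.
  have -> : (\int[lam]_x (g1 x * (\1_A x * cutoff c x))%:E = 0)%E.
    by rewrite -[LHS]fineK; [congr EFin; exact: I0|exact: integrable_fin_num].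
  by rewrite mule0.
have H0 := ge0_integral_eq0_null mh h0 ih0.
have mH : measurable [set x : T | h x != 0%E].
  by rewrite -[X in measurable X]setTI; exact: emeasurable_neq.
exists ((N : set T) `|` [set x : T | h x != 0%E]).
  have nN : lam.-negligible (N : set T) by exists N; split=> //; rewrite -N0; exact: lN.
  have nH : lam.-negligible [set x : T | h x != 0%E].
    exists [set x : T | h x != 0%E]; split; [exact: mH|exact: H0|exact: subset_refl].
  exact: negligibleU nN nH.
move=> x fx gx cx; have [Nx|Nx] := pselect (N x); first by left.
right; rewrite /= /h -EFinM eqe mulrA.
have xA : x \in A by apply/mem_set.
by rewrite indicE xA mul1r mulf_neq0// gt_eqF.
Qed.

Lemma weak_partial_zero_set : {ae lam, forall x, f x = 0 -> g x = 0}.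
Proof.
have kgt0 (k : nat) : (0 : R) < k.+1%:R by [].
have HM k : exists M : set T, lam.-negligible M /\ forall x, f x = 0 ->
    0 < 1 * (g x * \1_(cbox (k.+1%:R + 1)) x) -> 0 < cutoff k.+1%:R x -> M x.
  by have [M ? ?] := signed_null 1 (kgt0 k); exists M.
have HP k : exists M : set T, lam.-negligible M /\ forall x, f x = 0 ->
    0 < (-1) * (g x * \1_(cbox (k.+1%:R + 1)) x) -> 0 < cutoff k.+1%:R x -> M x.
  by have [M ? ?] := signed_null (-1) (kgt0 k); exists M.
have [M {}HM] := choice HM; have [P {}HP] := choice HP.
have [B [mB B0 sB]] : lam.-negligible (\bigcup_k (M k `|` P k)).
  apply: (negligible_bigcup (mu := lam)) => k.
  exact: negligibleU (HM k).1 (HP k).1.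
exists B; split; [exact: mB|exact: B0|].
move=> x /= /not_implyP[fx gx]; apply: sB.
pose k := Num.truncn (dotp x x).
have dk : dotp x x < k.+1%:R ^+ 2.
  apply: (lt_le_trans (truncnS_gt _)).
  by rewrite expr2 ler_peMl// ler1n.
have cx : 0 < cutoff k.+1%:R x by exact: cutoff_gt0.
have xK : \1_(cbox (k.+1%:R + 1)) x = 1 :> R.
  rewrite indicE mem_set// => j.
  have : cbox k.+1%:R x.
    by apply: contrapT => /(cutoff_out (kgt0 k)) c0; rewrite c0 ltxx in cx.
  move=> /(_ j); rewrite /= !in_itv/= => /andP[h1 h2].
  by rewrite (le_trans h2) ?lerDl// (le_trans _ h1)// lerN2 lerDl.
exists k => //; have [g0|g0|//] := ltgtP (g x) 0.
  by right; apply: (HP k).2 => //; rewrite xK mulr1 mulN1r oppr_gt0.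
by left; apply: (HM k).2 => //; rewrite xK mulr1 mul1r.
Qed.

End weak_gradient_null.

(** * Lower semicontinuity of the perimeter *)

Section integral_stable.
Context d (T : measurableType d) (R : realType) (mu : {measure set T -> \bar R}).
Variables (G f : T -> R).
Hypothesis Gi : mu.-integrable setT (EFin \o G).
Hypothesis mf : measurable_fun setT f.
Hypothesis f0 : forall x, 0 <= f x.
Hypothesis fG : {ae mu, forall x, f x = 0 -> G x = 0}.

Let density_measure_indic A : measurable A ->
  density_measure mu f A = (\int[mu]_x (f x * \1_A x)%:E)%E.
Proof.
move=> mA; rewrite /density_measure integral_mkcond; apply: eq_integral => x _.
by rewrite patchE indicE; case: (x \in A); rewrite ?mulr1 ?mulr0.
Qed.

(** The difference of the two integrals is at most the integral of |G| over the
    symmetric difference of [A] and [B], which [domination] bounds by a multiple of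
    its f-mass. *)
Lemma integral_stable (e : R) : 0 < e -> exists2 dl : R, 0 < dl & forall A B : set T,
  measurable A -> measurable B -> (density_measure mu f (A `\` B) < dl%:E)%E ->
  (density_measure mu f (B `\` A) < dl%:E)%E ->
  (\int[mu]_x (\1_A x * G x)%:E <= \int[mu]_x (\1_B x * G x)%:E + e%:E)%E.
Proof.
move=> e0.
have mZ : measurable [set x | f x != 0].
  have -> : [set x | f x != 0] = ~` (f @^-1` [set 0]).
    by apply/seteqP; split => x /= /eqP.
  by apply: measurableC; rewrite -[X in measurable X]setTI; exact: mf.
pose G' x := G x * \1_[set x | f x != 0] x.
have G'i : mu.-integrable setT (EFin \o G').
  apply: (@integrable_bounded _ _ _ _ _ _ 1 Gi); first exact: measurable_indic.
  by move=> x; rewrite indicE; case: (_ \in _); rewrite ?normr1 ?normr0.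
have G'0 x : f x = 0 -> G' x = 0.
  by move=> fx; rewrite /G' indicE memNset ?mulr0//= fx eqxx.
have mG : measurable_fun setT G by apply/measurable_EFinP; exact: (measurable_int mu).
have mG' : measurable_fun setT G' by apply/measurable_EFinP; exact: (measurable_int mu).
have ind1 (A : set T) x : `|\1_A x| <= 1 :> R.
  by rewrite indicE; case: (_ \in _); rewrite ?normr1 ?normr0.
have GG' (A : set T) : measurable A ->
    (\int[mu]_x (\1_A x * G x)%:E = (\int[mu]_x (G' x * \1_A x))%:E)%E.
  move=> mA; rewrite fineK; last first.
    apply: integrable_fin_num => //.
    exact: (integrable_bounded G'i (measurable_indic mA) (ind1 A)).
  apply: ae_eq_integral => //.
  - by apply/measurable_EFinP; apply: measurable_funM => //; exact: measurable_indic.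
  - by apply/measurable_EFinP; apply: measurable_funM => //; exact: measurable_indic.
  apply: filterS fG => x fGx _; congr EFin; rewrite /G' mulrC; congr (_ * _).
  rewrite indicE; have [fx|fx] := eqVneq (f x) 0; first by rewrite fGx// mul0r.
  by rewrite mem_set// mulr1.
have e20 : 0 < e / 2 by rewrite divr_gt0.
have [m m0 Hm] := domination G'i mf f0 G'0 e20.
have m10 : 0 < m + 1 by rewrite ltr_wpDl.
pose dl := e / 4 / (m + 1).
have dl0 : 0 < dl by rewrite !divr_gt0.
have mdl : m * (dl + dl) <= e / 2.
  rewrite /dl -mulrDl mulrCA (_ : e / 4 + e / 4 = e / 2); last by lra.
  by rewrite ler_piMr ?(ltW e20)// ler_pdivrMr// mul1r lerDl.
exists dl => // A B mA mB AB BA.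
rewrite (GG' _ mA) (GG' _ mB) -EFinD lee_fin -lerBlDl.
apply: (le_trans (ler_norm _)).
rewrite -lee_fin; apply: (le_trans (Rintegral_dist G'i (measurable_indic mA)
  (measurable_indic mB) (ind1 A) (ind1 B))).
have mAB : measurable_fun setT (fun x => `|\1_A x - \1_B x| : R).
  by apply: measurableT_comp => //; apply: measurable_funB; exact: measurable_indic.
apply: (le_trans (Hm _ mAB _)).
  by move=> x; rewrite normr_ge0/= !indicE; case: (_ \in _); case: (_ \in _);
    rewrite ?subrr ?normr0 ?subr0 ?sub0r ?normrN ?normr1 ?ler01.
rewrite [leRHS](_ : _ = (e / 2)%:E + (e / 2)%:E)%E; last by rewrite -EFinD -splitr.
apply: leeD2r; apply: (@le_trans _ _ (m * (dl + dl))%:E%E); last by rewrite lee_fin.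
rewrite EFinM lee_wpmul2l ?lee_fin//.
have -> : (\int[mu]_x (f x * `|\1_A x - \1_B x|)%:E =
    density_measure mu f (A `\` B) + density_measure mu f (B `\` A))%E.
  have mAD := measurableD mA mB; have mBD := measurableD mB mA.
  rewrite !density_measure_indic// -ge0_integralD//.
  - apply: eq_integral => x _; rewrite -EFinD -mulrDr; congr (_ * _)%:E.
    rewrite !indicE !in_setD; case: (x \in A); case: (x \in B) => /=;
      by rewrite ?subrr ?normr0 ?subr0 ?sub0r ?normrN ?normr1 ?addr0 ?add0r.
  - by move=> x _; rewrite lee_fin mulr_ge0.
  - by apply/measurable_EFinP; apply: measurable_funM => //; exact: measurable_indic.
  - by move=> x _; rewrite lee_fin mulr_ge0.
  - by apply/measurable_EFinP; apply: measurable_funM => //; exact: measurable_indic.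
by rewrite EFinD leeD// ltW.
Qed.

End integral_stable.

Section test_fields.
Context {R : realType} {n : nat}.
Local Notation T := (lebesgue_type R n).
Local Notation lam := (lebesgueN R n).
Variables (f : 'rV[R]_n -> R) (phi : 'rV[R]_n -> 'rV[R]_n).
Hypothesis hf : class_W f.
Hypothesis C1phi : C1c setT phi.
Hypothesis phi1 : forall x, enorm (phi x) <= 1.

Let C1_component i : C1 (fun y => phi y ord0 i).
Proof.
have [dphi cphi _] := C1phi; split => [x|v].
  apply: (@differentiable_comp _ _ _ _ phi (fun y : 'rV[R]_n => y ord0 i)) => //.
  exact: (C1_coord i).1.
rewrite (_ : 'D_v _ = fun x => ('D_v phi x) ord0 i).
  move=> x; apply: (@continuous_comp _ _ _ ('D_v phi) (fun y : 'rV[R]_n => y ord0 i)).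
    exact: cphi.
  exact: coord_continuous.
by apply/funext => x; rewrite derive_mx ?mxE//; exact: diff_derivable.
Qed.

Let component_le1 i x : `|phi x ord0 i| <= 1.
Proof.
have : dotp (phi x) (phi x) <= 1.
  by rewrite -[leLHS]sqr_sqrtr ?dotp_ge0// expr_le1// ?phi1// sqrtr_ge0.
apply: contraTT; rewrite -!ltNge => h.
rewrite /dotp (bigD1 i)//= ltr_wpDr//.
  by apply: sumr_ge0 => j _; rewrite -expr2 sqr_ge0.
by rewrite -expr2 -real_normK ?num_real// exprn_egt1.
Qed.

Let test_integrand x := divergence phi x * f x + dotp (phi x) (grad f x).

Let weak_grad : weak_gradient f (grad f).
Proof. by have [_ _ [_ ex] _] := hf; exact: xgetPex. Qed.

Lemma test_integrand_integrable : lam.-integrable setT (EFin \o (test_integrand : T -> R)).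
Proof.
have [_ fi _ _] := hf; have [_ _ [K [cK _ phiK]]] := C1phi.
have h1 i : lam.-integrable setT (fun x : T => (f x * partial i (fun y => phi y ord0 i) x)%:E).
  have [|C C0 HC] := derive_bounded (delta_mx ord0 i) cK _ (C1_component i).
    by move=> y Ky; rewrite phiK// mxE.
  apply: (integrable_bounded fi _ HC); apply: measurable_fun_lebesgue.
  by apply: continuous_measurable_rV; exact: (C1_component i).2.
have h2 i : lam.-integrable setT (fun x : T => (phi x ord0 i * grad f x ord0 i)%:E).
  have gi := loc_integrable_truncated (weak_grad i).1 cK.
  have := integrable_bounded gi (C1_measurable (C1_component i)) (component_le1 i).
  apply: eq_integrable => // x _; congr EFin; rewrite indicE mulrC.
  have [xK|xK] := boolP (x \in K); first by rewrite mulr1.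
  rewrite phiK ?mxE ?mul0r// => Kx; move/negP: xK; apply; exact/mem_set.
have s1 : lam.-integrable setT
    (fun x : T => \sum_i (f x * partial i (fun y => phi y ord0 i) x)%:E)%E.
  by apply: integrable_sum => // i _; exact: h1.
have s2 : lam.-integrable setT (fun x : T => \sum_i (phi x ord0 i * grad f x ord0 i)%:E)%E.
  by apply: integrable_sum => // i _; exact: h2.
have := integrableD measurableT s1 s2.
apply: eq_integrable => // x _.
rewrite /= !sumEFin -EFinD /test_integrand /divergence mulr_suml /dotp; congr (_ + _)%:E.
by apply: eq_bigr => i _; rewrite mulrC.
Qed.

Lemma test_integrand_zero : {ae lam, forall x, f x = 0 -> test_integrand x = 0}.
Proof.
have [f_ge0 fi _ _] := hf.
have H i := weak_partial_zero_set f_ge0 fi (weak_grad i).1 (weak_grad i).2.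
have [N [mN N0 sN]] : {ae lam, forall x, forall i : 'I_n, f x = 0 -> grad f x ord0 i = 0}.
  exact: filter_forall H.
exists N; split; [exact: mN|exact: N0|move=> x /= nx; apply: sN => /= Hx; apply: nx => fx].
rewrite /test_integrand fx mulr0 add0r /dotp big1// => i _.
by rewrite Hx// mulr0.
Qed.

End test_fields.

Theorem lemma3p1 (R : realType) (n : nat) (hn : (2 <= n)%N)
    (f : 'rV[R]_n -> R) (hf : PS_measure f)
    (v : 'rV[R]_n) (hv : enorm v = 1)
    (E : set 'rV[R]_n) (mE : lebesgue_measurable E) :
  (wperimeter f (halfspace_of f E v) setT <= wperimeter f E setT)%E.
Proof.
have [Wf _] := hf; have [f0 fi _ _] := Wf.
have [->|Eoo] := eqVneq (wperimeter f E setT) +oo%E; first exact: leey.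
have {}Eoo : (wperimeter f E setT < +oo)%E by rewrite ltey.
apply: ge_ereal_sup => _ [phi [C1phi phi1] <-].
have mf : measurable_fun setT (f : lebesgue_type R n -> R).
  by apply/measurable_EFinP; exact: (measurable_int (lebesgueN R n)).
have mH : lebesgue_measurable (halfspace_of f E v).
  exact: (lebesgueN_borel (measurable_halfspace _ _)).1.
apply/lee_addgt0Pr => e e0.
have [dl dl0 Hdl] := integral_stable (test_integrand_integrable Wf C1phi phi1) mf f0
  (test_integrand_zero phi Wf) e0.
have [E' [mE' perE' E'H HE']] := PS_approx_halfspace hf hv mE Eoo dl0.
apply: (le_trans (Hdl _ _ mH mE' HE' E'H)); apply: leeD2r.
by apply: le_trans perE'; apply: ereal_sup_ubound; exists phi.
Qed.
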